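(* Let $\psi:\mathbb{R}\to\mathbb{R}_+$ be a convex function of the form $\psi(u)=u^2\theta(u)$ for $u>0$, with some function $\theta(\cdot)$ which is not necessarily slowly varying. Suppose that for some real numbers $\alpha^{\diamond},\alpha_{\diamond}$ one of the following conditions holds: $$-\tfrac12<\alpha^{\diamond},\quad \alpha_{\diamond}\le\alpha^{\diamond}<\alpha_{\diamond}+\tfrac13,$$ or $$-1<\alpha^{\diamond}\le-\tfrac12,\quad \alpha_{\diamond}\le\alpha^{\diamond}<3\alpha_{\diamond}+2.$$ Assume that $$|\log u|^{\alpha_{\diamond}}\ll\theta(u)\ll|\log u|^{\alpha^{\diamond}},\quad u\to0 \ (u>0).$$ Let $m_{\psi}(b):=\int_1^b a\,\psi(a^{-1})\,\mathrm{d}a$ for $b\ge1$. If $\lim_{b\to\infty}m_{\psi}(b)=\infty$, then for any $r>0$, almost surely $$\lim_{T\to\infty}\frac{I_W^{\psi}(T,r)}{m_{\psi}(T^{1/2})}=1.$$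
   Context: $W(\cdot)$ is a standard Wiener process on $[0,\infty)$ with $W(0)=0$. $AC[0,T]$ is the space of absolutely continuous functions on $[0,T]$. $\mathbb{R}_+=[0,\infty)$. For convex $\psi:\mathbb{R}\to\mathbb{R}_+$ and $h\in AC[0,T]$, $|h|_T^{\psi}:=\int_0^T\psi(h'(t))\,\mathrm{d}t$. For $T,r>0$, $I_W^{\psi}(T,r):=\inf\{|h|_T^{\psi}: h\in AC[0,T],\ h(0)=r,\ h(t)\ge W(t)\ \text{for all } t\in[0,T]\}$ (a random variable; equivalently one may require $h(0)=0$ and $h\ge W-r$). The notation $f\ll g$ means $f=O(g)$ in the indicated limit. *)

(* Defs.v *)
From HB Require Import structures.
From mathcomp Require Import all_boot all_order all_algebra.
From mathcomp Require Import all_classical all_reals all_analysis.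

Set Implicit Arguments.
Unset Strict Implicit.
Unset Printing Implicit Defensive.

Import Order.TTheory GRing.Theory Num.Theory.
Import numFieldNormedType.Exports.

Local Open Scope classical_set_scope.
Local Open Scope ring_scope.

(* As B i may be setT, the product rule for the full family contains the one
   for every subfamily. *)
Definition mutually_independent (R : realType) (d : measure_display)
    (Omega : measurableType d) (P : probability Omega R)
    (I : finType) (X : I -> Omega -> R) : Prop :=
  forall B : I -> set R, (forall i, measurable (B i)) ->
    P (\bigcap_i (X i @^-1` B i)) = (\prod_(i : I) P (X i @^-1` B i))%E.

(* The time parameter is the half-line [0, +oo[: the values of W at negative
   times are unconstrained and never used.  The second parameter of
   normal_prob is the standard deviation. *)
Record standard_wiener (R : realType) (d : measure_display)
    (Omega : measurableType d) (P : probability Omega R)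
    (W : R -> {RV P >-> R}) : Prop := StandardWiener {
  wiener_start : {ae P, forall omega, W 0 omega = 0};
  wiener_increments_independent : forall (n : nat) (t : nat -> R),
    0 <= t 0%N -> {homo t : i j / (i <= j)%N >-> i <= j} ->
    mutually_independent P
      (fun (i : 'I_n) omega => W (t i.+1) omega - W (t i) omega);
  wiener_increments_normal : forall s t : R, 0 <= s -> s < t ->
    forall B : set R, measurable B ->
      pushforward P (fun omega => W t omega - W s omega) B =
        normal_prob 0 (Num.sqrt (t - s)) B;
  wiener_continuous : {ae P, forall omega,
    {within `[0, +oo[, continuous (fun t : R => W t omega)}}
}.

Definition AC (R : realType) (T : R) (h : R -> R) : Prop :=
  forall eps : R, 0 < eps -> exists2 delta : R, 0 < delta &
    forall (n : nat) (a b : 'I_n -> R),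
      (forall i, [/\ 0 <= a i, a i <= b i & b i <= T]) ->
      trivIset setT (fun i => `]a i, b i[%classic) ->
      \sum_(i < n) (b i - a i) < delta ->
      \sum_(i < n) `|h (b i) - h (a i)| < eps.

(* |h|_T^psi, in [0, +oo].  An absolutely continuous h is differentiable
   almost everywhere on [0, T]; the default value derive1 takes elsewhere does
   not affect the integral. *)
Definition energy (R : realType) (psi : R -> R) (T : R) (h : R -> R) : \bar R :=
  (\int[lebesgue_measure]_(t in `[0%R, T]) (psi (derive1 h t))%:E)%E.

(* I_w^psi(T, r) for a single path w. *)
Definition min_energy (R : realType) (psi : R -> R) (w : R -> R) (T r : R) :
    \bar R :=
  ereal_inf [set energy psi T h | h in
    [set h : R -> R | [/\ AC T h, h 0 = r &
                          forall t, 0 <= t <= T -> w t <= h t]]].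

Definition m_psi (R : realType) (psi : R -> R) (b : R) : R :=
  \int[lebesgue_measure]_(a in `[1, b]) (a * psi a^-1).

(* Main.v *)
(* By convexity psi is, up to a factor tending to 1 as q -> 1, a superposition of
   the functions v |-> (v - c_k)^+ over the grid of slopes c_k = q^-k, with
   weights s_k - s_(k+1) (differences of chord slopes).  For an absolutely
   continuous majorant h of the path, the integral of (h' - c)^+ over [0, T] is
   at least sup_(t <= T) (W t - c t) - r, and the concave majorant formed by the
   lines of slope c_k lying above the path attains this for all k at once.  So
   the minimal energy is a weighted sum over k of the suprema of W t - c_k t.
   The supremum at slope c = c_k is realized near t ~ c^-2 = q^(2k), is of size
   1/c, and has mean 1/(2c) (stationary mean of the Lindley recursion, the
   reflected random walk obtained by discretizing time).  Restricted to windows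
   [q^(2j), q^(2(j + 2p + 1))] these suprema become finitely dependent with
   bounded second moments, so a weighted law of large numbers applies (Chebyshev
   and Borel-Cantelli along a geometric subsequence of the total weight); the
   growth bounds on theta enter only by making no single weight dominate.  The
   error of the localization is of order q^-p.  The total weight is compared with
   m_psi(T^(1/2)) by integrating over [q^k, q^(k+1)], and the ratios of the
   resulting upper and lower constants tend to 1 as q -> 1. *)

Require Import Defs.
From HB Require Import structures.
From mathcomp Require Import all_boot all_order all_algebra.
From mathcomp Require Import all_classical all_reals all_analysis.
From mathcomp Require Import measurable_realfun.
From mathcomp Require Import ring lra zify.

Import Order.TTheory GRing.Theory Num.Theory.
Import numFieldNormedType.Exports.

Local Open Scope classical_set_scope.
Local Open Scope ring_scope.

Set Implicit Arguments.
Unset Strict Implicit.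
Unset Printing Implicit Defensive.

(** * Gaussian moments *)

(** The exact law of the supremum of a drifted path is never computed. In the scaling c (W t - W a)
    - c^2 (t - a) the variance and the drift of a step are the same number [eta], and balancing
    first and second moments over one step of the recursion forces the mean 1/2 as [eta] tends to 0.
    One exponential moment, at most 4, supplies all other bounds: second moments, the oscillation
    inside a block, and the blocks beyond a window. The yardstick is A n, the sum of psi(q^-k)
    q^(2k) over k < n. The weights of the suprema add up to (q - 1/q) A n plus boundary terms, and
    [m_psi] at q^n is squeezed between multiples of sums of the same terms. The exponents act
    through max(alpha_up, 0) < alpha_lo + 1: a term of A n grows with a smaller power of n than A n
    does, so single terms and shifts of n by a constant are negligible. The limits are taken in the
    order n, p, q; since p and q run through countable sets, one null set serves all of them.
    Measurability of t |-> psi(h'(t)) is never established: energies are compared as suprema over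
    simple functions. *)

Section normal_mgf.
Context {R : realType}.
Notation mu := (@lebesgue_measure R).

(** The Radon-Nikodym derivative of the law and the density have the same integral over every
    measurable set, hence agree almost everywhere. *)
Lemma ge0_integral_normal_prob (m s : R) (f : R -> \bar R) :
  measurable_fun setT f -> (forall x, 0 <= f x)%E ->
  (\int[normal_prob m s]_x f x =
   \int[mu]_x (f x * (normal_pdf m s x)%:E))%E.
Proof.
move=> mf f0.
have dom := normal_prob_dominates m s.
rewrite -(Radon_Nikodym_SigmaFinite.change_of_variables dom f0 measurableT mf).
have mpdf := measurable_normal_pdf m s.
have mRN := measurable_int _ (Radon_Nikodym_SigmaFinite.f_integrable dom).
apply: ge0_ae_eq_integral => //.
- exact: emeasurable_funM.
- by apply: emeasurable_funM => //; exact/measurable_EFinP.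
- by move=> x _; rewrite mule_ge0// Radon_Nikodym_SigmaFinite.f_ge0.
- by move=> x _; rewrite mule_ge0// lee_fin normal_pdf_ge0.
have : ae_eq mu setT (Radon_Nikodym_SigmaFinite.f (normal_prob m s) mu)
    (fun x => (normal_pdf m s x)%:E).
  apply: integral_ae_eq => //.
  - exact: Radon_Nikodym_SigmaFinite.f_integrable.
  - exact/measurable_EFinP.
  - by move=> A _ mA; rewrite -Radon_Nikodym_SigmaFinite.f_integral.
by apply: filterS => x /= + _ => ->.
Qed.

(** Completing the square: tilting the centred density by [expR (t * x)] gives a constant times the
    density with mean [t * s ^+ 2]. *)
Lemma normal_prob_mgf (s t : R) : 0 < s ->
  (\int[normal_prob 0 s]_x (expR (t * x))%:E =
   (expR (t ^+ 2 * s ^+ 2 / 2))%:E)%E.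
Proof.
move=> s0; have sn0 : s != 0 by rewrite gt_eqF.
rewrite ge0_integral_normal_prob; last 2 first.
- apply/measurable_EFinP; apply: measurableT_comp => //.
- by move=> x; rewrite lee_fin expR_ge0.
under eq_integral => x _.
  rewrite -EFinM (_ : expR (t * x) * normal_pdf 0 s x =
    expR (t ^+ 2 * s ^+ 2 / 2) * normal_pdf (t * s ^+ 2) s x); last first.
    have pdfE m : normal_pdf m s x = normal_peak s * normal_fun m s x.
      by rewrite normal_pdfE.
    rewrite !pdfE /normal_fun mulrCA [RHS]mulrCA -!expRD.
    congr (_ * expR _); field.
    by rewrite sn0.
  rewrite EFinM; over.
rewrite ge0_integralZl//.
- by rewrite integral_normal_pdf mule1.
- by apply/measurable_EFinP; exact: measurable_normal_pdf.
- by move=> x _; rewrite lee_fin normal_pdf_ge0.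
Qed.

End normal_mgf.

Section gaussian_moments.
Context {R : realType}.

(** Replaces differentiation at 0: moments are read off the moment generating function by letting t
    tend to 0 in inequalities. *)
Lemma le_small_slope (a b C : R) :
  (forall t : R, 0 < t <= 1 -> a <= b + t * C) -> a <= b.
Proof.
move=> h; apply/ler_addgt0Pr => e e0.
pose t := Num.min 1 (e / (1 + `|C|)).
have C0 : 0 < 1 + `|C| by rewrite ltr_pwDl.
have t0 : 0 < t by rewrite lt_min ltr01 divr_gt0.
have /h/le_trans : 0 < t <= 1 by rewrite t0 ge_min lexx.
apply; rewrite lerD2l (@le_trans _ _ (t * (1 + `|C|)))//.
  by rewrite ler_pM2l// (le_trans (ler_norm _))// lerDr.
by rewrite -ler_pdivlMr// ge_min lexx orbT.
Qed.

Lemma expR_sub1_le (x : R) : expR x - 1 <= x * expR x.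
Proof.
have := expR_ge1Dx (- x); rewrite expRN => h.
have e0 := expR_gt0 x.
have : (1 - x) * expR x <= 1.
  by rewrite -ler_pdivlMr// div1r.
lra.
Qed.

(** By evenness x >= 0 may be assumed; then e^x + e^-x - 2 = e^-x (e^x - 1)^2 with x <= e^x - 1 <= x
    e^x. *)
Lemma norm_cosh_sub (x : R) :
  `|expR x + expR (- x) - 2 - x ^+ 2| <= 6 * `|x| ^+ 3 * expR `|x|.
Proof.
wlog x0 : x / 0 <= x.
  move=> h; have [/h//|/ltW x0] := leP 0 x.
  have := h (- x); rewrite oppr_ge0 => /(_ x0).
  by rewrite opprK normrN sqrrN addrC [expR (- x) + _]addrC addrC.
rewrite (ger0_norm x0).
have e0 := expR_gt0 x.
have eN0 := expR_gt0 (- x).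
have eN : expR (- x) * expR x = 1 by rewrite -expRD addNr expR0.
have e1 := expR_sub1_le x.
have e2 := expR_ge1Dx x.
have e3 := expR_ge1Dx (- x).
have -> : expR x + expR (- x) - 2 = expR (- x) * (expR x - 1) ^+ 2.
  by transitivity (expR (-x) * expR x * expR x - 2 * (expR (-x) * expR x) + expR (-x)); [rewrite eN; ring|ring].
have lo : x ^+ 2 * expR (- x) <= expR (- x) * (expR x - 1) ^+ 2.
  rewrite mulrC ler_pM2l// ler_sqr ?nnegrE//; lra.
have up : expR (- x) * (expR x - 1) ^+ 2 <= x ^+ 2 * expR x.
  have -> : x ^+ 2 * expR x = expR (- x) * (x * expR x) ^+ 2.
    transitivity (x ^+ 2 * expR x * (expR (-x) * expR x)); [by rewrite eN mulr1|ring].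
  rewrite ler_pM2l// ler_sqr ?nnegrE//; [lra|exact: mulr_ge0 (ltW _)].
have x3 : 0 <= x ^+ 3 by rewrite exprn_ge0.
have xx : 0 <= x ^+ 2 by rewrite exprn_ge0.
have k1 : x ^+ 2 * expR x - x ^+ 2 <= x ^+ 3 * expR x.
  have -> : x ^+ 3 * expR x = x ^+ 2 * (x * expR x) by ring.
  have -> : x ^+ 2 * expR x - x ^+ 2 = x ^+ 2 * (expR x - 1) by ring.
  by rewrite ler_wpM2l.
have k2 : x ^+ 2 - x ^+ 2 * expR (- x) <= x ^+ 3 * expR x.
  have -> : x ^+ 2 - x ^+ 2 * expR (- x) = x ^+ 2 * (1 - expR (- x)) by ring.
  have -> : x ^+ 3 * expR x = x ^+ 2 * (x * expR x) by ring.
  rewrite ler_wpM2l//.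
  have : x <= x * expR x by rewrite ler_peMr// -expR0 ler_expR.
  lra.
have k3 : 0 <= x ^+ 3 * expR x by exact: mulr_ge0 (ltW _).
rewrite ler_norml; lra.
Qed.

Lemma exprn_le_expR (n : nat) (x : R) : 0 <= x -> x ^+ n <= n`!%:R * expR x.
Proof.
case: n => [|n] x0.
  by rewrite expr0 mul1r -expR0 ler_expR.
have := expR_ge1Dxn n x0; rewrite -ler_pdivrMl ?ltr0n ?fact_gt0//.
rewrite mulrC => /(le_trans _); apply; lra.
Qed.

Lemma expR_norm_le (x : R) : expR `|x| <= expR x + expR (- x).
Proof.
by case: (ger0P x) => _; rewrite ?lerDl ?lerDr expR_ge0.
Qed.

Lemma Rintegral_probability_cst d (T : measurableType d)
  (P : probability T R) (r : R) : \int[P]_w r = r.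
Proof.
rewrite Rintegral_cst//; have /= -> := probability_setT P.
by rewrite mulr1.
Qed.

Context d (T : measurableType d) (P : probability T R) (X : T -> R) (eta : R).
Hypothesis mX : measurable_fun setT X.
Hypothesis eta0 : 0 < eta.
Hypothesis mgfX : forall t : R,
  (\int[P]_w (expR (t * X w))%:E = (expR (t ^+ 2 * eta / 2))%:E)%E.

Lemma integrable_expR_mgf t :
  P.-integrable setT (EFin \o (fun w => expR (t * X w))).
Proof.
apply/integrableP; split.
  apply/measurable_EFinP; apply: measurableT_comp => //.
  exact: measurable_funM.
rewrite (_ : (\int[P]_w _ = \int[P]_w (expR (t * X w))%:E)%E); last first.
  by apply: eq_integral => w _ /=; rewrite ger0_norm// expR_ge0.
by rewrite mgfX ltry.
Qed.

Lemma Rintegral_mgf t : \int[P]_w expR (t * X w) = expR (t ^+ 2 * eta / 2).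
Proof. by rewrite /Rintegral mgfX. Qed.

(** An integrable majorant of exp(2|X|), hence of all powers of X and of the remainder in the
    second-order expansion below. *)
Let E2 w := expR (2 * X w) + expR (- 2 * X w).

Let integrable_E2 : P.-integrable setT (EFin \o E2).
Proof.
have := integrableD measurableT (integrable_expR_mgf 2) (integrable_expR_mgf (-2)).
by [].
Qed.

Let Rintegral_E2 : \int[P]_w E2 w = 2 * expR (2 * eta).
Proof.
rewrite RintegralD//; try exact: integrable_expR_mgf.
rewrite !Rintegral_mgf sqrrN -mulr2n mulr_natl; congr (expR _ *+ 2).
by field.
Qed.

Lemma expRnorm_le_E2 w : expR (2 * `|X w|) <= E2 w.
Proof.
rewrite /E2 mulNr; have := expR_norm_le (2 * X w).
by rewrite normrM ger0_norm.
Qed.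

Lemma norm_expr_le_E2 (n : nat) w : `|X w| ^+ n <= n`!%:R * E2 w.
Proof.
rewrite (le_trans (exprn_le_expR n (normr_ge0 _)))//.
rewrite ler_pM2l ?ltr0n ?fact_gt0// (le_trans _ (expRnorm_le_E2 _))//.
by rewrite ler_expR ler_peMl// ler1n.
Qed.

Lemma integrable_expr_mgf (n : nat) :
  P.-integrable setT (EFin \o (fun w => X w ^+ n)).
Proof.
have h : P.-integrable setT (EFin \o (fun w => n`!%:R * E2 w)).
  by have := integrableZl measurableT n`!%:R integrable_E2.
apply: (le_integrable measurableT _ _ h).
  by apply/measurable_EFinP; exact: measurable_funX.
move=> w _ /=; rewrite lee_fin normrX (le_trans (norm_expr_le_E2 n w))//.
exact: ler_norm.
Qed.

Let integrable_X : P.-integrable setT (EFin \o X).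
Proof. exact: (integrable_expr_mgf 1). Qed.

(** Integrating 1 + u <= e^u with u = t s X and s = 1 or -1 bounds t s E X by exp(t^2 eta / 2) - 1,
    which is of order t^2; divide by t and let t tend to 0. *)
Lemma mgf_mean : \int[P]_w X w = 0.
Proof.
have key (s : R) : `|s| = 1 -> s * (\int[P]_w X w) <= 0.
  move=> s1; apply: (@le_small_slope _ _ (eta / 2 * expR (eta / 2))) => t /andP[t0 t1].
  rewrite add0r -(ler_pM2l t0).
  have h : 1 + t * s * (\int[P]_w X w) <= expR ((t * s) ^+ 2 * eta / 2).
    rewrite -Rintegral_mgf -RintegralZl//.
    rewrite -{1}(Rintegral_probability_cst P 1).
    have iX : P.-integrable setT (EFin \o (fun w => t * s * X w)).
      exact: (integrableZl measurableT (t * s) integrable_X).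
    have i1 : P.-integrable setT (EFin \o (fun _ : T => (1 : R))).
      exact: finite_measure_integrable_cst.
    rewrite -RintegralD//; apply: le_Rintegral => //.
    - exact: (integrableD measurableT i1 iX).
    - exact: integrable_expR_mgf.
    - by move=> w _; exact: expR_ge1Dx.
  have sq : (t * s) ^+ 2 = t ^+ 2 by rewrite exprMn -(real_normK (num_real s)) s1 expr1n mulr1.
  rewrite sq in h.
  have := expR_sub1_le (t ^+ 2 * eta / 2).
  have e1 : expR (t ^+ 2 * eta / 2) <= expR (eta / 2).
    by rewrite ler_expR ler_pM2r ?invr_gt0// ler_piMl ?(ltW eta0)// expr_le1// ltW.
  have : t ^+ 2 * eta / 2 * expR (t ^+ 2 * eta / 2) <= t ^+ 2 * eta / 2 * expR (eta / 2).
    by rewrite ler_wpM2l// mulr_ge0// mulr_ge0 ?sqr_ge0// ltW.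
  rewrite (_ : t * (t * (eta / 2 * expR (eta / 2))) = t ^+ 2 * eta / 2 * expR (eta / 2)); last by ring.
  rewrite mulrA; lra.
apply/eqP; rewrite eq_le; apply/andP; split.
  by have := key 1; rewrite normr1 mul1r; exact.
by have := key (-1); rewrite normrN1 mulN1r oppr_le0; exact.
Qed.

(** The symmetrized remainder e^u + e^-u - 2 - u^2 at u = t X has mean of order t^3, so division by
    t^2 identifies the second moment in the limit. *)
Lemma mgf_second : \int[P]_w (X w ^+ 2) = eta.
Proof.
set m2 := (X in X = _).
have iX2 := integrable_expr_mgf 2.
(* 36 = 6 * 6: the constant of [norm_cosh_sub] times the 3! from |X|^3 <= 3! exp|X|. *)
have key (t : R) : 0 < t <= 1 ->
    `|2 * (expR (t ^+ 2 * eta / 2) - 1) - t ^+ 2 * m2| <=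
    t ^+ 3 * (36 * (2 * expR (2 * eta))).
  move=> /andP[t0 t1].
  pose D w := (expR (t * X w) + expR (- t * X w) - 2) - t ^+ 2 * X w ^+ 2.
  have i2 : P.-integrable setT (EFin \o (fun _ : T => (2 : R))).
    exact: finite_measure_integrable_cst.
  have iD1 := integrableD measurableT (integrable_expR_mgf t) (integrable_expR_mgf (- t)).
  have iD2 := integrableB measurableT iD1 i2.
  have iD3 : P.-integrable setT (EFin \o (fun w => t ^+ 2 * X w ^+ 2)).
    exact: (integrableZl measurableT (t ^+ 2) iX2).
  have iD := integrableB measurableT iD2 iD3.
  have -> : 2 * (expR (t ^+ 2 * eta / 2) - 1) - t ^+ 2 * m2 = \int[P]_w D w.
    rewrite /D RintegralB// RintegralB// RintegralD//; try exact: integrable_expR_mgf.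
    rewrite !Rintegral_mgf sqrrN RintegralZl// Rintegral_probability_cst /m2.
    by ring.
  rewrite (le_trans (le_normr_Rintegral _ _))//.
  rewrite -Rintegral_E2 -!RintegralZl//; last exact: (integrableZl measurableT 36 integrable_E2).
  apply: le_Rintegral => //.
  - exact: integrable_norm.
  - exact: (integrableZl measurableT (t ^+ 3) (integrableZl measurableT 36 integrable_E2)).
  move=> w _; have := norm_cosh_sub (t * X w).
  rewrite /D exprMn mulNr => /le_trans; apply.
  rewrite normrM (ger0_norm (ltW t0)) exprMn.
  have h1 : expR (t * `|X w|) <= expR `|X w| by rewrite ler_expR ler_piMl.
  have h2 := exprn_le_expR 3 (normr_ge0 (X w)).
  have h3 := expRnorm_le_E2 w.
  rewrite mulr_natl mulr2n expRD in h3.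
  have t3 : 0 <= t ^+ 3 by rewrite exprn_ge0// ltW.
  rewrite (_ : 6 * _ * _ = t ^+ 3 * (6 * (`|X w| ^+ 3 * expR (t * `|X w|)))); last by ring.
  rewrite ler_wpM2l//.
  have e0 := expR_gt0 `|X w|.
  have -> : 36 * E2 w = 6 * (6 * E2 w) by ring.
  rewrite ler_pM2l// (@le_trans _ _ (6 * (expR `|X w| * expR `|X w|)))//.
    by rewrite mulrA; apply: ler_pM; rewrite ?exprn_ge0 ?expR_ge0.
  by rewrite ler_pM2l.
have eta2 (t : R) : 0 < t <= 1 -> t ^+ 2 * eta <= 2 * (expR (t ^+ 2 * eta / 2) - 1)
    <= t ^+ 2 * eta + t ^+ 3 * (eta ^+ 2 * expR eta).
  move=> /andP[t0 t1].
  set u := t ^+ 2 * eta / 2.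
  have u0 : 0 <= u by rewrite mulr_ge0// mulr_ge0 ?sqr_ge0// ltW.
  have -> : t ^+ 2 * eta = 2 * u by rewrite /u; field.
  have h1 := expR_ge1Dx u.
  have h2 := expR_sub1_le u.
  have ueta : u <= eta.
    have : t ^+ 2 * eta <= eta by rewrite ler_piMl ?(ltW eta0)// expr_le1// ltW.
    by have e0 := eta0; rewrite /u ler_pdivrMr//; lra.
  apply/andP; split; first lra.
  have h3 : u * (expR u - 1) <= u * (u * expR u) by rewrite ler_wpM2l.
  have h4 : u ^+ 2 * expR u <= t ^+ 3 * (eta ^+ 2 / 4 * expR eta).
    rewrite mulrA ler_pM ?sqr_ge0 ?expR_ge0 ?ler_expR//.
    rewrite (_ : u ^+ 2 = t * (t ^+ 3 * (eta ^+ 2 / 4))); last by rewrite /u; field.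
    by rewrite ler_piMl// mulr_ge0 ?divr_ge0 ?sqr_ge0// exprn_ge0// ltW.
  have h5 : 0 <= t ^+ 3 * (eta ^+ 2 * expR eta).
    by rewrite mulr_ge0 ?exprn_ge0 ?mulr_ge0 ?sqr_ge0 ?expR_ge0// ltW.
  rewrite [X in _ <= X](_ : _ = 2 * u + 4 * (t ^+ 3 * (eta ^+ 2 / 4 * expR eta))); last by field.
  lra.
apply/eqP; rewrite eq_le; apply/andP; split.
  apply: (@le_small_slope _ _ (eta ^+ 2 * expR eta + 36 * (2 * expR (2 * eta)))) => t t01.
  have /andP[t0 t1] := t01.
  have := key t t01; have /andP[a1 a2] := eta2 t t01.
  rewrite ler_norml => /andP[b1 b2].
  have tt : 0 < t ^+ 2 by rewrite exprn_gt0.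
  rewrite -(ler_pM2l tt).
  rewrite (_ : t ^+ 2 * (eta + _) = t ^+ 2 * eta + t ^+ 3 * (eta ^+ 2 * expR eta) + t ^+ 3 * (36 * (2 * expR (2 * eta)))); last by ring.
  lra.
apply: (@le_small_slope _ _ (36 * (2 * expR (2 * eta)))) => t t01.
have /andP[t0 t1] := t01.
have := key t t01; have /andP[a1 a2] := eta2 t t01.
rewrite ler_norml => /andP[b1 b2].
have tt : 0 < t ^+ 2 by rewrite exprn_gt0.
rewrite -(ler_pM2l tt).
rewrite (_ : t ^+ 2 * (m2 + _) = t ^+ 2 * m2 + t ^+ 3 * (36 * (2 * expR (2 * eta)))); last by ring.
lra.
Qed.

(** Apply x^4 <= 24 exp|x| to X / sqrt eta, whose exponential moments do not depend on [eta]: 192 =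
    24 * 2 * 4, using exp(1/2) <= 4. *)
Lemma mgf_fourth : \int[P]_w (X w ^+ 4) <= 192 * eta ^+ 2.
Proof.
pose k := (Num.sqrt eta)^-1.
have k2 : k ^+ 2 = eta^-1 by rewrite exprVn sqr_sqrtr// ltW.
have k0 : 0 < k by rewrite invr_gt0 sqrtr_gt0.
pose F w := expR (k * X w) + expR (- k * X w).
have iF : P.-integrable setT (EFin \o F).
  exact: (integrableD measurableT (integrable_expR_mgf k) (integrable_expR_mgf (- k))).
have FE : \int[P]_w F w = 2 * expR (1 / 2).
  rewrite RintegralD//; try exact: integrable_expR_mgf.
  rewrite !Rintegral_mgf sqrrN k2 mulVf ?gt_eqF//; ring.
have e4 : expR (1 / 2 : R) <= 4.
  have := expR_sub1_le (1 / 2 : R); lra.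
have c0 : 0 <= 24 * eta ^+ 2 by rewrite mulr_ge0 ?sqr_ge0.
rewrite (@le_trans _ _ (24 * eta ^+ 2 * (2 * expR (1 / 2))))//; last first.
  rewrite [X in _ <= X](_ : _ = 24 * eta ^+ 2 * (2 * 4)); last by ring.
  by rewrite ler_wpM2l// ler_pM2l.
rewrite -FE -RintegralZl//; apply: le_Rintegral => //.
- exact: (integrable_expr_mgf 4).
- exact: (integrableZl measurableT (24 * eta ^+ 2) iF).
move=> w _; have := exprn_le_expR 4 (normr_ge0 (k * X w)).
rewrite -normrX ger0_norm ?exprn_even_ge0// => h.
have h2 := expR_norm_le (k * X w).
have e2 : 0 < eta ^+ 2 by rewrite exprn_gt0.
have {h} h : eta ^+ 2 * (k * X w) ^+ 4 <= eta ^+ 2 * (24 * F w).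
  rewrite ler_pM2l// (le_trans h)// ler_pM2l ?ltr0n//.
  by rewrite /F mulNr.
rewrite [X in X <= _](_ : _ = X w ^+ 4) in h; last first.
  by rewrite exprMn (exprM k 2 2) k2; field; rewrite gt_eqF.
by rewrite (le_trans h)// mulrA (mulrC (eta ^+ 2)).
Qed.

End gaussian_moments.

Lemma integral_EFin_Rintegral {R : realType} d (T : measurableType d)
  (P : {measure set T -> \bar R}) (D : set T) (f : T -> R) : measurable D ->
  P.-integrable D (EFin \o f) ->
  (\int[P]_(w in D) (f w)%:E = (\int[P]_(w in D) f w)%:E)%E.
Proof.
by move=> mD intf; rewrite /Rintegral fineK//; exact: integrable_fin_num.
Qed.

(** * Lindley's recursion *)

Section lindley_kernel.
Context {R : realType} d (T : measurableType d) (P : probability T R).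
Context (X : T -> R) (eta : R).
Hypothesis mX : measurable_fun setT X.

Definition lindley (x w : R) : R := Num.max 0 (x + w - eta).

(** Moments of the chain are iterates of this operator on nonnegative functions with extended
    values, so that finiteness can be settled after the algebra. *)
Definition lindley_kernel (f : R -> \bar R) (x : R) : \bar R :=
  (\int[P]_w f (lindley x (X w)))%E.

Notation K := lindley_kernel.

Lemma measurable_lindley_pair :
  measurable_fun [set: R * T] (fun z => lindley z.1 (X z.2)).
Proof.
apply: measurable_maxr => //; apply: measurable_funB => //.
apply: measurable_funD => //.
exact: measurableT_comp.
Qed.

Lemma measurable_lindley_sec x : measurable_fun setT (fun w => lindley x (X w)).
Proof.
apply: measurable_maxr => //; apply: measurable_funB => //.
exact: measurable_funD.
Qed.

Lemma lindley_ge0 x w : 0 <= lindley x w.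
Proof. by rewrite /lindley le_max lexx. Qed.

Lemma lindley_kernel_ge0 (f : R -> \bar R) x : (forall x : R, (0 <= f x))%E -> (0 <= K f x)%E.
Proof. by move=> f0; exact: integral_ge0. Qed.

Lemma measurable_lindley_kernel (f : R -> \bar R) : (forall x : R, (0 <= f x))%E ->
  measurable_fun [set: R] f -> measurable_fun [set: R] (K f).
Proof.
move=> f0 mf.
apply: (@measurable_fun_fubini_tonelli_F _ _ _ _ _ P
  (fun z => f (lindley z.1 (X z.2)))) => //.
by apply: measurableT_comp => //; exact: measurable_lindley_pair.
Qed.

(** A step always lands in the half-line, so a comparison there suffices; this is what allows
    one-step identities valid for x >= 0 to be iterated. *)
Lemma lindley_kernel_le (f g : R -> \bar R) x : (forall x : R, (0 <= f x))%E -> (forall x : R, (0 <= g x))%E ->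
  measurable_fun [set: R] f -> measurable_fun [set: R] g ->
  (forall x : R, 0 <= x -> (f x <= g x)%E) -> (K f x <= K g x)%E.
Proof.
move=> f0 g0 mf mg fg; apply: ge0_le_integral => //.
- by apply: measurableT_comp => //; exact: measurable_lindley_sec.
- by apply: measurableT_comp => //; exact: measurable_lindley_sec.
- by move=> w _; apply: fg; exact: lindley_ge0.
Qed.

Lemma lindley_kernelD (f g : R -> \bar R) x : (forall x : R, (0 <= f x))%E -> (forall x : R, (0 <= g x))%E ->
  measurable_fun [set: R] f -> measurable_fun [set: R] g ->
  (K (fun y => f y + g y) x = K f x + K g x)%E.
Proof.
move=> f0 g0 mf mg; rewrite /K ge0_integralD//.
- by apply: measurableT_comp => //; exact: measurable_lindley_sec.
- by apply: measurableT_comp => //; exact: measurable_lindley_sec.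
Qed.

Lemma lindley_kernelZ (f : R -> \bar R) (c : R) x : 0 <= c -> (forall x : R, (0 <= f x))%E ->
  measurable_fun [set: R] f ->
  (K (fun y => c%:E * f y) x = c%:E * K f x)%E.
Proof.
move=> c0 f0 mf; rewrite /K ge0_integralZl_EFin//.
by apply: measurableT_comp => //; exact: measurable_lindley_sec.
Qed.

Lemma lindley_kernel_cst (c : \bar R) x : (K (cst c) x = c)%E.
Proof.
rewrite /K/= integral_cst//; have /= -> := probability_setT P.
by rewrite mule1.
Qed.

Lemma lindley_kernel_nd (f : R -> \bar R) : (forall x : R, (0 <= f x))%E -> measurable_fun [set: R] f ->
  {homo f : x y / x <= y >-> (x <= y)%E} ->
  {homo K f : x y / x <= y >-> (x <= y)%E}.
Proof.
move=> f0 mf ndf x y xy; apply: ge0_le_integral => //.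
- by apply: measurableT_comp => //; exact: measurable_lindley_sec.
- by apply: measurableT_comp => //; exact: measurable_lindley_sec.
- move=> w _; apply: ndf; rewrite /lindley ge_max le_max lexx/= le_max.
  by rewrite !lerD2r xy orbT.
Qed.

Definition lindley_iter n f : R -> \bar R := iter n K f.
Notation Kn := lindley_iter.

Lemma lindley_iter_ge0 n (f : R -> \bar R) : (forall x : R, (0 <= f x))%E -> (forall x, 0 <= Kn n f x)%E.
Proof.
by move=> f0; elim: n => [//|n IH] x /=; exact: lindley_kernel_ge0.
Qed.

Lemma measurable_lindley_iter n (f : R -> \bar R) : (forall x : R, (0 <= f x))%E ->
  measurable_fun [set: R] f -> measurable_fun [set: R] (Kn n f).
Proof.
move=> f0 mf; elim: n => [//|n IH] /=.
by apply: measurable_lindley_kernel => //; exact: lindley_iter_ge0.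
Qed.

Lemma lindley_iter_le n (f g : R -> \bar R) : (forall x : R, (0 <= f x))%E -> (forall x : R, (0 <= g x))%E ->
  measurable_fun [set: R] f -> measurable_fun [set: R] g ->
  (forall x : R, 0 <= x -> (f x <= g x)%E) -> (forall x : R, 0 <= x -> (Kn n f x <= Kn n g x)%E).
Proof.
move=> f0 g0 mf mg fg; elim: n => [//|n IH] x x0 /=.
apply: lindley_kernel_le => //; try exact: lindley_iter_ge0;
  exact: measurable_lindley_iter.
Qed.

Lemma lindley_iterD n (f g : R -> \bar R) x : (forall x : R, (0 <= f x))%E -> (forall x : R, (0 <= g x))%E ->
  measurable_fun [set: R] f -> measurable_fun [set: R] g ->
  (Kn n (fun y => f y + g y) x = Kn n f x + Kn n g x)%E.
Proof.
move=> f0 g0 mf mg; elim: n x => [//|n IH] x /=.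
rewrite -lindley_kernelD//; try exact: lindley_iter_ge0;
  try exact: measurable_lindley_iter.
by apply: eq_integral => w _; exact: IH.
Qed.

Lemma lindley_iterZ n (f : R -> \bar R) (c : R) x : 0 <= c -> (forall x : R, (0 <= f x))%E ->
  measurable_fun [set: R] f ->
  (Kn n (fun y => c%:E * f y) x = c%:E * Kn n f x)%E.
Proof.
move=> c0 f0 mf; elim: n x => [//|n IH] x /=.
rewrite -lindley_kernelZ//; try exact: lindley_iter_ge0;
  try exact: measurable_lindley_iter.
by apply: eq_integral => w _; exact: IH.
Qed.

Lemma lindley_iter_cst n (c : \bar R) x : (Kn n (cst c) x = c)%E.
Proof.
elim: n x => [//|n IH] x /=; rewrite -[RHS](lindley_kernel_cst c x).
by apply: eq_integral => w _; exact: IH.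
Qed.

Lemma lindley_iterS n (f : R -> \bar R) x : Kn n.+1 f x = Kn n (K f) x.
Proof. by rewrite /Kn iterSr. Qed.

(** After one step the chain from 0 sits at some state >= 0, and iterates of a nondecreasing
    function are nondecreasing. *)
Lemma lindley_iter_nd n (f : R -> \bar R) : (forall x : R, (0 <= f x))%E -> measurable_fun [set: R] f ->
  {homo f : x y / x <= y >-> (x <= y)%E} -> (Kn n f 0 <= Kn n.+1 f 0)%E.
Proof.
move=> f0 mf ndf /=.
have h : {homo Kn n f : x y / x <= y >-> (x <= y)%E}.
  elim: n => [//|n IH]; apply: lindley_kernel_nd => //.
    exact: lindley_iter_ge0.
  exact: measurable_lindley_iter.
rewrite -{1}(lindley_kernel_cst (Kn n f 0) 0); apply: ge0_le_integral => //.
- by move=> ? _; exact: lindley_iter_ge0.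
- apply: measurableT_comp; last exact: measurable_lindley_sec.
  exact: measurable_lindley_iter.
- by move=> w _; apply: h; exact: lindley_ge0.
Qed.

End lindley_kernel.

(* e, v, a, p, r are the means of L_n, L_n^2, exp L_n, of the part of the step
   cut off at 0, and of its square, for the recursion L_(n+1) = max 0 (L_n + step). *)
Section lindley_reals.
Context {R : realType} (eta : R) (e v p r a : nat -> R).
Hypothesis eta0 : 0 < eta.
Hypothesis eta1 : eta <= 1.
Hypothesis e0 : e 0%N = 0.
Hypothesis v0 : v 0%N = 0.
Hypothesis a0 : a 0%N <= 1.
Hypothesis eS : forall n, e n.+1 + eta = e n + p n.
Hypothesis vS : forall n, v n.+1 + 2 * eta * e n + r n = v n + eta + eta ^+ 2.
Hypothesis rp : forall n (x : R), 0 < x -> r n <= x * p n + 1544 * eta ^+ 2 / x ^+ 2.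
Hypothesis r0 : forall n, 0 <= r n.
Hypothesis aS : forall n, a n.+1 <= a n * expR (- eta / 2) + p n.
Hypothesis end_ : forall n, e n <= e n.+1.
Hypothesis vge0 : forall n, 0 <= v n.
Hypothesis va : forall n, v n <= 2 * a n.

Let e_nd m n : (m <= n)%N -> e m <= e n.
Proof. by move/subnKC <-; elim: (n - m)%N => [|k IH]; rewrite ?addn0// addnS (le_trans IH). Qed.

(* Otherwise the second moments v would eventually become negative. *)
Lemma lindley_mean_le n : e n <= (1 + eta) / 2.
Proof.
rewrite leNgt; apply/negP => h.
pose g := 2 * eta * e n - eta - eta ^+ 2.
have eta_0 := eta0.
have g0 : 0 < g.
  have : eta * ((1 + eta) / 2) < eta * e n by rewrite ltr_pM2l.
  rewrite /g expr2; lra.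
have vk k : v (n + k)%N <= v n - k%:R * g.
  elim: k => [|k IH]; first by rewrite addn0 mul0r subr0.
  have := vS (n + k); have := r0 (n + k); 
  have -> : k.+1%:R * g = k%:R * g + g by rewrite -(natr1 k); ring.
  rewrite addnS.
  have : 2 * eta * e n <= 2 * eta * e (n + k)%N.
    by apply: ler_wpM2l; [rewrite mulr_ge0// ltW|apply: e_nd; exact: leq_addr].
  rewrite /g in IH *; lra.
have := vk (Num.truncn (v n / g)).+1; have := vge0 (n + (Num.truncn (v n / g)).+1).
have := truncnS_gt (v n / g); rewrite ltr_pdivrMr//.
lra.
Qed.

(** The unknown [p] enters the recursions of [a] and [e] with the same coefficient and cancels in a
    - e. The bound a <= 3 + e is preserved because 3 exp(-eta/2) + eta <= 3 when eta <= 1. *)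
Lemma lindley_expR_le n : a n <= 4.
Proof.
have [e_0 e_1] := (eta0, eta1).
have h : a n <= 3 + e n.
  elim: n => [|n IH]; first by rewrite e0 addr0 (le_trans a0)// ler1n.
  have := aS n; have := eS n => h1 h2.
  have q0 := expR_gt0 (- eta / 2).
  have q1 : expR (- eta / 2) <= 1 by rewrite -expR0 ler_expR mulNr oppr_le0 divr_ge0// ltW.
  have q2 : 3 * expR (- eta / 2) + eta <= 3.
    have : expR (- eta / 2) * (1 + eta / 2) <= 1.
      have := expR_ge1Dx (eta / 2); rewrite -(ler_pM2l q0) => /le_trans; apply.
      by rewrite -expRD mulNr addNr expR0.
    have c0 : 0 < 1 + eta / 2 by rewrite addr_gt0// divr_gt0.
    have ee : eta * eta <= eta * 1 by rewrite ler_pM2l.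
    set y := expR _ => hy; rewrite -(ler_pM2r c0).
    have -> : (3 * y + eta) * (1 + eta / 2) = 3 * (y * (1 + eta / 2)) + eta + eta * eta / 2 by field.
    lra.
  have : a n * expR (- eta / 2) <= (3 + e n) * expR (- eta / 2) by rewrite ler_pM2r.
  have en0 : 0 <= e n by rewrite -e0 e_nd.
  have : e n * expR (- eta / 2) <= e n by rewrite ler_piMr.
  nra.
have := lindley_mean_le n; lra.
Qed.

(** Sum the second-moment balance over n steps. The [p] add up to exactly e n + n eta, which
    controls the sum of the [r] at truncation level x; monotonicity bounds the sum of the [e] by n
    times the last one; and v n <= 2 a n <= 8. Division by 2 n eta gives the claim; x is chosen
    later. *)
Lemma lindley_mean_ge n (x : R) : 0 < x -> (0 < n)%N ->
  1 / 2 - (4 / (n%:R * eta) + x / 2 * (1 / (n%:R * eta) + 1) + 772 * eta / x ^+ 2)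
  <= e n.
Proof.
move=> x0 n0.
have [e_0 e_1] := (eta0, eta1).
have key m : v m + 2 * eta * (\sum_(i < m) e i) + (\sum_(i < m) r i) =
    m%:R * (eta + eta ^+ 2).
  elim: m => [|m IH]; first by rewrite !big_ord0 v0 mulr0 mul0r !addr0.
  have -> : m.+1%:R * (eta + eta ^+ 2) = m%:R * (eta + eta ^+ 2) + (eta + eta ^+ 2).
    by rewrite -(natr1 m); ring.
  by rewrite !big_ord_recr /= -IH; have := vS m; lra.
have sp m : \sum_(i < m) p i = e m + m%:R * eta.
  elim: m => [|m IH]; first by rewrite big_ord0 e0 mul0r addr0.
  rewrite big_ord_recr /= IH -(natr1 m); have := eS m; lra.
have sr : \sum_(i < n) r i <= x * (e n + n%:R * eta) + n%:R * (1544 * eta ^+ 2 / x ^+ 2).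
  rewrite -sp mulr_sumr; apply: (@le_trans _ _ (\sum_(i < n) (x * p i + 1544 * eta ^+ 2 / x ^+ 2))).
    by apply: ler_sum => i _; exact: rp.
  by rewrite big_split/= sumr_const card_ord -[_ *+ n]mulr_natl.
have se : \sum_(i < n) e i <= n%:R * e n.
  rewrite mulr_natl -[X in _ <= _ *+ X]card_ord -sumr_const; apply: ler_sum => i _.
  by apply: e_nd; exact: ltnW.
have := key n; have := va n; have := lindley_expR_le n; have := lindley_mean_le n => h1 h2 h3 h4.
have nR : 0 < n%:R :> R by rewrite ltr0n.
have c0 : 0 < 2 * (n%:R * eta) by rewrite mulr_gt0// mulr_gt0.
rewrite -(ler_pM2l c0).
have -> : 2 * (n%:R * eta) * (1 / 2 - (4 / (n%:R * eta) + x / 2 * (1 / (n%:R * eta) + 1) + 772 * eta / x ^+ 2)) =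
  n%:R * eta - 8 - x * (1 + n%:R * eta) - n%:R * (1544 * eta ^+ 2 / x ^+ 2).
  by field; rewrite !gt_eqF.
have h5 : 2 * eta * (\sum_(i < n) e i) <= 2 * eta * (n%:R * e n) by rewrite ler_pM2l// mulr_gt0.
have h6 : x * (e n + n%:R * eta) <= x * (1 + n%:R * eta) by rewrite ler_pM2l// lerD2r; lra.
have h7 : 0 <= n%:R * eta ^+ 2 by rewrite mulr_ge0 ?sqr_ge0// ltW.
lra.
Qed.

End lindley_reals.

Section lindley_moments.
Context {R : realType} d (T : measurableType d) (P : probability T R).
Context (X : T -> R) (eta : R).
Hypothesis mX : measurable_fun setT X.
Hypothesis eta0 : 0 < eta.
Hypothesis eta1 : eta <= 1.
Hypothesis mgfX : forall t : R,
  (\int[P]_w (expR (t * X w))%:E = (expR (t ^+ 2 * eta / 2))%:E)%E.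

Notation K := (lindley_kernel P X eta).
Notation Kn := (lindley_iter P X eta).

Definition lindley_loss (x w : R) : R := Num.max 0 (eta - x - w).

Let idf (x : R) : \bar R := (`|x|)%:E.
Let sqf (x : R) : \bar R := (x ^+ 2)%:E.
Let exf (x : R) : \bar R := (expR x)%:E.
Let pif (x : R) : \bar R := (\int[P]_w (lindley_loss x (X w))%:E)%E.
Let rhof (x : R) : \bar R := (\int[P]_w (lindley_loss x (X w) ^+ 2)%:E)%E.

Let measurable_loss :
  measurable_fun [set: R * T] (fun z => lindley_loss z.1 (X z.2)).
Proof.
apply: measurable_maxr => //; apply: measurable_funB => //.
  exact: measurable_funB.
exact: measurableT_comp.
Qed.

Let measurable_loss_sec x : measurable_fun setT (fun w => lindley_loss x (X w)).
Proof.
apply: measurable_maxr => //; exact: measurable_funB.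
Qed.

Let loss_ge0 x w : 0 <= lindley_loss x w.
Proof. by rewrite /lindley_loss le_max lexx. Qed.

Let idf0 (x : R) : (0 <= idf x)%E. Proof. by rewrite lee_fin. Qed.
Let sqf0 (x : R) : (0 <= sqf x)%E. Proof. by rewrite lee_fin sqr_ge0. Qed.
Let exf0 (x : R) : (0 <= exf x)%E. Proof. by rewrite lee_fin expR_ge0. Qed.
Let pif0 (x : R) : (0 <= pif x)%E.
Proof. by apply: integral_ge0 => w _; rewrite lee_fin. Qed.
Let rhof0 (x : R) : (0 <= rhof x)%E.
Proof. by apply: integral_ge0 => w _; rewrite lee_fin sqr_ge0. Qed.

Let mid : measurable_fun [set: R] idf.
Proof. by apply/measurable_EFinP; exact: normr_measurable. Qed.
Let msq : measurable_fun [set: R] sqf.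
Proof. by apply/measurable_EFinP; exact: exprn_measurable. Qed.
Let mex : measurable_fun [set: R] exf.
Proof. by apply/measurable_EFinP; exact: measurable_expR. Qed.
Let mpi : measurable_fun [set: R] pif.
Proof.
apply: (@measurable_fun_fubini_tonelli_F _ _ _ _ _ P
  (fun z => (lindley_loss z.1 (X z.2))%:E)).
  exact/measurable_EFinP.
by move=> z; rewrite lee_fin.
Qed.
Let mrho : measurable_fun [set: R] rhof.
Proof.
apply: (@measurable_fun_fubini_tonelli_F _ _ _ _ _ P
  (fun z => (lindley_loss z.1 (X z.2) ^+ 2)%:E)).
  by apply/measurable_EFinP; exact: measurable_funX.
by move=> z; rewrite lee_fin sqr_ge0.
Qed.

Let iX n : P.-integrable setT (EFin \o (fun w => X w ^+ n)).
Proof. exact: (integrable_expr_mgf mX mgfX). Qed.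

Let iX1 : P.-integrable setT (EFin \o X).
Proof. exact: (iX 1). Qed.

Let icst (c : R) : P.-integrable setT (EFin \o (fun _ : T => c)).
Proof. exact: finite_measure_integrable_cst. Qed.

Let step_lossE x w : lindley eta x w - lindley_loss x w = x + w - eta.
Proof. by rewrite /lindley /lindley_loss !maxEle; case: ifPn; case: ifPn; lra. Qed.

(** State and loss are the positive and the negative part of x + w - eta, so their squares add up to
    the square of x + w - eta without a cross term. *)
Let step_lossM x w : lindley eta x w * lindley_loss x w = 0.
Proof.
rewrite /lindley /lindley_loss !maxEle; case: ifPn; case: ifPn; rewrite ?mul0r ?mulr0//.
move=> h1 h2; have -> : x + w - eta = 0 by lra.
by rewrite mul0r.
Qed.

Let loss_le (x w : R) : 0 <= x -> lindley_loss x w <= `|w| + eta.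
Proof.
move=> x0; have e0 := eta0; rewrite /lindley_loss ge_max.
have := ler_norm (- w); rewrite normrN; have := normr_ge0 w; lra.
Qed.

Let iloss_sq (x : R) : 0 <= x ->
  P.-integrable setT (EFin \o (fun w => lindley_loss x (X w) ^+ 2)).
Proof.
move=> x0; have e_0 := eta0.
have iD : P.-integrable setT (EFin \o (fun w => 2 * X w ^+ 2 + 2 * eta ^+ 2)).
  exact: (integrableD measurableT (integrableZl measurableT 2 (iX 2)) (icst (2 * eta ^+ 2))).
apply: (le_integrable measurableT _ _ iD) => //.
  by apply/measurable_EFinP; exact: measurable_funX.
move=> w _ /=; have c0 : 0 <= 2 * X w ^+ 2 + 2 * eta ^+ 2.
  by rewrite addr_ge0// mulr_ge0// sqr_ge0.
rewrite lee_fin !ger0_norm ?sqr_ge0//.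
apply: (@le_trans _ _ ((`|X w| + eta) ^+ 2)).
  by rewrite ler_sqr ?nnegrE ?addr_ge0 ?(ltW e_0)// loss_le.
rewrite -(real_normK (num_real (X w))).
have := sqr_ge0 (`|X w| - eta); rewrite !expr2; lra.
Qed.

Let iloss (x : R) : 0 <= x ->
  P.-integrable setT (EFin \o (fun w => lindley_loss x (X w))).
Proof.
move=> x0; have e_0 := eta0.
have iD : P.-integrable setT (EFin \o (fun w => lindley_loss x (X w) ^+ 2 + 1)).
  exact: (integrableD measurableT (iloss_sq x0) (icst 1)).
apply: (le_integrable measurableT _ _ iD) => //.
  by apply/measurable_EFinP.
move=> w _ /=; rewrite lee_fin !ger0_norm ?addr_ge0 ?sqr_ge0//.
have := sqr_ge0 (lindley_loss x (X w) - 1); rewrite !expr2.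
have := loss_ge0 x (X w); lra.
Qed.

Let Kid (x : R) : 0 <= x -> (K idf x + eta%:E = idf x + pif x)%E.
Proof.
move=> x0.
have iS : P.-integrable setT (EFin \o (fun w => x + X w - eta)).
  exact: (integrableB measurableT (integrableD measurableT (icst x) iX1) (icst eta)).
have iG : P.-integrable setT (EFin \o (fun w => lindley eta x (X w))).
  have := integrableD measurableT iS (iloss x0).
  apply: eq_integrable => // w _ /=; rewrite -EFinD -(step_lossE x (X w)); congr EFin; lra.
have -> : K idf x = (\int[P]_w lindley eta x (X w))%:E.
  rewrite /K -integral_EFin_Rintegral//; apply: eq_integral => w _.
  by rewrite /idf ger0_norm// lindley_ge0.
rewrite /pif integral_EFin_Rintegral//; last exact: iloss.
rewrite /idf ger0_norm// -!EFinD; congr EFin.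
have : \int[P]_w (lindley eta x (X w) - lindley_loss x (X w)) = x - eta.
  under eq_Rintegral do rewrite step_lossE.
  rewrite RintegralB//; last exact: (integrableD measurableT (icst x) iX1).
  rewrite RintegralD// (mgf_mean mX eta0 mgfX) !Rintegral_probability_cst; lra.
rewrite RintegralB//; [lra|exact: iloss].
Qed.

Let Ksq (x : R) : 0 <= x ->
  (K sqf x + (2 * eta)%:E * idf x + rhof x = sqf x + (eta + eta ^+ 2)%:E)%E.
Proof.
move=> x0.
have iS : P.-integrable setT (EFin \o (fun w => X w ^+ 2 + 2 * (x - eta) * X w + (x - eta) ^+ 2)).
  exact: (integrableD measurableT (integrableD measurableT (iX 2)
    (integrableZl measurableT (2 * (x - eta)) iX1)) (icst ((x - eta) ^+ 2))).
have key w : lindley eta x (X w) ^+ 2 + lindley_loss x (X w) ^+ 2 =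
    X w ^+ 2 + 2 * (x - eta) * X w + (x - eta) ^+ 2.
  transitivity ((lindley eta x (X w) - lindley_loss x (X w)) ^+ 2).
    have := step_lossM x (X w); rewrite !expr2; lra.
  by rewrite step_lossE; ring.
have iG : P.-integrable setT (EFin \o (fun w => lindley eta x (X w) ^+ 2)).
  have := integrableB measurableT iS (iloss_sq x0).
  by apply: eq_integrable => // w _ /=; rewrite -EFinB -key addrK.
have -> : K sqf x = (\int[P]_w (lindley eta x (X w) ^+ 2))%:E.
  by rewrite /K -integral_EFin_Rintegral.
rewrite /rhof integral_EFin_Rintegral//; last exact: iloss_sq.
rewrite /idf /sqf ger0_norm// -!EFinD; congr EFin.
have : \int[P]_w (lindley eta x (X w) ^+ 2 + lindley_loss x (X w) ^+ 2) =
    eta + (x - eta) ^+ 2.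
  under eq_Rintegral do rewrite key.
  rewrite RintegralD//; last first.
    exact: (integrableD measurableT (iX 2) (integrableZl measurableT (2 * (x - eta)) iX1)).
  rewrite RintegralD//; last exact: (integrableZl measurableT (2 * (x - eta)) iX1).
  rewrite RintegralZl// (mgf_mean mX eta0 mgfX) (mgf_second mX eta0 mgfX).
  rewrite !Rintegral_probability_cst; lra.
rewrite RintegralD//; last exact: iloss_sq.
rewrite !expr2; lra.
Qed.

(** For a loss l, l^2 <= y l if l <= y and l^2 <= l^4 / y^2 otherwise. The constant is 8 (192 + 1),
    from (u + eta)^4 <= 8 (u^4 + eta^4), the fourth moment bound and eta^4 <= eta^2. *)
Let rho_le (x y : R) : 0 <= x -> 0 < y ->
  (rhof x <= y%:E * pif x + (1544 * eta ^+ 2 / y ^+ 2)%:E)%E.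
Proof.
move=> x0 y0; have [e_0 e_1] := (eta0, eta1).
rewrite /rhof /pif !integral_EFin_Rintegral//; [|exact: iloss|exact: iloss_sq].
rewrite -EFinM -EFinD lee_fin -RintegralZl//; last exact: iloss.
have y2 : 0 < y ^+ 2 by rewrite exprn_gt0.
have i4 : P.-integrable setT (EFin \o (fun w => 8 / y ^+ 2 * (X w ^+ 4 + eta ^+ 4))).
  exact: (integrableZl measurableT _ (integrableD measurableT (iX 4) (icst (eta ^+ 4)))).
have iy : P.-integrable setT (EFin \o (fun w => y * lindley_loss x (X w))).
  exact: (integrableZl measurableT y (iloss x0)).
apply: (@le_trans _ _ (\int[P]_w (y * lindley_loss x (X w) +
    8 / y ^+ 2 * (X w ^+ 4 + eta ^+ 4)))).
  apply: le_Rintegral => //; first exact: iloss_sq.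
    exact: (integrableD measurableT iy i4).
  move=> w _; set l := lindley_loss _ _.
  have l0 : 0 <= l by exact: loss_ge0.
  have ll : l <= `|X w| + eta by exact: loss_le.
  have h4 : l ^+ 4 <= 8 * (X w ^+ 4 + eta ^+ 4).
    apply: (@le_trans _ _ ((`|X w| + eta) ^+ 4)).
      by rewrite lerXn2r ?nnegrE// addr_ge0// ltW.
    have -> : X w ^+ 4 = `|X w| ^+ 4 by rewrite -normrX ger0_norm// exprn_even_ge0.
    set u := `|X w|.
    rewrite -subr_ge0.
    have -> : 8 * (u ^+ 4 + eta ^+ 4) - (u + eta) ^+ 4 =
      (u - eta) ^+ 2 * (7 * u ^+ 2 + 10 * u * eta + 7 * eta ^+ 2) by ring.
    have u0 : 0 <= u by exact: normr_ge0.
    apply: mulr_ge0; first exact: sqr_ge0.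
    by rewrite !addr_ge0 ?mulr_ge0 ?sqr_ge0// ltW.
  have h5 : l ^+ 4 / y ^+ 2 <= 8 / y ^+ 2 * (X w ^+ 4 + eta ^+ 4).
    by rewrite [leRHS]mulrAC ler_pM2r ?invr_gt0.
  have h40 : 0 <= l ^+ 4 / y ^+ 2 by rewrite divr_ge0 ?exprn_ge0// ltW.
  have [ly|ly] := leP l y.
    have : l * l <= y * l by rewrite ler_wpM2r.
    rewrite expr2; lra.
  have : l ^+ 2 <= l ^+ 4 / y ^+ 2.
    rewrite ler_pdivlMr// (exprM l 2 2) [leRHS]expr2.
    by rewrite ler_wpM2l ?sqr_ge0// ler_sqr ?nnegrE// ltW.
  have : 0 <= y * l by rewrite mulr_ge0// ltW.
  lra.
rewrite RintegralD// lerD2l RintegralZl//; last exact: (integrableD measurableT (iX 4) (icst (eta ^+ 4))).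
rewrite RintegralD// ?Rintegral_probability_cst.
have m4 := mgf_fourth mX eta0 mgfX.
rewrite [leRHS](_ : _ = 8 / y ^+ 2 * (193 * eta ^+ 2)); last first.
  by field; rewrite gt_eqF.
apply: ler_wpM2l; first by rewrite divr_ge0// ltW.
have : eta ^+ 4 <= eta ^+ 2 by rewrite ler_wiXn2l// ltW.
lra.
Qed.

(** exp(max(0, y)) <= exp(y) + max(0, -y), and the Gaussian factor exp(eta/2) eats half of the drift
    factor exp(-eta). *)
Let Kex (x : R) : 0 <= x -> (K exf x <= (expR (- eta / 2))%:E * exf x + pif x)%E.
Proof.
move=> x0.
have ie : P.-integrable setT (EFin \o (fun w => expR (x - eta) * expR (1 * X w))).
  exact: (integrableZl measurableT _ (integrable_expR_mgf mX mgfX 1)).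
have -> : ((expR (- eta / 2))%:E * exf x = \int[P]_w (expR (x - eta) * expR (1 * X w))%:E)%E.
  rewrite integral_EFin_Rintegral// RintegralZl//; last exact: (integrable_expR_mgf mX mgfX 1).
  rewrite (Rintegral_mgf mgfX) /exf -EFinM -!expRD; congr (expR _)%:E; by field.
rewrite -ge0_integralD//; last 3 first.
- exact: (measurable_int P ie).
- by move=> w _; rewrite lee_fin loss_ge0.
- by apply/measurable_EFinP.
- apply: ge0_le_integral => //.
  + apply: measurableT_comp => //; exact: measurable_lindley_sec.
  + apply: emeasurable_funD; first exact: (measurable_int P ie).
    exact/measurable_EFinP.
  + move=> w _; rewrite /exf -EFinD lee_fin mul1r -expRD.
    rewrite /lindley /lindley_loss (_ : x - eta + X w = x + X w - eta); last by ring.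
    rewrite !maxEle; case: ifPn; case: ifPn => //; rewrite ?addr0 ?expR0//.
    * have := expR_ge0 (x + X w - eta); lra.
    * have := expR_ge1Dx (x + X w - eta); lra.
    * lra.
Qed.

(** A crude bound; from it the finiteness of all the means follows by induction. *)
Let pi_le (x : R) : 0 <= x -> (pif x <= (eta + eta + 1)%:E)%E.
Proof.
move=> x0; rewrite /pif integral_EFin_Rintegral//; last exact: iloss.
rewrite lee_fin.
have e_0 := eta0.
have -> : eta + eta + 1 = \int[P]_w (X w ^+ 2 + (1 + eta)).
  by rewrite RintegralD// ?(mgf_second mX eta0 mgfX) ?Rintegral_probability_cst; lra.
apply: le_Rintegral => //; first exact: iloss.
  exact: (integrableD measurableT (iX 2) (icst (1 + eta))).
move=> w _; have := loss_le (X w) x0.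
rewrite -(real_normK (num_real (X w))).
have := sqr_ge0 (`|X w| - 1); have := normr_ge0 (X w); rewrite !expr2; lra.
Qed.

Let fin_le (x : \bar R) (c : R) : (0 <= x)%E -> (x <= c%:E)%E -> x \is a fin_num.
Proof. by move=> x0 /le_lt_trans h; rewrite ge0_fin_numE// h// ltry. Qed.

Let eS n : (Kn n.+1 idf 0 + eta%:E = Kn n idf 0 + Kn n pif 0)%E.
Proof.
rewrite lindley_iterS -lindley_iterD// -(lindley_iter_cst P X eta n eta%:E 0).
have mK : measurable_fun [set: R] (K idf) by exact: measurable_lindley_kernel.
have K0 (x : R) : (0 <= K idf x)%E by exact: lindley_kernel_ge0.
have E0 (x : R) : (0 <= (cst eta%:E : R -> \bar R) x)%E by rewrite lee_fin ltW.
rewrite -lindley_iterD//.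
apply/eqP; rewrite eq_le; apply/andP; split; apply: lindley_iter_le => //;
  rewrite ?adde_ge0//; try (by apply: emeasurable_funD);
  by [move=> x; rewrite adde_ge0|move=> x x0 /=; rewrite Kid].
Qed.

Let vS n : (Kn n.+1 sqf 0 + (2 * eta)%:E * Kn n idf 0 + Kn n rhof 0 =
  Kn n sqf 0 + (eta + eta ^+ 2)%:E)%E.
Proof.
have e2 : 0 <= 2 * eta by rewrite mulr_ge0// ltW.
have e3 : 0 <= eta + eta ^+ 2 by rewrite addr_ge0 ?sqr_ge0// ltW.
rewrite lindley_iterS -lindley_iterZ// -(lindley_iter_cst P X eta n (eta + eta ^+ 2)%:E 0).
have mK : measurable_fun [set: R] (K sqf) by exact: measurable_lindley_kernel.
have K0 (x : R) : (0 <= K sqf x)%E by exact: lindley_kernel_ge0.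
have E0 (x : R) : (0 <= (cst (eta + eta ^+ 2)%:E : R -> \bar R) x)%E by rewrite lee_fin.
have mZ : measurable_fun [set: R] (fun x => (2 * eta)%:E * idf x)%E by exact: measurable_funeM.
have Z0 (x : R) : (0 <= (2 * eta)%:E * idf x)%E by rewrite mule_ge0.
rewrite -!lindley_iterD//.
- have F0 (x : R) : (0 <= K sqf x + (2 * eta)%:E * idf x + rhof x)%E.
    by apply: adde_ge0 => //; exact: adde_ge0.
  have mF : measurable_fun [set: R] (fun x => K sqf x + (2 * eta)%:E * idf x + rhof x)%E.
    by apply: emeasurable_funD => //; exact: emeasurable_funD.
  have G0 (x : R) : (0 <= sqf x + cst (eta + eta ^+ 2)%:E x)%E by exact: adde_ge0.
  have mG : measurable_fun [set: R] (fun x => sqf x + cst (eta + eta ^+ 2)%:E x)%E.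
    exact: emeasurable_funD.
  apply/eqP; rewrite eq_le; apply/andP; split; apply: lindley_iter_le => //;
  by move=> x x0 /=; rewrite Ksq.
- by move=> x; rewrite adde_ge0.
- exact: emeasurable_funD.
Qed.

Let e_fin n : Kn n idf 0 \is a fin_num /\ Kn n pif 0 \is a fin_num.
Proof.
have pfin m : Kn m pif 0 \is a fin_num.
  apply: (@fin_le _ (eta + eta + 1)); first exact: lindley_iter_ge0.
  rewrite -(lindley_iter_cst P X eta m (eta + eta + 1)%:E 0).
  have e_0 := ltW eta0.
  have C0 (x : R) : (0 <= (cst (eta + eta + 1)%:E : R -> \bar R) x)%E.
    by rewrite lee_fin !addr_ge0.
  by apply: lindley_iter_le => // x x0; exact: pi_le.
split=> //; elim: n => [|n IH]; first by rewrite /= /idf normr0.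
have := eS n; move/(congr1 (fun x => x \is a fin_num)).
by rewrite !fin_numD IH pfin /= => /andP[].
Qed.

Let r_le n (y : R) : 0 < y ->
  (Kn n rhof 0 <= y%:E * Kn n pif 0 + (1544 * eta ^+ 2 / y ^+ 2)%:E)%E.
Proof.
move=> y0.
have c0 : 0 <= 1544 * eta ^+ 2 / y ^+ 2.
  by apply: divr_ge0; [apply: mulr_ge0; [exact: ler0n|exact: sqr_ge0]|exact: sqr_ge0].
rewrite -lindley_iterZ ?(ltW y0)//.
rewrite -(lindley_iter_cst P X eta n (1544 * eta ^+ 2 / y ^+ 2)%:E 0).
have mZ : measurable_fun [set: R] (fun x => y%:E * pif x)%E by exact: measurable_funeM.
have Z0 (x : R) : (0 <= y%:E * pif x)%E by rewrite mule_ge0// lee_fin ltW.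
have C0 (x : R) : (0 <= (cst (1544 * eta ^+ 2 / y ^+ 2)%:E : R -> \bar R) x)%E.
  by rewrite lee_fin.
rewrite -lindley_iterD//; apply: lindley_iter_le => //.
- by move=> x; exact: adde_ge0.
- exact: emeasurable_funD.
- by move=> x x0 /=; exact: rho_le.
Qed.

Let v_fin n : Kn n sqf 0 \is a fin_num /\ Kn n rhof 0 \is a fin_num.
Proof.
have rfin m : Kn m rhof 0 \is a fin_num.
  have [_ pfin] := e_fin m.
  have := r_le m ltr01; rewrite -(fineK pfin) -EFinM -EFinD.
  by apply: fin_le; exact: lindley_iter_ge0.
split=> //; elim: n => [//|n IH].
have [efin _] := e_fin n.
have := vS n; move/(congr1 (fun x => x \is a fin_num)).
by rewrite !fin_numD IH rfin /= => /andP[/andP[]].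
Qed.

Let aS n : (Kn n.+1 exf 0 <= (expR (- eta / 2))%:E * Kn n exf 0 + Kn n pif 0)%E.
Proof.
rewrite lindley_iterS -lindley_iterZ ?expR_ge0//.
have mZ : measurable_fun [set: R] (fun x => (expR (- eta / 2))%:E * exf x)%E by exact: measurable_funeM.
have Z0 (x : R) : (0 <= (expR (- eta / 2))%:E * exf x)%E by rewrite mule_ge0// lee_fin expR_ge0.
rewrite -lindley_iterD//; apply: lindley_iter_le => //.
- by move=> x; exact: lindley_kernel_ge0.
- by move=> x; rewrite adde_ge0.
- exact: measurable_lindley_kernel.
- exact: emeasurable_funD.
Qed.

Let a_fin n : Kn n exf 0 \is a fin_num.
Proof.
elim: n => [//|n IH]; have [_ pfin] := e_fin n.
have := aS n; rewrite -(fineK pfin) -(fineK IH) -EFinM -EFinD.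
by apply: fin_le; exact: lindley_iter_ge0.
Qed.

Let e n := fine (Kn n idf 0).
Let v n := fine (Kn n sqf 0).
Let p n := fine (Kn n pif 0).
Let r n := fine (Kn n rhof 0).
Let a n := fine (Kn n exf 0).

Let eE n : Kn n idf 0 = (e n)%:E. Proof. by rewrite fineK//; case: (e_fin n). Qed.
Let vE n : Kn n sqf 0 = (v n)%:E. Proof. by rewrite fineK//; case: (v_fin n). Qed.
Let pE n : Kn n pif 0 = (p n)%:E. Proof. by rewrite fineK//; case: (e_fin n). Qed.
Let rE n : Kn n rhof 0 = (r n)%:E. Proof. by rewrite fineK//; case: (v_fin n). Qed.
Let aE n : Kn n exf 0 = (a n)%:E. Proof. by rewrite fineK. Qed.

Let sides : [/\ e 0%N = 0, v 0%N = 0, a 0%N <= 1,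
  (forall n, e n.+1 + eta = e n + p n) &
  (forall n, v n.+1 + 2 * eta * e n + r n = v n + eta + eta ^+ 2)].
Proof.
split; rewrite /e /v /a /= ?normr0// ?expr0n// ?expR0// => n.
- by have := eS n; rewrite !eE pE -!EFinD => -[].
- by have := vS n; rewrite !eE !vE rE -!EFinD => -[]; rewrite addrA.
Qed.

Let sides2 : [/\ (forall n (x : R), 0 < x -> r n <= x * p n + 1544 * eta ^+ 2 / x ^+ 2),
  (forall n, 0 <= r n), (forall n, a n.+1 <= a n * expR (- eta / 2) + p n),
  (forall n, e n <= e n.+1) & (forall n, 0 <= v n <= 2 * a n)].
Proof.
split => n.
- by move=> x x0; have := r_le n x0; rewrite rE pE -EFinM -EFinD lee_fin.
- by rewrite -lee_fin -rE; exact: lindley_iter_ge0.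
- by have := aS n; rewrite !aE pE -EFinM -EFinD lee_fin mulrC.
- rewrite -lee_fin -!eE.
  (* The positive part replaces the absolute value because it is monotone on the whole line; on the
     states of the chain the two coincide. *)
  have h : {homo (fun x : R => (Num.max 0 x)%:E) : x y / x <= y >-> (x <= y)%E}.
    by move=> x y xy; rewrite lee_fin ge_max !le_max lexx/= xy orbT.
  have hm : measurable_fun [set: R] (fun x : R => (Num.max 0 x)%:E).
    by apply/measurable_EFinP; exact: measurable_maxr.
  have h0 (x : R) : (0 <= (Num.max 0 x)%:E)%E by rewrite lee_fin le_max lexx.
  have E m : Kn m idf 0 = Kn m (fun x : R => (Num.max 0 x)%:E) 0.
    apply/eqP; rewrite eq_le; apply/andP; split; apply: lindley_iter_le => //;
    by move=> x x0; rewrite /idf ger0_norm// max_r.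
  by rewrite !E; exact: lindley_iter_nd.
- apply/andP; split; first by rewrite -lee_fin -vE; exact: lindley_iter_ge0.
  rewrite -lee_fin EFinM -vE -aE -lindley_iterZ//.
  apply: lindley_iter_le => //.
  + by move=> x; rewrite mule_ge0.
  + exact: measurable_funeM.
  + move=> x x0; rewrite /sqf /exf -EFinM lee_fin.
    exact: (exprn_le_expR 2).
Qed.

Lemma lindley_iter_mean_le n : (Kn n (fun x => (`|x|)%:E) 0 <= ((1 + eta) / 2)%:E)%E.
Proof.
have [h1 h2 h3 h4 h5] := sides; have [k1 k2 k3 k4 k5] := sides2.
rewrite -[Kn n _ 0]/(Kn n idf 0) eE lee_fin.
by apply: (@lindley_mean_le R eta e v r) => // m; case/andP: (k5 m).
Qed.

Lemma lindley_iter_expR_le n : (Kn n (fun x => (expR x)%:E) 0 <= 4%:E)%E.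
Proof.
have [h1 h2 h3 h4 h5] := sides; have [k1 k2 k3 k4 k5] := sides2.
rewrite -[Kn n _ 0]/(Kn n exf 0) aE lee_fin.
by apply: (@lindley_expR_le R eta e v p r) => // m; case/andP: (k5 m).
Qed.

Lemma lindley_iter_mean_ge n (x : R) : 0 < x -> (0 < n)%N ->
  ((1 / 2 - (4 / (n%:R * eta) + x / 2 * (1 / (n%:R * eta) + 1) + 772 * eta / x ^+ 2))%:E
  <= Kn n (fun x => (`|x|)%:E) 0)%E.
Proof.
have [h1 h2 h3 h4 h5] := sides; have [k1 k2 k3 k4 k5] := sides2 => x0 n0.
rewrite -[Kn n _ 0]/(Kn n idf 0) eE lee_fin.
by apply: (@lindley_mean_ge R eta e v p r a) => // m; case/andP: (k5 m).
Qed.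

End lindley_moments.

Lemma eq_measure_rectangles {R : realType} d1 d2 (T1 : measurableType d1)
    (T2 : measurableType d2) (m m' : {measure set (T1 * T2) -> \bar R}) :
  (m setT < +oo)%E ->
  (forall A B, measurable A -> measurable B -> m (A `*` B) = m' (A `*` B)) ->
  forall X, measurable X -> m X = m' X.
Proof.
move=> moo mm' X mX.
pose C : set (set (T1 * T2)) := [set A `*` B | A in measurable & B in measurable].
have CI : setI_closed C.
  move=> _ _ [X1 mX1 [X2 mX2 <-]] [Y1 mY1 [Y2 mY2 <-]].
  rewrite -setXI; exists (X1 `&` Y1); first exact: measurableI.
  by exists (X2 `&` Y2) => //; exact: measurableI.
apply: (measure_unique C (fun=> setT)) => //.
- exact: measurable_prod_measurableType.
- by move=> _; exists setT => //; exists setT => //; rewrite setXTT.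
- by rewrite bigcup_const.
- by move=> _ [A mA [B mB <-]]; exact: mm'.
Qed.

(** * Independence along a list of variables *)

Section independence.
Context {R : realType} d (Omega : measurableType d) (P : probability Omega R).
Local Open Scope ereal_scope.

Fixpoint rv_event (s : seq (Omega -> R)) (B : nat -> set R) : set Omega :=
  if s is x :: s' then x @^-1` B 0%N `&` rv_event s' (B \o succn) else setT.

Fixpoint rv_prob (s : seq (Omega -> R)) (B : nat -> set R) : \bar R :=
  if s is x :: s' then P (x @^-1` B 0%N) * rv_prob s' (B \o succn) else 1.

(* The list [s] consists of mutually independent variables, and is jointly
   independent of the event [E]. *)
Definition indep_with (E : set Omega) (s : seq (Omega -> R)) : Prop :=
  forall B : nat -> set R, (forall i, measurable (B i)) ->
    P (rv_event s B) = rv_prob s B /\ P (E `&` rv_event s B) = P E * rv_prob s B.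

Definition rv_all_measurable (s : seq (Omega -> R)) : Prop :=
  forall i, (i < size s)%N -> measurable_fun setT (nth (cst 0%R) s i).

Lemma rv_all_measurable_cons x s : rv_all_measurable (x :: s) <->
  measurable_fun setT x /\ rv_all_measurable s.
Proof.
split=> [h|[h1 h2] [|i] //]; last exact: h2.
by split; [exact: (h 0%N)|move=> i; exact: (h i.+1)].
Qed.

Lemma rv_eventE s B : rv_event s B =
  \bigcap_(i in `I_(size s)) (nth (cst 0%R) s i @^-1` B i).
Proof.
elim: s B => [|x s IH] B /=; first by rewrite II0 bigcap_set0.
rewrite IH; apply/seteqP; split => w /=.
  by move=> [h1 h2] [|i] //= isz; exact: (h2 i).
move=> h; split; first exact: (h 0%N).
by move=> i isz; exact: (h i.+1).
Qed.

Lemma rv_probE s B : rv_prob s B =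
  \prod_(i < size s) P (nth (cst 0%R) s i @^-1` B i).
Proof.
elim: s B => [|x s IH] B /=; first by rewrite big_ord0.
by rewrite big_ord_recl /= IH.
Qed.

Lemma measurable_rv_event s B : rv_all_measurable s ->
  (forall i, measurable (B i)) -> measurable (rv_event s B).
Proof.
elim: s B => [|x s IH] B //= /rv_all_measurable_cons[mx ms] mB.
apply: measurableI; last by apply: IH => // i; exact: mB.
by rewrite -(setTI (_ @^-1` _)); exact: mx.
Qed.

Lemma rv_prob_ge0 s B : 0 <= rv_prob s B.
Proof. by elim: s B => [|x s IH] B //=; rewrite mule_ge0. Qed.

Lemma rv_prob_fin_num s B : rv_all_measurable s -> (forall i, measurable (B i)) ->
  rv_prob s B \is a fin_num.
Proof.
elim: s B => [|x s IH] B //= /rv_all_measurable_cons[mx ms] mB.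
rewrite fin_numM//; last by apply: IH => // i; exact: mB.
rewrite fin_num_measure//.
by rewrite -(setTI (_ @^-1` _)); exact: mx.
Qed.

Lemma indep_with_cons E x s : measurable_fun setT x ->
  indep_with E (x :: s) -> indep_with E s.
Proof.
move=> mx h B mB; pose B' i := if i is j.+1 then B j else setT.
have mB' i : measurable (B' i) by case: i => [|i] //=; exact: mB.
have := h B' mB'; rewrite /= preimage_setT probability_setT setTI mul1e.
by rewrite (_ : B' \o succn = B).
Qed.

(** Moves the first variable into the event slot. This is how, after a first window has been folded
    into one variable, the second window is seen to be independent of it. *)
Lemma indep_with_event E x s A : measurable_fun setT x -> measurable A ->
  indep_with E (x :: s) -> indep_with (x @^-1` A) s.
Proof.
move=> mx mA h B mB; split; first by have [] := indep_with_cons mx h mB.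
pose B' i := if i is j.+1 then B j else A.
have mB' i : measurable (B' i) by case: i => [|i] //=; exact: mB.
by have [/= + _] := h B' mB'; rewrite (_ : B' \o succn = B).
Qed.

Lemma indep_with_cst E (c : R) s : indep_with E s -> indep_with E (cst c :: s).
Proof.
move=> h B mB /=; have [h1 h2] := h (B \o succn) (fun i => mB i.+1).
rewrite preimage_cst; case: ifPn => _.
  by rewrite setTI probability_setT mul1e.
by rewrite set0I setI0 measure0 mul0e mule0.
Qed.

(** For a fixed event on the rest of the list, both sides are finite measures in the pair (x, y);
    independence gives equality on rectangles, which generate. Repeated merging turns a function of
    a whole block of variables into one variable independent of the rest. *)
Lemma indep_with_merge E x y s (g : R * R -> R) :
  measurable E -> measurable_fun setT x -> measurable_fun setT y ->
  rv_all_measurable s -> measurable_fun setT g ->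
  indep_with E (x :: y :: s) -> indep_with E ((fun w => g (x w, y w)) :: s).
Proof.
move=> mE mx my ms mg h B mB.
have mxy : measurable_fun setT (fun w => (x w, y w)) by exact: measurable_fun_pair.
pose pi := rv_prob s (B \o succn).
have mBS i : measurable ((B \o succn) i) by exact: mB.
have mS : measurable (rv_event s (B \o succn)) by exact: measurable_rv_event.
have pifin : pi \is a fin_num by exact: rv_prob_fin_num.
have mC : measurable (g @^-1` B 0%N).
  by rewrite -(setTI (_ @^-1` _)); exact: mg.
have mxA A : measurable A -> measurable (x @^-1` A).
  by move=> mA; rewrite -(setTI (_ @^-1` _)); exact: mx.
have myA A : measurable A -> measurable (y @^-1` A).
  by move=> mA; rewrite -(setTI (_ @^-1` _)); exact: my.
(* F will be the event of the rest of the list, without or with E, and c the product of the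
   corresponding probabilities. *)
have key (F : set Omega) (c : R) (mF : measurable F) (c0 : (0 <= c)%R) :
  (forall A1 A2, measurable A1 -> measurable A2 ->
    P ((x @^-1` A1 `&` y @^-1` A2) `&` F) = P (x @^-1` A1 `&` y @^-1` A2) * c%:E) ->
  P ((fun w => g (x w, y w)) @^-1` B 0%N `&` F) =
  P ((fun w => g (x w, y w)) @^-1` B 0%N) * c%:E.
  move=> hF.
  pose nu_ : {measure set (R * R) -> \bar R} := pushforward (mrestr P mF) (fun w => (x w, y w)).
  pose nu'_ : {measure set (R * R) -> \bar R} := mscale (NngNum c0) (pushforward P (fun w => (x w, y w))).
  have : nu_ mxy (g @^-1` B 0%N) = nu'_ mxy (g @^-1` B 0%N).
    apply: eq_measure_rectangles => //.
    - rewrite /nu_ /= /pushforward /mrestr preimage_setT setTI.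
      by rewrite -ge0_fin_numE// fin_num_measure.
    - move=> A1 A2 mA1 mA2; rewrite /nu_ /nu'_ /= /pushforward /mrestr /mscale /= muleC.
      exact: hF.
  by rewrite /nu_ /nu'_ /= /pushforward /mrestr /mscale /= muleC.
pose B' A1 A2 (i : nat) : set R :=
  if i is j.+1 then if j is k.+1 then B j else A2 else A1.
have mB' A1 A2 i : measurable A1 -> measurable A2 -> measurable (B' A1 A2 i).
  by case: i => [|[|i]] //= _ _; exact: mB.
have hB' A1 A2 : measurable A1 -> measurable A2 ->
  P (x @^-1` A1 `&` (y @^-1` A2 `&` rv_event s (B \o succn))) =
    P (x @^-1` A1) * (P (y @^-1` A2) * pi) /\
  P (E `&` (x @^-1` A1 `&` (y @^-1` A2 `&` rv_event s (B \o succn)))) =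
    P E * (P (x @^-1` A1) * (P (y @^-1` A2) * pi)).
  move=> mA1 mA2; have [] := h (B' A1 A2) (fun i => mB' _ _ i mA1 mA2).
  by rewrite /= (_ : (B' A1 A2 \o succn) \o succn = B \o succn).
have hxy A1 A2 : measurable A1 -> measurable A2 ->
    P (x @^-1` A1 `&` y @^-1` A2) = P (x @^-1` A1) * P (y @^-1` A2).
  move=> mA1 mA2.
  pose B2 (i : nat) : set R := if i is j.+1 then if j is k.+1 then setT else A2 else A1.
  have mB2 i : measurable (B2 i) by case: i => [|[|i]] //=.
  have [+ _] := h B2 mB2; rewrite /=.
  have -> : (B2 \o succn) \o succn = (fun=> setT) by [].
  have -> : rv_event s (fun=> setT) = setT.
    by rewrite rv_eventE; apply/seteqP; split.
  have -> : rv_prob s (fun=> setT) = 1.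
    rewrite rv_probE big1// => i _.
    by rewrite preimage_setT probability_setT.
  by rewrite setIT mule1.
split=> /=.
- rewrite (key _ (fine pi) mS) ?fine_ge0 ?rv_prob_ge0// ?fineK//.
  move=> A1 A2 mA1 mA2; rewrite -setIA; have [-> _] := hB' _ _ mA1 mA2.
  by rewrite hxy// muleA.
- have pE : P E \is a fin_num by exact: fin_num_measure.
  rewrite setIC -setIA.
  have mF : measurable (rv_event s (B \o succn) `&` E) by exact: measurableI.
  rewrite (key _ (fine (P E * pi)) mF); last 2 first.
  + by rewrite fine_ge0// mule_ge0// rv_prob_ge0.
  + move=> A1 A2 mA1 mA2; rewrite fineK ?fin_numM// -setIA [X in P X](_ : _ =
      E `&` (x @^-1` A1 `&` (y @^-1` A2 `&` rv_event s (B \o succn)))); last first.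
      by rewrite [RHS]setIC -!setIA.
    have [_ ->] := hB' _ _ mA1 mA2.
    by rewrite hxy// [RHS]muleCA !muleA.
  by rewrite fineK ?fin_numM// muleCA.
Qed.

End independence.

Section independence_expectation.
Context {R : realType} d (Omega : measurableType d) (P : probability Omega R).
Local Open Scope ereal_scope.

(** The joint law is a product measure and Tonelli applies. The law of Y is given as a separate
    [mu], so that an explicit normal law can be put in its place. *)
Lemma ge0_integral_indep (X Y : Omega -> R) (mu : probability R R)
    (h : R * R -> \bar R) :
  measurable_fun setT X -> measurable_fun setT Y ->
  (forall A B, measurable A -> measurable B ->
     P (X @^-1` A `&` Y @^-1` B) = P (X @^-1` A) * mu B) ->
  measurable_fun setT h -> (forall z, 0 <= h z) ->
  \int[P]_w h (X w, Y w) = \int[P]_w \int[mu]_y h (X w, y).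
Proof.
move=> mX mY XY mh h0.
have mXY : measurable_fun setT (fun w => (X w, Y w)) by exact: measurable_fun_pair.
pose Xm := isMeasurableFun.Build _ _ _ _ _ mX.
pose X' : {RV P >-> R} := HB.pack X Xm.
pose m' : {measure set (R * R) -> \bar R} := pushforward P (fun w => (X w, Y w)).
have E1 : \int[m' mXY]_z h z = \int[P]_w h (X w, Y w).
  by rewrite ge0_integral_pushforward.
have E2 : \int[m' mXY]_z h z = \int[distribution P X' \x mu]_z h z.
  apply: eq_measure_integral => A mA _; symmetry.
  exact: product_measure_unique.
rewrite -E1 E2 fubini_tonelli1// ge0_integral_distribution//.
- exact: measurable_fun_fubini_tonelli_F.
- by move=> y; exact: integral_ge0.
Qed.

Lemma ge0_expectationM_indep (X Y : Omega -> R) (f g : R -> \bar R) :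
  measurable_fun setT X -> measurable_fun setT Y ->
  (forall A B, measurable A -> measurable B ->
     P (X @^-1` A `&` Y @^-1` B) = P (X @^-1` A) * P (Y @^-1` B)) ->
  measurable_fun [set: R] f -> measurable_fun [set: R] g ->
  (forall x : R, 0 <= f x) -> (forall x : R, 0 <= g x) ->
  \int[P]_w (f (X w) * g (Y w)) = (\int[P]_w f (X w)) * \int[P]_w g (Y w).
Proof.
move=> mX mY XY mf mg f0 g0.
pose Ym := isMeasurableFun.Build _ _ _ _ _ mY.
pose Y' : {RV P >-> R} := HB.pack Y Ym.
pose mu : probability R R := distribution P Y'.
have mfg : measurable_fun [set: R * R] (fun z => f z.1 * g z.2).
  by apply: emeasurable_funM; exact: measurableT_comp.
rewrite (@ge0_integral_indep X Y mu (fun z => f z.1 * g z.2))//=; last first.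
  by move=> z; rewrite mule_ge0.
under eq_integral => w _ do rewrite ge0_integralZl//.
rewrite ge0_integralZr//.
- by rewrite (ge0_integral_distribution Y').
- exact: measurableT_comp.
- exact: integral_ge0.
Qed.

End independence_expectation.

(** * Lindley's recursion driven by independent variables *)

Section lindley_rv.
Context {R : realType} d (Omega : measurableType d) (P : probability Omega R).
Context (c eta : R).

Definition lindley_fold (x0 : Omega -> R) (s : seq (Omega -> R)) (w : Omega) : R :=
  foldl (fun l x => lindley eta l (c * x w)) (x0 w) s.

Lemma measurable_lindley_fold x0 s : measurable_fun setT x0 -> rv_all_measurable s ->
  measurable_fun setT (lindley_fold x0 s).
Proof.
elim: s x0 => [|x s IH] x0 // mx0 /rv_all_measurable_cons[mx ms].
apply: (IH (fun w => lindley eta (x0 w) (c * x w))) => //.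
apply: measurable_maxr => //; apply: measurable_funB => //.
by apply: measurable_funD => //; exact: measurable_funM.
Qed.

Let measurable_step : measurable_fun [set: R * R] (fun z => lindley eta z.1 (c * z.2)).
Proof.
apply: measurable_maxr => //; apply: measurable_funB => //.
by apply: measurable_funD => //; exact: measurable_funM.
Qed.

Lemma indep_with_lindley E x0 s s' : measurable E -> measurable_fun setT x0 ->
  rv_all_measurable (s ++ s') -> indep_with P E (x0 :: s ++ s') ->
  indep_with P E (lindley_fold x0 s :: s').
Proof.
move=> mE; elim: s x0 => [|x s IH] x0 // mx0 /rv_all_measurable_cons[mx ms] h.
apply: (IH (fun w => lindley eta (x0 w) (c * x w))) => //.
  apply: measurable_maxr => //; apply: measurable_funB => //.
  by apply: measurable_funD => //; exact: measurable_funM.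
exact: (indep_with_merge mE mx0 mx ms measurable_step).
Qed.

Lemma indep_with_pair E x y s A B : measurable_fun setT x -> measurable_fun setT y ->
  indep_with P E (x :: y :: s) -> measurable A -> measurable B ->
  P (x @^-1` A `&` y @^-1` B) = (P (x @^-1` A) * P (y @^-1` B))%E.
Proof.
move=> mx my h mA mB.
pose B2 (i : nat) : set R := if i is j.+1 then if j is k.+1 then setT else B else A.
have mB2 i : measurable (B2 i) by case: i => [|[|i]] //=.
have [+ _] := h B2 mB2; rewrite /=.
have -> : (B2 \o succn) \o succn = (fun=> setT) by [].
have -> : rv_event s (fun=> setT) = setT.
  by rewrite rv_eventE; apply/seteqP; split.
have -> : rv_prob P s (fun=> setT) = 1%E.
  rewrite rv_probE big1// => i _.
  by rewrite preimage_setT probability_setT.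
by rewrite setIT mule1.
Qed.

(** Merging the first step into the starting variable keeps it independent of the tail, hence the
    induction over all starting variables; integrating out the merged step is one more application
    of the kernel. *)
Lemma integral_lindley_fold x0 s (mu : probability R R) (f : R -> \bar R) :
  measurable_fun setT x0 -> rv_all_measurable s ->
  (forall i B, (i < size s)%N -> measurable B ->
    P (nth (cst 0) s i @^-1` B) = mu B) ->
  indep_with P setT (x0 :: s) ->
  (forall x : R, (0 <= f x)%E) -> measurable_fun [set: R] f ->
  (\int[P]_w f (lindley_fold x0 s w) =
   \int[P]_w lindley_iter mu ( *%R c) eta (size s) f (x0 w))%E.
Proof.
move=> + + + + f0 mf; elim: s x0 => [|x s IH] x0 // mx0 /rv_all_measurable_cons[mx ms] law h.
have mx1 : measurable_fun setT (fun w => lindley eta (x0 w) (c * x w)).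
  apply: measurable_maxr => //; apply: measurable_funB => //.
  by apply: measurable_funD => //; exact: measurable_funM.
have mc : measurable_fun [set: R] ( *%R c) by exact: measurable_funM.
transitivity (\int[P]_w lindley_iter mu ( *%R c) eta (size s) f (lindley eta (x0 w) (c * x w)))%E.
  apply: (IH (fun w => lindley eta (x0 w) (c * x w))) => //.
    by move=> i B isz mB; exact: (law i.+1).
  exact: (indep_with_merge measurableT mx0 mx ms measurable_step).
rewrite (@ge0_integral_indep _ _ _ P x0 x mu
  (fun z => lindley_iter mu ( *%R c) eta (size s) f (lindley eta z.1 (c * z.2))))//.
- move=> A B mA mB; rewrite (indep_with_pair mx0 mx h)//.
  by rewrite (law 0%N).
- apply: (measurableT_comp _ measurable_step).
  exact: measurable_lindley_iter.
- by move=> z; exact: lindley_iter_ge0.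
Qed.

End lindley_rv.

Section mutually_independent_list.
Context {R : realType} d (Omega : measurableType d) (P : probability Omega R).

(** Indices outside the list get the full set. Any list without repetitions is allowed, so the order
    can be reversed and single increments left out. *)
Lemma indep_with_map (X : nat -> Omega -> R) (n : nat) (l : seq nat) :
  mutually_independent P (fun (i : 'I_n) => X i) ->
  uniq l -> all (ltn^~ n) l -> indep_with P setT (map X l).
Proof.
move=> iX ul /allP ln B mB; rewrite setTI probability_setT mul1e.
suff -> : P (rv_event (map X l) B) = rv_prob P (map X l) B by [].
pose B' (i : nat) : set R := if i \in l then B (index i l) else setT.
have mB' i : measurable (B' i) by rewrite /B'; case: ifPn.
have := iX (fun i : 'I_n => B' i) (fun i => mB' i).
have -> : \bigcap_(i : 'I_n) (X i @^-1` B' i) = rv_event (map X l) B.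
  rewrite rv_eventE size_map; apply/seteqP; split => w /=.
    move=> h i /= il; have lin := ln _ (mem_nth 0%N il).
    have := h (Ordinal lin) Logic.I => /=.
    by rewrite /B' mem_nth// index_uniq// (nth_map 0%N).
  move=> h i _ /=; rewrite /B'; case: ifPn => // il.
  have := h (index (i : nat) l); rewrite /= index_mem => /(_ il).
  by rewrite (nth_map 0%N) ?index_mem// nth_index.
move=> ->; rewrite rv_probE size_map.
rewrite -(big_mkord xpredT (fun i => P (X i @^-1` B' i))).
rewrite (bigID (mem l))/= [X in (_ * X)%E]big1 ?mule1; last first.
  by move=> i /negbTE il; rewrite /B' il preimage_setT probability_setT.
rewrite -big_filter (perm_big l); last first.
  apply: uniq_perm => //; first by rewrite filter_uniq// iota_uniq.
  move=> i; rewrite mem_filter mem_index_iota/= andb_idr// => il.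
  exact: (ln _ il).
rewrite (big_nth 0%N) big_mkord; apply: eq_bigr => i _.
by rewrite (nth_map 0%N)// /B' mem_nth// index_uniq.
Qed.

End mutually_independent_list.

(** * Suprema of Brownian motion with drift *)

Section halfline_paths.
Context {R : realType} (w : R -> R).
Hypothesis cw : {within `[0, +oo[, continuous w}.

Lemma halfline_continuous_eps (t e : R) : 0 <= t -> 0 < e ->
  exists2 del : R, 0 < del & forall s : R, 0 <= s -> `|s - t| < del -> `|w s - w t| < e.
Proof.
move=> t0 e0.
have tA : (`[0, +oo[%classic : set R) t by rewrite /= in_itv/= t0.
have /subspace_continuousP/(_ t tA)/cvgrPdist_lt/(_ e e0) := cw.
move=> [del /= del0 h]; exists del => // s s0 std; rewrite distrC.
apply: (h s); first by rewrite /ball_/= distrC.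
by rewrite in_itv/= s0.
Qed.

Lemma halfline_bounded (T : R) : 0 <= T ->
  exists2 M : R, 0 <= M & forall t : R, 0 <= t <= T -> `|w t| <= M.
Proof.
move=> T0.
have cT : {within `[0, T], continuous (fun t => `|w t|)}.
  have cT : {within `[0, T], continuous w}.
    apply: continuous_subspaceW cw => x /=.
    by rewrite !in_itv/= => /andP[->].
  by move=> x; apply: cvg_norm; exact: cT.
have [c _ h] := EVT_max T0 cT.
exists `|w c|; first exact: normr_ge0.
by move=> t tT; apply: h; rewrite in_itv.
Qed.

End halfline_paths.

Section dyadic_sup.
Context {R : realType} (c a b : R).

Definition dyadic_step (n : nat) : R := (b - a) / 2 ^+ n.
Definition dyadic_grid (n j : nat) : R := a + j%:R * dyadic_step n.

(** Folded from the right, the recursion computes the largest partial sum: max 0 (x + M) puts a step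
    in front of the best continuation. The result is the maximum over the grid of c (w t - w a) -
    c^2 (t - a). *)
Definition dyadic_max (n : nat) (w : R -> R) : R :=
  foldr (fun x l => lindley (c ^+ 2 * dyadic_step n) l (c * x)) 0
    [seq w (dyadic_grid n j.+1) - w (dyadic_grid n j) | j <- iota 0 (2 ^ n)].

Lemma foldr_lindley_ge (eta : R) (x : nat -> R) (i m j : nat) : (j <= m)%N ->
  \sum_(i <= l < i + j) (c * x l - eta) <=
  foldr (fun x l => lindley eta l (c * x)) 0 [seq x l | l <- iota i m].
Proof.
elim: m i j => [|m IH] i [|j] //=.
- by rewrite addn0 big_geq.
- by rewrite addn0 big_geq// lindley_ge0.
rewrite ltnS => jm; rewrite big_ltn ?addnS ?ltnS ?leq_addr//.
have := IH i.+1 j jm; rewrite addSn => h.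
rewrite /lindley le_max; apply/orP; right.
by rewrite -addnS in h *; lra.
Qed.

Lemma foldr_lindley_le (eta y : R) (x : nat -> R) (i m : nat) :
  (forall j, (j <= m)%N -> \sum_(i <= l < i + j) (c * x l - eta) <= y) ->
  foldr (fun x l => lindley eta l (c * x)) 0 [seq x l | l <- iota i m] <= y.
Proof.
elim: m i y => [|m IH] i y h /=.
  by have := h 0%N (leqnn _); rewrite addn0 big_geq.
rewrite /lindley ge_max; apply/andP; split.
  by have := h 0%N (leq0n _); rewrite addn0 big_geq.
have := IH i.+1 (y - (c * x i - eta)).
have h' j : (j <= m)%N -> \sum_(i.+1 <= l < i.+1 + j) (c * x l - eta) <= y - (c * x i - eta).
  move=> jm; have := h j.+1; rewrite ltnS => /(_ jm).
  rewrite big_ltn ?addnS ?ltnS ?leq_addr// addSn; lra.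
by move=> /(_ h'); lra.
Qed.

Lemma dyadic_sumE n w j :
  \sum_(0 <= l < 0 + j) (c * (w (dyadic_grid n l.+1) - w (dyadic_grid n l)) -
    c ^+ 2 * dyadic_step n) =
  c * (w (dyadic_grid n j) - w a) - c ^+ 2 * (dyadic_grid n j - a).
Proof.
elim: j => [|j IH].
  by rewrite addn0 big_geq// /dyadic_grid mul0r addr0 !subrr !mulr0 subr0.
rewrite addnS big_nat_recr//= IH /dyadic_grid -(natr1 j); ring.
Qed.

Lemma dyadic_max_ge n w j : (j <= 2 ^ n)%N ->
  c * (w (dyadic_grid n j) - w a) - c ^+ 2 * (dyadic_grid n j - a) <= dyadic_max n w.
Proof.
move=> jn; rewrite -dyadic_sumE.
exact: (@foldr_lindley_ge _ (fun l => w (dyadic_grid n l.+1) - w (dyadic_grid n l))).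
Qed.

Lemma dyadic_max_le n w y : (forall j, (j <= 2 ^ n)%N ->
  c * (w (dyadic_grid n j) - w a) - c ^+ 2 * (dyadic_grid n j - a) <= y) ->
  dyadic_max n w <= y.
Proof.
move=> h; apply: (@foldr_lindley_le _ _ (fun l => w (dyadic_grid n l.+1) - w (dyadic_grid n l))).
by move=> j jn; rewrite dyadic_sumE; exact: h.
Qed.

Lemma dyadic_max_ge0 n w : 0 <= dyadic_max n w.
Proof.
have := @dyadic_max_ge n w 0 (leq0n _).
by rewrite /dyadic_grid mul0r addr0 !subrr !mulr0 subr0.
Qed.

Lemma dyadic_max_nd w : nondecreasing_seq (dyadic_max ^~ w).
Proof.
apply/nondecreasing_seqP => n; apply: dyadic_max_le => j jn.
have -> : dyadic_grid n j = dyadic_grid n.+1 j.*2.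
  rewrite /dyadic_grid /dyadic_step -mul2n natrM exprS; field.
  by rewrite expf_neq0.
by apply: dyadic_max_ge; rewrite expnS mul2n leq_double.
Qed.

Hypothesis ab : a <= b.
Hypothesis a0 : 0 <= a.

Lemma dyadic_step_ge0 n : 0 <= dyadic_step n.
Proof. by rewrite divr_ge0 ?subr_ge0// exprn_ge0. Qed.

Lemma dyadic_grid_itv n j : (j <= 2 ^ n)%N -> a <= dyadic_grid n j <= b.
Proof.
move=> jn; rewrite /dyadic_grid lerDl mulr_ge0 ?dyadic_step_ge0//=.
have -> : b = a + (2 ^ n)%:R * dyadic_step n.
  by rewrite /dyadic_step natrX; field; rewrite expf_neq0.
by rewrite lerD2l ler_wpM2r ?dyadic_step_ge0// ler_nat.
Qed.

Lemma dyadic_max_le_sup n w y : (forall t, a <= t <= b ->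
  c * (w t - w a) - c ^+ 2 * (t - a) <= y) -> dyadic_max n w <= y.
Proof.
by move=> h; apply: dyadic_max_le => j jn; apply: h; exact: dyadic_grid_itv.
Qed.

Lemma dyadic_approx (n : nat) (t : R) : a <= t <= b -> exists2 j, (j <= 2 ^ n)%N &
  `|dyadic_grid n j - t| <= dyadic_step n.
Proof.
move=> /andP[at_ tb].
have [ab0|abn] := eqVneq a b.
  exists 0%N => //; rewrite /dyadic_grid mul0r addr0.
  have -> : t = a by apply/eqP; rewrite eq_le at_ andbT ab0.
  by rewrite subrr normr0 dyadic_step_ge0.
have ab' : a < b by rewrite lt_neqAle abn ab.
have h0 : 0 < dyadic_step n by rewrite divr_gt0 ?subr_gt0// exprn_gt0.
have x0 : 0 <= (t - a) / dyadic_step n by rewrite divr_ge0 ?subr_ge0// ltW.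
have /andP[h1 h2] := truncn_itv x0.
set j := Num.truncn _ in h1 h2.
exists j.
  rewrite -(ler_nat R) (le_trans h1)// ler_pdivrMr// natrX /dyadic_step mulrC divfK ?expf_neq0//.
  by rewrite lerD2r.
move: h1 h2; rewrite ler_pdivlMr// ltr_pdivrMr// -(natr1 j) /dyadic_grid => h1 h2.
rewrite ler_norml; lra.
Qed.

Lemma dyadic_max_sup_ge (w : R -> R) (y : R) :
  {within `[0, +oo[, continuous w} -> (forall n, dyadic_max n w <= y) ->
  forall t, a <= t <= b -> c * (w t - w a) - c ^+ 2 * (t - a) <= y.
Proof.
move=> cw h t tab; have /andP[at_ tb] := tab.
have t0 : 0 <= t by rewrite (le_trans a0).
apply/ler_addgt0Pr => e e0.
pose e1 := e / (2 * (1 + `|c|)).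
have c1 : 0 < 1 + `|c| by rewrite ltr_pwDl.
have e10 : 0 < e1 by rewrite divr_gt0// mulr_gt0.
have [d1 d10 hd1] := halfline_continuous_eps cw t0 e10.
pose d2 := Num.min d1 (e / (2 * (1 + c ^+ 2))).
have c2 : 0 < 1 + c ^+ 2 by rewrite ltr_pwDl// sqr_ge0.
have d20 : 0 < d2 by rewrite lt_min d10 divr_gt0// mulr_gt0.
have [n hn] : exists n, dyadic_step n < d2.
  exists (Num.truncn ((b - a) / d2)).+1.
  rewrite /dyadic_step ltr_pdivrMr ?exprn_gt0// mulrC -ltr_pdivrMr//.
  rewrite (lt_le_trans (truncnS_gt _))// -natrX ler_nat.
  exact/ltnW/ltn_expl.
have [j jn jt] := dyadic_approx n tab.
have jd : `|dyadic_grid n j - t| < d2 by exact: le_lt_trans hn.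
have /andP[ga gb] := dyadic_grid_itv jn.
have g0 : 0 <= dyadic_grid n j by rewrite (le_trans a0).
have jd1 : `|dyadic_grid n j - t| < d1 by rewrite (lt_le_trans jd)// ge_min lexx.
have jd2 : `|dyadic_grid n j - t| < e / (2 * (1 + c ^+ 2)).
  by rewrite (lt_le_trans jd)// ge_min lexx orbT.
have k1 := hd1 _ g0 jd1.
have k2 := le_trans (dyadic_max_ge w jn) (h n).
have k3 : `|c * (w (dyadic_grid n j) - w t)| <= e / 2.
  rewrite normrM (@le_trans _ _ ((1 + `|c|) * e1))//.
    by apply: ler_pM => //; [rewrite lerDr|exact: ltW].
  by rewrite /e1 [leLHS](_ : _ = e / 2)//; field; rewrite gt_eqF.
have k4 : `|c ^+ 2 * (dyadic_grid n j - t)| <= e / 2.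
  rewrite normrM (ger0_norm (sqr_ge0 _)) (@le_trans _ _ ((1 + c ^+ 2) * (e / (2 * (1 + c ^+ 2)))))//.
    by apply: ler_pM => //; [exact: sqr_ge0|rewrite lerDr|exact: ltW].
  by rewrite [leLHS](_ : _ = e / 2)//; field; rewrite gt_eqF.
move: k3 k4; rewrite !ler_norml => /andP[k3 k3'] /andP[k4 k4'].
move: k2 k3 k3' k4 k4'; set g := dyadic_grid n j; lra.
Qed.

End dyadic_sup.

(** The monotone limit exists everywhere with extended values; it is identified with Y only almost
    everywhere, since paths are continuous only almost surely. *)
Lemma cvg_integral_ae_nondecreasing {R : realType} d (T : measurableType d)
    (P : {measure set T -> \bar R}) (X : nat -> T -> R) (Y : T -> R) :
  (forall n, measurable_fun setT (X n)) -> measurable_fun setT Y ->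
  (forall n w, 0 <= X n w) -> (forall w, 0 <= Y w) ->
  (forall w, nondecreasing_seq (X ^~ w)) ->
  {ae P, forall w, X n w @[n --> \oo] --> Y w} ->
  ((\int[P]_w (X n w)%:E) @[n --> \oo] --> \int[P]_w (Y w)%:E)%E.
Proof.
move=> mX mY X0 Y0 ndX XY.
pose L w := ereal_sup (range (fun n => (X n w)%:E)).
have cL w : ((X n w)%:E @[n --> \oo] --> L w)%E.
  by apply: ereal_nondecreasing_cvgn => m n mn; rewrite lee_fin; exact: ndX.
have mL : measurable_fun setT L.
  apply: (@emeasurable_fun_cvg _ _ _ _ (fun n w => (X n w)%:E)) => //.
  by move=> n; exact/measurable_EFinP.
have L0 w : (0 <= L w)%E.
  apply: (@le_trans _ _ (X 0%N w)%:E); first by rewrite lee_fin.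
  by apply: ereal_sup_ubound; exists 0%N.
have -> : (\int[P]_w (Y w)%:E = \int[P]_w L w)%E.
  apply: ge0_ae_eq_integral => //; first exact/measurable_EFinP.
    by move=> w _; rewrite lee_fin.
  move: XY; apply: filterS => w h _.
  have h' : ((X n w)%:E @[n --> \oo] --> (Y w)%:E)%E by apply: cvg_EFin => //; exact: nearW.
  exact: (cvg_unique _ h' (cL w)).
have -> : (\int[P]_w L w = \int[P]_w limn (fun n => (X n w)%:E))%E.
  by apply: eq_integral => w _; apply/esym/cvg_lim => //; exact: cL.
apply: cvg_monotone_convergence => //.
- by move=> n; exact/measurable_EFinP.
- by move=> n w _; rewrite lee_fin.
- by move=> w _ m n mn; rewrite lee_fin; exact: ndX.
Qed.

Section normal_law.
Context {R : realType}.

Definition ocitv_id : measurableTypeR R -> R := id.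

Lemma measurable_ocitv_id : measurable_fun setT ocitv_id.
Proof. exact: measurable_id. Qed.

HB.instance Definition _ := isMeasurableFun.Build _ _ (measurableTypeR R) R
  ocitv_id measurable_ocitv_id.

(* [normal_prob] lives on the generated sigma-algebra type; this is the same law
   on [R] itself. *)
Definition normal_law (s : R) : probability R R :=
  distribution (normal_prob 0 s) ocitv_id.

Lemma normal_law_mgf (s t : R) : 0 < s ->
  (\int[normal_law s]_x (expR (t * x))%:E = (expR (t ^+ 2 * s ^+ 2 / 2))%:E)%E.
Proof.
move=> s0; rewrite -normal_prob_mgf//.
rewrite [LHS](ge0_integral_distribution _ (f := fun x : R => (expR (t * x))%:E))//.
by apply/measurable_EFinP; apply: measurableT_comp => //; exact: measurable_funM.
Qed.

End normal_law.

(** * Moments and independence of suprema over time windows *)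

Section wiener_window.
Context {R : realType} d (Omega : measurableType d) (P : probability Omega R).
Context (W : R -> {RV P >-> R}) (hW : standard_wiener W).

Definition window_max (c a b : R) (n : nat) (w : Omega) : R :=
  dyadic_max c a b n (fun t => W t w).

(** Built from grid maxima at every sample point, which makes it measurable without any regularity
    of the path; [fine] returns 0 where these maxima are unbounded, which continuity of the path
    excludes. *)
Definition window_sup (c a b : R) (w : Omega) : R :=
  fine (ereal_sup (range (fun n => (window_max c a b n w)%:E))).

Definition window_incr (a b : R) (n j : nat) (w : Omega) : R :=
  W (dyadic_grid a b n j.+1) w - W (dyadic_grid a b n j) w.

(** The increments are reversed because the maximum is a fold from the right, whereas the chain is
    run by a fold from the left. *)
Definition window_list (a b : R) (n : nat) : seq (Omega -> R) :=
  map (window_incr a b n) (rev (iota 0 (2 ^ n))).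

Lemma window_maxE c a b n :
  window_max c a b n =
  lindley_fold c (c ^+ 2 * dyadic_step a b n) (cst 0) (window_list a b n).
Proof.
apply/funext => w; rewrite /window_max /dyadic_max /lindley_fold /window_list.
rewrite map_rev foldl_rev.
by elim: (iota 0 (2 ^ n)) => [//|j s IH] /=; rewrite IH.
Qed.

Lemma measurable_window_incr a b n j : measurable_fun setT (window_incr a b n j).
Proof. exact: measurable_funB. Qed.

Lemma rv_all_measurable_map (X : nat -> Omega -> R) l :
  (forall j, measurable_fun setT (X j)) -> rv_all_measurable (map X l).
Proof.
move=> mX i; rewrite size_map => il.
by rewrite (nth_map 0%N).
Qed.

Lemma measurable_window_max c a b n : measurable_fun setT (window_max c a b n).
Proof.
rewrite window_maxE; apply: measurable_lindley_fold => //.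
by apply: rv_all_measurable_map => j; exact: measurable_window_incr.
Qed.

Lemma window_max_ge0 c a b n w : 0 <= window_max c a b n w.
Proof. exact: dyadic_max_ge0. Qed.

Lemma window_max_nd c a b w : nondecreasing_seq (window_max c a b ^~ w).
Proof. exact: dyadic_max_nd. Qed.

Lemma measurable_window_sup c a b : measurable_fun setT (window_sup c a b).
Proof.
apply: measurableT_comp; first exact: fine_measurable.
apply: (@emeasurable_fun_cvg _ _ _ _ (fun n w => (window_max c a b n w)%:E)) => //.
  by move=> n; apply/measurable_EFinP; exact: measurable_window_max.
move=> w _; apply: ereal_nondecreasing_cvgn => m n mn.
by rewrite lee_fin; exact: window_max_nd.
Qed.

Lemma window_sup_ge0 c a b w : 0 <= window_sup c a b w.
Proof.
apply/fine_ge0/(@le_trans _ _ (window_max c a b 0 w)%:E).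
  by rewrite lee_fin window_max_ge0.
by apply: ereal_sup_ubound; exists 0%N.
Qed.

Section one_window.
Context (c a b : R).
Hypothesis c0 : 0 < c.
Hypothesis a0 : 0 <= a.
Hypothesis ab : a < b.

Let step_gt0 n : 0 < dyadic_step a b n.
Proof. by rewrite divr_gt0 ?subr_gt0// exprn_gt0. Qed.

Lemma window_max_bounded w : {within `[0, +oo[, continuous (fun t => W t w)} ->
  exists M, forall n, window_max c a b n w <= M.
Proof.
move=> cw; have b0 : 0 <= b by rewrite (le_trans a0)// ltW.
have [M M0 hM] := halfline_bounded cw b0.
have c_0 := c0.
exists (c * (M + M)) => n; apply: dyadic_max_le_sup; first exact: ltW.
move=> t /andP[at_ tb].
have h1 := hM t; have h2 := hM a.
have {h1} : `|W t w| <= M by apply: h1; rewrite (le_trans a0 at_).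
have {h2} : `|W a w| <= M by apply: h2; rewrite a0 ltW.
rewrite !ler_norml => /andP[h1 h2] /andP[h3 h4].
have k1 : c * (W t w - W a w) <= c * (M + M) by rewrite ler_pM2l//; lra.
have k2 : 0 <= c ^+ 2 * (t - a) by rewrite mulr_ge0 ?sqr_ge0// subr_ge0.
lra.
Qed.

Lemma cvg_window_max w : {within `[0, +oo[, continuous (fun t => W t w)} ->
  window_max c a b n w @[n --> \oo] --> window_sup c a b w.
Proof.
move=> /window_max_bounded[M hM].
have ub : has_ubound (range (window_max c a b ^~ w)) by exists M => _ [n _ <-].
have -> : window_sup c a b w = sup (range (window_max c a b ^~ w)).
  rewrite /window_sup (_ : range (fun n => (window_max c a b n w)%:E) = EFin @` range (window_max c a b ^~ w)); last first.
    by rewrite image_comp.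
  by rewrite ereal_sup_EFin//; exists (window_max c a b 0 w); exists 0%N.
exact: nondecreasing_cvgn (@window_max_nd c a b w) ub.
Qed.

Lemma window_max_le_sup w n : {within `[0, +oo[, continuous (fun t => W t w)} ->
  window_max c a b n w <= window_sup c a b w.
Proof.
move=> cw; have h := cvg_window_max cw.
have <- := cvg_lim (@Rhausdorff R) h.
by apply: nondecreasing_cvgn_le; [exact: window_max_nd|exact: cvgP h].
Qed.

Lemma window_sup_ge w : {within `[0, +oo[, continuous (fun t => W t w)} ->
  forall t, a <= t <= b ->
  c * (W t w - W a w) - c ^+ 2 * (t - a) <= window_sup c a b w.
Proof.
move=> cw t tab; apply: (@dyadic_max_sup_ge R c a b (ltW ab) a0 (fun t => W t w)) => //.
by move=> n; exact: window_max_le_sup.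
Qed.

Lemma window_sup_le w y : {within `[0, +oo[, continuous (fun t => W t w)} ->
  (forall t, a <= t <= b -> c * (W t w - W a w) - c ^+ 2 * (t - a) <= y) ->
  window_sup c a b w <= y.
Proof.
move=> cw h; have h2 := cvg_window_max cw.
have <- := cvg_lim (@Rhausdorff R) h2.
apply: limr_le; first exact: cvgP h2.
by apply: nearW => n; apply: dyadic_max_le_sup => //; exact: ltW.
Qed.

Let mgf_normal n (t : R) :
  (\int[normal_law (Num.sqrt (dyadic_step a b n))]_y (expR (t * (c * y)))%:E =
  (expR (t ^+ 2 * (c ^+ 2 * dyadic_step a b n) / 2))%:E)%E.
Proof.
have s0 : 0 < Num.sqrt (dyadic_step a b n) by rewrite sqrtr_gt0.
have := normal_law_mgf (t * c) s0.
rewrite sqr_sqrtr ?ltW// exprMn !mulrA => <-.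
by apply: eq_integral => y _; rewrite mulrA.
Qed.

Let window_list_indep n : indep_with P setT (window_list a b n).
Proof.
apply: (@indep_with_map _ _ _ P (window_incr a b n) (2 ^ n)).
- apply: (wiener_increments_independent hW).
    by rewrite /dyadic_grid mul0r addr0.
  move=> i j ij; rewrite /dyadic_grid lerD2l ler_wpM2r ?ler_nat//.
  exact: ltW.
- by rewrite rev_uniq iota_uniq.
- by rewrite all_rev; apply/allP => i; rewrite mem_iota.
Qed.

(** Duality of the running maximum of a walk with the reflected walk: on reversed increments the
    maximum is the state, after 2^n steps, of the chain started at 0. *)
Lemma integral_window_max n (f : R -> \bar R) : (forall x : R, (0 <= f x)%E) ->
  measurable_fun [set: R] f ->
  (\int[P]_w f (window_max c a b n w) =
   lindley_iter (normal_law (Num.sqrt (dyadic_step a b n))) ( *%R c)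
    (c ^+ 2 * dyadic_step a b n) (2 ^ n) f 0)%E.
Proof.
move=> f0 mf; rewrite window_maxE.
rewrite (@integral_lindley_fold R d Omega P _ _ _ _ (normal_law (Num.sqrt (dyadic_step a b n))))//.
- rewrite /window_list size_map size_rev size_iota/=.
  rewrite integral_cst//; have /= -> := probability_setT P.
  by rewrite mule1.
- by apply: rv_all_measurable_map => j; exact: measurable_window_incr.
- move=> i B; rewrite size_map => il mB; rewrite (nth_map 0%N)//.
  set j := nth _ _ _.
  have gj : dyadic_grid a b n j < dyadic_grid a b n j.+1.
    by rewrite /dyadic_grid ltrD2l ltr_pM2r ?ltr_nat.
  have g0 : 0 <= dyadic_grid a b n j.
    by rewrite /dyadic_grid addr_ge0// mulr_ge0// ltW.
  have := wiener_increments_normal hW g0 gj mB.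
  rewrite /pushforward => ->.
  congr (normal_prob 0 (Num.sqrt _) B).
  by rewrite /dyadic_grid -(natr1 j); ring.
- exact: indep_with_cst.
Qed.

Let mc : measurable_fun [set: R] ( *%R c). Proof. exact: measurable_funM. Qed.

Let eta_gt0 n : 0 < c ^+ 2 * dyadic_step a b n.
Proof. by rewrite mulr_gt0// exprn_gt0. Qed.

Let window_max_norm n w : (window_max c a b n w)%:E = (`|window_max c a b n w|)%:E.
Proof. by rewrite ger0_norm// window_max_ge0. Qed.

Lemma dyadic_eta_small (e : R) : 0 < e ->
  exists N, forall n, (N <= n)%N -> c ^+ 2 * dyadic_step a b n <= e.
Proof.
move=> e0; have c2 : 0 < c ^+ 2 by rewrite exprn_gt0.
exists (Num.truncn (c ^+ 2 * (b - a) / e)).+1 => n Nn.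
rewrite /dyadic_step mulrA ler_pdivrMr ?exprn_gt0// [leRHS]mulrC -ler_pdivrMr//.
rewrite ltW// (lt_le_trans (truncnS_gt _))// -natrX ler_nat (leq_trans Nn)//.
exact/ltnW/ltn_expl.
Qed.

Lemma window_max_mean_le n : c ^+ 2 * dyadic_step a b n <= 1 ->
  (\int[P]_w (window_max c a b n w)%:E <= ((1 + c ^+ 2 * dyadic_step a b n) / 2)%:E)%E.
Proof.
move=> e1; under eq_integral => w _ do rewrite window_max_norm.
rewrite (@integral_window_max n (fun x => (`|x|)%:E))//.
- exact: (lindley_iter_mean_le mc (eta_gt0 n) e1 (mgf_normal n)).
- by apply/measurable_EFinP; exact: normr_measurable.
Qed.

Lemma window_max_expR_le n : c ^+ 2 * dyadic_step a b n <= 1 ->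
  (\int[P]_w (expR (window_max c a b n w))%:E <= 4%:E)%E.
Proof.
move=> e1; rewrite (@integral_window_max n (fun x => (expR x)%:E)).
- exact: (lindley_iter_expR_le mc (eta_gt0 n) e1 (mgf_normal n)).
- by move=> x; rewrite lee_fin expR_ge0.
- by apply/measurable_EFinP; exact: measurable_expR.
Qed.

(** The number of steps times [eta] is c^2 (b - a) on every grid, so refining the grid affects only
    the last error term. *)
Lemma window_max_mean_ge n (x : R) : c ^+ 2 * dyadic_step a b n <= 1 -> 0 < x ->
  ((1 / 2 - (4 / (c ^+ 2 * (b - a)) + x / 2 * (1 / (c ^+ 2 * (b - a)) + 1) +
    772 * (c ^+ 2 * dyadic_step a b n) / x ^+ 2))%:E <=
   \int[P]_w (window_max c a b n w)%:E)%E.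
Proof.
move=> e1 x0; under eq_integral => w _ do rewrite window_max_norm.
rewrite (@integral_window_max n (fun x => (`|x|)%:E))//; last first.
  by apply/measurable_EFinP; exact: normr_measurable.
have := lindley_iter_mean_ge mc (eta_gt0 n) e1 (mgf_normal n) x0.
move=> /(_ (2 ^ n)%N); rewrite expn_gt0 => /(_ erefl).
have -> // : (2 ^ n)%:R * (c ^+ 2 * dyadic_step a b n) = c ^+ 2 * (b - a).
by rewrite natrX /dyadic_step; field; rewrite expf_neq0.
Qed.

Let ae_cvg : {ae P, forall w, window_max c a b n w @[n --> \oo] --> window_sup c a b w}.
Proof.
by have := wiener_continuous hW; apply: filterS => w; exact: cvg_window_max.
Qed.

Let ae_cvg_expR (k : R) : {ae P, forall w, expR (k * window_max c a b n w) @[n --> \oo] -->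
  expR (k * window_sup c a b w)}.
Proof.
move: ae_cvg; apply: filterS => w h.
by apply: continuous_cvg; [exact: continuous_expR|exact: cvgMr].
Qed.

Lemma window_sup_mean_cvg :
  ((\int[P]_w (window_max c a b n w)%:E) @[n --> \oo] --> \int[P]_w (window_sup c a b w)%:E)%E.
Proof.
apply: cvg_integral_ae_nondecreasing => //.
- exact: measurable_window_max.
- exact: measurable_window_sup.
- exact: window_max_ge0.
- exact: window_sup_ge0.
- exact: window_max_nd.
Qed.

Lemma window_sup_mean_le : (\int[P]_w (window_sup c a b w)%:E <= (1 / 2)%:E)%E.
Proof.
apply/lee_addgt0Pr => e e0.
have e1 : 0 < Num.min 1 (2 * e) by rewrite lt_min ltr01 mulr_gt0.
have [N hN] := dyadic_eta_small e1.
apply: (cvge_le _ window_sup_mean_cvg).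
exists N => // n /= Nn; have := hN n Nn; rewrite le_min => /andP[h1 h2].
rewrite (le_trans (window_max_mean_le h1))// -EFinD lee_fin; lra.
Qed.

(** The truncation level x is fixed first, making its term equal to e / 2; then the grid is refined
    until the term with eta / x^2 is at most e / 2. What remains is the finite length of the
    window. *)
Lemma window_sup_mean_ge :
  ((1 / 2 - 4 / (c ^+ 2 * (b - a)))%:E <= \int[P]_w (window_sup c a b w)%:E)%E.
Proof.
apply/lee_addgt0Pr => e e0.
set L := c ^+ 2 * (b - a).
have L0 : 0 < L by rewrite mulr_gt0 ?exprn_gt0// subr_gt0.
pose x := e / (1 / L + 1).
have L1 : 0 < 1 / L + 1 by rewrite addr_gt0// divr_gt0.
have x0 : 0 < x by rewrite divr_gt0.
have e1 : 0 < Num.min 1 (e * x ^+ 2 / 1544).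
  rewrite lt_min ltr01; apply: divr_gt0; last by rewrite ltr0n.
  by rewrite mulr_gt0// exprn_gt0.
have [N hN] := dyadic_eta_small e1.
rewrite -leeBlDr//.
apply: (cvge_ge _ window_sup_mean_cvg).
exists N => // n /= Nn; have := hN n Nn; rewrite le_min => /andP[h1 h2].
apply: le_trans (window_max_mean_ge h1 x0); rewrite -EFinB lee_fin -/L.
have -> : x / 2 * (1 / L + 1) = e / 2.
  by rewrite mulrAC /x divfK// gt_eqF.
have k : 772 * (c ^+ 2 * dyadic_step a b n) / x ^+ 2 <= e / 2.
  have x2 : 0 < x ^+ 2 by rewrite exprn_gt0.
  have q0 : 0 < 1544 :> R by rewrite ltr0n.
  rewrite (ler_pdivrMr _ _ x2); move: h2; rewrite (ler_pdivlMr _ _ q0); lra.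
lra.
Qed.

Lemma window_sup_expR_le : (\int[P]_w (expR (window_sup c a b w))%:E <= 4%:E)%E.
Proof.
have [N hN] := dyadic_eta_small ltr01.
have : ((\int[P]_w (expR (1 * window_max c a b n w))%:E) @[n --> \oo] -->
    \int[P]_w (expR (1 * window_sup c a b w))%:E)%E.
  apply: cvg_integral_ae_nondecreasing => //.
  - move=> n; apply: measurableT_comp => //; apply: measurable_funM => //.
    exact: measurable_window_max.
  - apply: measurableT_comp => //; apply: measurable_funM => //.
    exact: measurable_window_sup.
  - by move=> w m n mn; rewrite ler_expR !mul1r; exact: window_max_nd.
under eq_integral => w _ do rewrite mul1r.
move=> h; apply: (cvge_le _ h).
exists N => // n /= Nn; under eq_integral => w _ do rewrite mul1r.
exact: window_max_expR_le (hN n Nn).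
Qed.

End one_window.

Section two_windows.
Context (c a b c' a' b' : R).
Hypothesis c0 : 0 < c.
Hypothesis a0 : 0 <= a.
Hypothesis ab : a < b.
Hypothesis c0' : 0 < c'.
Hypothesis ab' : a' < b'.
Hypothesis ba' : b <= a'.

Let step_ge0 n : 0 <= dyadic_step a b n.
Proof. by rewrite divr_ge0 ?subr_ge0 ?exprn_ge0// ltW. Qed.
Let step_ge0' n : 0 <= dyadic_step a' b' n.
Proof. by rewrite divr_ge0 ?subr_ge0 ?exprn_ge0// ltW. Qed.

(** A single increasing sequence of times runs through both grids; its increment number N, from b to
    a', is left out of the list. The first half of the list is folded and turned into an event, then
    the second half is folded. *)
Lemma window_max_indep n A B : measurable A -> measurable B ->
  (P (window_max c a b n @^-1` A `&` window_max c' a' b' n @^-1` B) =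
   P (window_max c a b n @^-1` A) * P (window_max c' a' b' n @^-1` B))%E.
Proof.
move=> mA mB.
pose N := (2 ^ n)%N.
pose t i := if (i <= N)%N then dyadic_grid a b n i else dyadic_grid a' b' n (i - N.+1).
pose X i w := W (t i.+1) w - W (t i) w.
have gN : dyadic_grid a b n N = b.
  by rewrite /dyadic_grid /dyadic_step /N natrX; field; rewrite expf_neq0.
have iX : mutually_independent P (fun i : 'I_(N + N.+1) => X i).
  apply: (wiener_increments_independent hW).
    by rewrite /t /dyadic_grid /= mul0r addr0.
  move=> i j ij; rewrite /t; case: leqP => iN; case: leqP => jN.
  - by rewrite /dyadic_grid lerD2l ler_wpM2r ?ler_nat.
  - apply: (@le_trans _ _ b).
      by have /andP[] := dyadic_grid_itv (ltW ab) iN.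
    by rewrite (le_trans ba')// /dyadic_grid lerDl mulr_ge0.
  - by move: (leq_trans iN ij); rewrite ltnNge jN.
  - by rewrite /dyadic_grid lerD2l ler_wpM2r ?ler_nat// leq_sub2r.
pose l := rev (iota 0 N) ++ rev (iota N.+1 N).
have il : indep_with P setT (map X l).
  apply: (indep_with_map iX).
    rewrite cat_uniq !rev_uniq !iota_uniq/= andbT; apply/hasPn => i.
    by rewrite !mem_rev !mem_iota add0n -leqNgt => /andP[/ltnW].
  rewrite all_cat !all_rev; apply/andP; split; apply/allP => i; rewrite mem_iota /=.
    by rewrite add0n => h; rewrite ltn_addr.
  by rewrite addSnnS => /andP[_].
have E1 : map X (rev (iota 0 N)) = window_list a b n.
  apply/eq_in_map => i; rewrite mem_rev mem_iota /= add0n => iN.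
  by apply/funext => w; rewrite /X /t iN ltnW.
have E2 : map X (rev (iota N.+1 N)) = window_list a' b' n.
  rewrite -[N.+1]addn0 iotaDl /window_list !map_rev -map_comp; congr rev.
  apply/eq_map => i; apply/funext => w; rewrite /X /t /=.
  have -> : (N.+1 + i <= N)%N = false by apply/negbTE; rewrite -ltnNge ltnS leq_addr.
  have -> : (N.+1 + i < N)%N = false.
    by apply/negbTE; rewrite -leqNgt addSn leqW// leq_addr.
  by rewrite -addnS !addKn.
rewrite /l map_cat E1 E2 in il.
have m1 : rv_all_measurable (window_list a b n).
  by apply: rv_all_measurable_map => j; exact: measurable_window_incr.
have m2 : rv_all_measurable (window_list a' b' n).
  by apply: rv_all_measurable_map => j; exact: measurable_window_incr.
have m12 : rv_all_measurable (window_list a b n ++ window_list a' b' n).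
  by rewrite -E1 -E2 -map_cat; apply: rv_all_measurable_map => j; exact: measurable_funB.
have := @indep_with_lindley _ _ _ P c (c ^+ 2 * dyadic_step a b n) setT (cst 0)
  _ _ measurableT (@measurable_cst _ _ _ _ _ _) m12 (indep_with_cst 0 il).
rewrite -window_maxE => i1.
have mM := measurable_window_max c a b n.
have mE : measurable (window_max c a b n @^-1` A).
  by rewrite -(setTI (_ @^-1` _)); exact: mM.
have i2 := indep_with_event mM mA i1.
have m2' : rv_all_measurable (window_list a' b' n ++ [::]) by rewrite cats0.
have := @indep_with_lindley _ _ _ P c' (c' ^+ 2 * dyadic_step a' b' n) _ (cst 0)
  (window_list a' b' n) [::] mE (@measurable_cst _ _ _ _ _ _) m2'.
rewrite cats0 => /(_ (indep_with_cst 0 i2)).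
rewrite -window_maxE => /(_ (fun=> B) (fun=> mB))[_ /=].
by rewrite setIT mule1.
Qed.

(** Monotonicity and continuity of f make the grid means converge to the right limits, for the
    factors and for the product; finiteness of the two means excludes 0 times infinity. *)
Lemma window_sup_expectationM (f : R -> R) : (forall x, 0 <= f x) ->
  {homo f : x y / x <= y} -> continuous f -> measurable_fun [set: R] f ->
  (\int[P]_w (f (window_sup c a b w))%:E \is a fin_num)%E ->
  (\int[P]_w (f (window_sup c' a' b' w))%:E \is a fin_num)%E ->
  (\int[P]_w (f (window_sup c a b w) * f (window_sup c' a' b' w))%:E =
   (\int[P]_w (f (window_sup c a b w))%:E) * \int[P]_w (f (window_sup c' a' b' w))%:E)%E.
Proof.
move=> f0 ndf cf mf fin1 fin2.
have a0' : 0 <= a' by rewrite (le_trans _ ba')// (le_trans a0)// ltW.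
have mcomp (X : Omega -> R) : measurable_fun setT X -> measurable_fun setT (f \o X).
  by move=> mX; exact: measurableT_comp.
have cvg1 : ((\int[P]_w (f (window_max c a b n w))%:E) @[n --> \oo] -->
    \int[P]_w (f (window_sup c a b w))%:E)%E.
  apply: cvg_integral_ae_nondecreasing => //.
  - by move=> n; apply: mcomp; exact: measurable_window_max.
  - by apply: mcomp; exact: measurable_window_sup.
  - by move=> w m n mn; apply: ndf; exact: window_max_nd.
  - have := wiener_continuous hW; apply: filterS => w cw.
    by apply: continuous_cvg; [exact: cf|exact: cvg_window_max].
have cvg2 : ((\int[P]_w (f (window_max c' a' b' n w))%:E) @[n --> \oo] -->
    \int[P]_w (f (window_sup c' a' b' w))%:E)%E.
  apply: cvg_integral_ae_nondecreasing => //.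
  - by move=> n; apply: mcomp; exact: measurable_window_max.
  - by apply: mcomp; exact: measurable_window_sup.
  - by move=> w m n mn; apply: ndf; exact: window_max_nd.
  - have := wiener_continuous hW; apply: filterS => w cw.
    by apply: continuous_cvg; [exact: cf|exact: cvg_window_max].
have cvg12 : ((\int[P]_w (f (window_max c a b n w) * f (window_max c' a' b' n w))%:E) @[n --> \oo] -->
    \int[P]_w (f (window_sup c a b w) * f (window_sup c' a' b' w))%:E)%E.
  apply: cvg_integral_ae_nondecreasing => //.
  - move=> n; apply: measurable_funM; apply: mcomp; exact: measurable_window_max.
  - apply: measurable_funM; apply: mcomp; exact: measurable_window_sup.
  - by move=> n w; exact: mulr_ge0.
  - by move=> w; exact: mulr_ge0.
  - by move=> w m n mn; apply: ler_pM => //; apply: ndf; exact: window_max_nd.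
  - have := wiener_continuous hW; apply: filterS => w cw.
    by apply: cvgM; (apply: continuous_cvg; [exact: cf|exact: cvg_window_max]).
have E n : (\int[P]_w (f (window_max c a b n w) * f (window_max c' a' b' n w))%:E =
  (\int[P]_w (f (window_max c a b n w))%:E) * \int[P]_w (f (window_max c' a' b' n w))%:E)%E.
  apply: (@ge0_expectationM_indep _ _ _ P _ _ (EFin \o f) (EFin \o f)).
  - exact: measurable_window_max.
  - exact: measurable_window_max.
  - by move=> A B mA mB; exact: window_max_indep.
  - exact/measurable_EFinP.
  - exact/measurable_EFinP.
  - by move=> x; rewrite lee_fin.
  - by move=> x; rewrite lee_fin.
move: cvg12; under eq_fun do rewrite E.
move=> h; apply: (cvg_unique _ h) => //.
by apply: cvgeM => //; rewrite mule_def_fin.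
Qed.

End two_windows.
End wiener_window.

(** * A weighted law of large numbers *)

Section ae_series.
Context {R : realType} d (T : measurableType d) (P : probability T R).

(** The whole series has finite mean, hence is finite almost surely. Together with the next lemma
    this does the work of Borel-Cantelli. *)
Lemma ae_geometric_series_bounded (f : nat -> T -> R) (K r : R) :
  0 <= K -> 0 <= r < 1 -> (forall k, measurable_fun setT (f k)) ->
  (forall k w, 0 <= f k w) ->
  (forall k, (\int[P]_w (f k w)%:E <= (K * r ^+ k)%:E)%E) ->
  {ae P, forall w, exists M, forall n, \sum_(0 <= k < n) f k w <= M}.
Proof.
move=> K0 /andP[r0 r1] mf f0 fK.
pose F w := (\sum_(k <oo) (f k w)%:E)%E.
have mF : measurable_fun setT F.
  by apply: ge0_emeasurable_sum => [k w _ _|k _]; [rewrite lee_fin|exact/measurable_EFinP].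
have intF : P.-integrable setT F.
  apply/integrableP; split=> //.
  have F0 w : (0 <= F w)%E by apply: nneseries_ge0 => k _ _; rewrite lee_fin.
  under eq_integral => w _ do rewrite gee0_abs//.
  rewrite integral_nneseries//; last 2 first.
    by move=> k; exact/measurable_EFinP.
    by move=> k w _; rewrite lee_fin.
  apply: (@le_lt_trans _ _ (K * (1 - r)^-1)%:E); last exact: ltry.
  apply: lime_le.
    by apply: is_cvg_nneseries => k _ _; apply: integral_ge0 => w _; rewrite lee_fin.
  apply: nearW => n.
  apply: (@le_trans _ _ (\sum_(0 <= k < n) (K * r ^+ k)%:E)%E).
    by apply: lee_sum => k _; exact: fK.
  rewrite sumEFin lee_fin -mulr_sumr ler_wpM2l//.
  have := geometric_seriesE 1 (negbT (lt_eqF r1)) => /(congr1 (fun h => h n)).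
  rewrite /series/= mul1r => h.
  rewrite (eq_bigr (fun k => 1 * r ^+ k)) ?h; last by move=> k _; rewrite mul1r.
  by rewrite ler_pdivrMr ?subr_gt0// mulVf ?gt_eqF ?subr_gt0// gerBl exprn_ge0.
have := integrable_ae measurableT intF.
apply: filterS => w /(_ Logic.I) Ffin; exists (fine (F w)) => n.
rewrite -lee_fin fineK// -sumEFin.
by apply: nneseries_lim_ge => k _ _; rewrite lee_fin.
Qed.

Lemma bounded_series_small (u : nat -> R) (M : R) : (forall k, 0 <= u k) ->
  (forall n, \sum_(0 <= k < n) u k <= M) ->
  forall e, 0 < e -> exists N, forall k, (N <= k)%N -> u k <= e.
Proof.
move=> u0 hM e e0.
have cu : cvgn (series u).
  apply: nondecreasing_is_cvgn; last by exists M => _ [n _ <-]; exact: hM.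
  by apply/nondecreasing_seqP => n; rewrite /series/= big_nat_recr//= lerDl.
have /cvgrPdist_le/(_ e e0)[N _ hN] := @cvg_series_cvg_0 _ R u cu.
exists N => k Nk; have := hN k Nk; rewrite /= sub0r normrN.
exact/le_trans/ler_norm.
Qed.

End ae_series.

Section slln.
Context {R : realType} d (T : measurableType d) (P : probability T R).
Context (xi : nat -> T -> R) (C : R) (p : nat) (a b : nat -> R) (n0 : nat) (g D : R).
Hypothesis mxi : forall i, measurable_fun setT (xi i).
Hypothesis xi0 : forall i w, 0 <= xi i w.
Hypothesis xi2 : forall i, (\int[P]_w (xi i w ^+ 2)%:E <= C%:E)%E.
Hypothesis xi_uncor : forall i j, (i + p <= j)%N ->
  (\int[P]_w (xi i w * xi j w)%:E = (\int[P]_w (xi i w)%:E) * \int[P]_w (xi j w)%:E)%E.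
Hypothesis a0 : forall i, 0 <= a i.
Hypothesis ab : forall i, a i <= b i.

Definition wsum (c : nat -> R) (n : nat) : R := \sum_(i < n) c i.
Notation B := (wsum b).

Hypothesis g0 : 0 < g.
Hypothesis D0 : 0 <= D.
Hypothesis bD : forall n i, (n0 <= n)%N -> (i < n)%N -> b i * B n `^ g <= D * B n.
Hypothesis Boo : forall M : R, exists N, forall n, (N <= n)%N -> M <= B n.

Let m i := \int[P]_w xi i w.
Let S n w := \sum_(i < n) a i * xi i w.
Let ES n := \sum_(i < n) a i * m i.

Let b0 i : 0 <= b i. Proof. exact: le_trans (a0 i) (ab i). Qed.

Let ixi2 i : P.-integrable setT (EFin \o (fun w => xi i w ^+ 2)).
Proof.
apply/integrableP; split; first by apply/measurable_EFinP; exact: measurable_funX.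
rewrite (eq_integral (fun w => (xi i w ^+ 2)%:E)).
  by rewrite (le_lt_trans (xi2 i))// ltry.
by move=> w _ /=; rewrite ger0_norm ?sqr_ge0.
Qed.

Let icst (c : R) : P.-integrable setT (EFin \o (fun _ : T => c)).
Proof. exact: finite_measure_integrable_cst. Qed.

Let ixiM i j : P.-integrable setT (EFin \o (fun w => xi i w * xi j w)).
Proof.
have h : P.-integrable setT (EFin \o (fun w => xi i w ^+ 2 + xi j w ^+ 2)).
  exact: (integrableD measurableT (ixi2 i) (ixi2 j)).
apply: (le_integrable measurableT _ _ h).
  by apply/measurable_EFinP; exact: measurable_funM.
move=> w _ /=; rewrite lee_fin !ger0_norm ?addr_ge0 ?mulr_ge0 ?sqr_ge0//.
have := sqr_ge0 (xi i w - xi j w); have := mulr_ge0 (xi0 i w) (xi0 j w).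
rewrite !expr2; lra.
Qed.

Let ixi i : P.-integrable setT (EFin \o xi i).
Proof.
have h : P.-integrable setT (EFin \o (fun w => xi i w ^+ 2 + 1)).
  exact: (integrableD measurableT (ixi2 i) (icst 1)).
apply: (le_integrable measurableT _ _ h); first exact/measurable_EFinP.
move=> w _ /=; rewrite lee_fin !ger0_norm ?addr_ge0 ?sqr_ge0//.
have := sqr_ge0 (xi i w - 1); have := xi0 i w; rewrite !expr2; lra.
Qed.

Let m0 i : 0 <= m i. Proof. exact: Rintegral_ge0. Qed.

Let xi2R i : \int[P]_w (xi i w ^+ 2) <= C.
Proof.
have := xi2 i; rewrite (@integral_EFin_Rintegral _ _ _ P setT (fun w => xi i w ^+ 2))//.
Qed.

Let C0 : 0 <= C.
Proof.
by apply: le_trans (xi2R 0); apply: Rintegral_ge0 => w _; exact: sqr_ge0.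
Qed.

Let mC i : m i <= 1 + C.
Proof.
apply: (@le_trans _ _ (\int[P]_w (1 + xi i w ^+ 2))).
  apply: le_Rintegral => //; first exact: (integrableD measurableT (icst 1) (ixi2 i)).
  move=> w _; have := sqr_ge0 (xi i w - 1); have := xi0 i w; rewrite !expr2; lra.
rewrite RintegralD// Rintegral_probability_cst lerD2l; exact: xi2R.
Qed.

Let cov i j := \int[P]_w ((xi i w - m i) * (xi j w - m j)).

Let icov i j : P.-integrable setT (EFin \o (fun w => (xi i w - m i) * (xi j w - m j))).
Proof.
have h1 : P.-integrable setT (EFin \o (fun w => m i * xi j w)).
  exact: (integrableZl measurableT (m i) (ixi j)).
have h2 : P.-integrable setT (EFin \o (fun w => m j * xi i w)).
  exact: (integrableZl measurableT (m j) (ixi i)).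
have := integrableD measurableT (integrableB measurableT (integrableB measurableT (ixiM i j) h1) h2) (icst (m i * m j)).
apply: eq_integrable => // w _ /=; rewrite -EFinD; congr EFin; ring.
Qed.

Let covE i j : cov i j = \int[P]_w (xi i w * xi j w) - m i * m j.
Proof.
have h1 : P.-integrable setT (EFin \o (fun w => m i * xi j w)).
  exact: (integrableZl measurableT (m i) (ixi j)).
have h2 : P.-integrable setT (EFin \o (fun w => m j * xi i w)).
  exact: (integrableZl measurableT (m j) (ixi i)).
transitivity (\int[P]_w (xi i w * xi j w - m i * xi j w - m j * xi i w + m i * m j)).
  by apply: eq_Rintegral => w _; ring.
rewrite RintegralD//; last first.
  exact: (integrableB measurableT (integrableB measurableT (ixiM i j) h1) h2).
rewrite RintegralB//; last exact: (integrableB measurableT (ixiM i j) h1).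
rewrite RintegralB// !RintegralZl// Rintegral_probability_cst -/(m i) -/(m j).
ring.
Qed.

Let cov_le i j : cov i j <= C.
Proof.
rewrite covE; have mm : 0 <= m i * m j by exact: mulr_ge0.
have : \int[P]_w (xi i w * xi j w) <= C; last lra.
apply: (@le_trans _ _ (\int[P]_w (2^-1 * (xi i w ^+ 2 + xi j w ^+ 2)))).
  apply: le_Rintegral => //.
    exact: (integrableZl measurableT 2^-1 (integrableD measurableT (ixi2 i) (ixi2 j))).
  move=> w _; have := sqr_ge0 (xi i w - xi j w); rewrite !expr2; lra.
rewrite RintegralZl//; last exact: (integrableD measurableT (ixi2 i) (ixi2 j)).
rewrite RintegralD//; have := xi2R i; have := xi2R j; lra.
Qed.

Let cov0 i j : (i + p <= j)%N -> cov i j = 0.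
Proof.
move=> ij; rewrite covE; have := xi_uncor ij.
rewrite (@integral_EFin_Rintegral _ _ _ P setT (fun w => xi i w * xi j w))//.
rewrite !integral_EFin_Rintegral// -EFinM => -[->].
by rewrite subrr.
Qed.

Let covC i j : cov i j = cov j i.
Proof. by apply: eq_Rintegral => w _; rewrite mulrC. Qed.

Lemma Rintegral_sum (I : Type) (s : seq I) (f : I -> T -> R) :
  (forall i, P.-integrable setT (EFin \o f i)) ->
  P.-integrable setT (EFin \o (fun w => \sum_(i <- s) f i w)) /\
  \int[P]_w (\sum_(i <- s) f i w) = \sum_(i <- s) \int[P]_w f i w.
Proof.
move=> fi; elim: s => [|i s [IH1 IH2]].
  rewrite big_nil; under eq_Rintegral do rewrite big_nil.
  rewrite Rintegral_probability_cst; split => //.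
  by apply: eq_integrable (icst 0) => // w _ /=; rewrite big_nil.
split.
  apply: eq_integrable (integrableD measurableT (fi i) IH1) => // w _ /=.
  by rewrite big_cons.
under eq_Rintegral do rewrite big_cons.
by rewrite RintegralD// big_cons IH2.
Qed.

Let near_count n i : (\sum_(j < n | (i < j + p) && (j < i + p)) 1 <= 2 * p)%N.
Proof.
rewrite sum1dep_card cardE -(size_map val).
rewrite -[X in (_ <= X)%N](size_iota (i.+1 - p)).
apply: uniq_leq_size; first by rewrite (map_inj_uniq val_inj) enum_uniq.
move=> k /mapP[j]; rewrite mem_enum inE => /andP[h1 h2] ->.
rewrite mem_iota; apply/andP; split => /=; lia.
Qed.

Let var_le n : (n0 <= n)%N -> 0 < B n ->
  P.-integrable setT (EFin \o (fun w => (S n w - ES n) ^+ 2)) /\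
  \int[P]_w ((S n w - ES n) ^+ 2) * B n `^ g <= 2 * p%:R * C * D * B n ^+ 2.
Proof.
move=> nn0 Bn0.
have SE w : (S n w - ES n) ^+ 2 =
    \sum_(i < n) \sum_(j < n) a i * a j * ((xi i w - m i) * (xi j w - m j)).
  rewrite /S /ES -sumrB expr2 mulr_suml; apply: eq_bigr => i _.
  rewrite mulr_sumr; apply: eq_bigr => j _; ring.
have h1 i j : P.-integrable setT (EFin \o (fun w => a i * a j * ((xi i w - m i) * (xi j w - m j)))).
  exact: (integrableZl measurableT (a i * a j) (icov i j)).
have h2 i := Rintegral_sum (index_enum 'I_n) (fun j : 'I_n => h1 i j).
have [h3 h4] := Rintegral_sum (index_enum 'I_n) (fun i : 'I_n => (h2 i).1).
have -> : (fun w => (S n w - ES n) ^+ 2) =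
    (fun w => \sum_(i < n) \sum_(j < n) a i * a j * ((xi i w - m i) * (xi j w - m j))).
  by apply/funext => w; exact: SE.
split=> //; rewrite h4.
pose Mx := D * B n / B n `^ g.
have Bg : 0 < B n `^ g by rewrite powR_gt0.
have bM i : (i < n)%N -> b i <= Mx by move=> iN; rewrite ler_pdivlMr// bD.
have M0 : 0 <= Mx by rewrite divr_ge0 ?mulr_ge0// ltW.
apply: (@le_trans _ _ ((\sum_(i < n) b i * (2 * p%:R * (C * Mx))) * B n `^ g)); last first.
  rewrite -mulr_suml -/(B n) /Mx.
  rewrite [leLHS](_ : _ = 2 * p%:R * C * D * B n ^+ 2)//.
  by field; rewrite gt_eqF.
rewrite ler_pM2r//; apply: ler_sum => i _; rewrite (h2 i).2.
rewrite (bigID (fun j : 'I_n => (i < j + p)%N && (j < i + p)%N))/=.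
rewrite [X in _ + X]big1 ?addr0; last first.
  move=> j; rewrite negb_and -!leqNgt => h.
  rewrite RintegralZl// -/(cov i j).
  by case/orP: h => h; [rewrite covC|]; rewrite cov0 ?mulr0.
apply: (@le_trans _ _ (\sum_(j < n | (i < j + p)%N && (j < i + p)%N) b i * (C * Mx))).
  apply: ler_sum => j _; rewrite RintegralZl// -/(cov i j) -mulrA.
  have aj : a j <= Mx by rewrite (le_trans (ab j))// bM.
  apply: (@le_trans _ _ (a i * (a j * C))).
    by rewrite ler_wpM2l// ler_wpM2l.
  apply: ler_pM => //; first by rewrite mulr_ge0.
  by rewrite mulrC ler_wpM2l.
rewrite (eq_bigl (mem [pred j : 'I_n | (i < j + p)%N && (j < i + p)%N]))//.
rewrite sumr_const -[_ *+ #|_|]mulr_natl.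
have cn : (#|[pred j : 'I_n | (i < j + p)%N && (j < i + p)%N]| <= 2 * p)%N.
  by have := near_count n i; rewrite sum1_card.
rewrite mulrCA ler_wpM2l//; apply: ler_wpM2r; first exact: mulr_ge0.
by rewrite -natrM ler_nat.
Qed.

(** Where B >= rho^k, the relative variances are dominated by a geometric sequence of ratio
    rho^-g. *)
Let ae_sub (rho : R) (z : nat -> nat) : 1 < rho ->
  (forall k, (n0 <= z k)%N) -> (forall k, rho ^+ k <= B (z k)) ->
  {ae P, forall w, forall e, 0 < e -> exists N, forall k, (N <= k)%N ->
    `|S (z k) w - ES (z k)| <= e * B (z k)}.
Proof.
move=> rho1 zn zB.
have rho0 : 0 < rho by rewrite (lt_trans _ rho1).
have Bz k : 0 < B (z k) by rewrite (lt_le_trans _ (zB k))// exprn_gt0.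
pose f k w := ((S (z k) w - ES (z k)) / B (z k)) ^+ 2.
pose r := (rho `^ g)^-1.
have rg : 1 < rho `^ g.
  have := @gt0_ltr_powR R g g0 1 rho.
  by rewrite !nnegrE ler01 (ltW rho0) powR1; apply.
have r01 : 0 <= r < 1 by rewrite invr_ge0 powR_ge0 invf_lt1// (lt_trans ltr01).
pose K := 2 * p%:R * C * D.
have K0 : 0 <= K by rewrite !mulr_ge0.
have mS n : measurable_fun setT (S n).
  by apply: measurable_sum => i; exact: measurable_funM.
have mf k : measurable_fun setT (f k).
  apply: measurable_funX; apply: measurable_funM => //; exact: measurable_funB.
have fK k : (\int[P]_w (f k w)%:E <= (K * r ^+ k)%:E)%E.
  have [iv vl] := var_le (zn k) (Bz k).
  have iv' : P.-integrable setT (EFin \o (fun w => (B (z k))^-1 ^+ 2 * (S (z k) w - ES (z k)) ^+ 2)).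
    exact: (integrableZl measurableT _ iv).
  rewrite (_ : (\int[P]_w _)%E = (\int[P]_w ((B (z k))^-1 ^+ 2 * (S (z k) w - ES (z k)) ^+ 2)%:E)%E); last first.
    by apply: eq_integral => w _; rewrite /f exprMn mulrC.
  rewrite (@integral_EFin_Rintegral _ _ _ P setT (fun w => (B (z k))^-1 ^+ 2 * (S (z k) w - ES (z k)) ^+ 2))//.
  rewrite lee_fin RintegralZl//.
  have Bg : 0 < B (z k) `^ g by rewrite powR_gt0.
  have hr : (B (z k) `^ g)^-1 <= r ^+ k.
    rewrite /r exprVn lef_pV2 ?posrE ?exprn_gt0 ?powR_gt0//.
    rewrite -powR_mulrn ?powR_ge0// -powRrM mulrC powRrM powR_mulrn ?(ltW rho0)//.
    by apply: ge0_ler_powR; rewrite ?nnegrE ?exprn_ge0 ?(ltW g0) ?(ltW rho0) ?(ltW (Bz k)).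
  apply: (@le_trans _ _ (K * (B (z k) `^ g)^-1)); last by rewrite ler_wpM2l.
  rewrite ler_pdivlMr// -mulrA exprVn mulrC ler_pdivrMr ?exprn_gt0//.
have := ae_geometric_series_bounded K0 r01 mf (fun k w => sqr_ge0 _) fK.
apply: filterS => w [M hM] e e0.
have e2 : 0 < e ^+ 2 by rewrite exprn_gt0.
have [N hN] := bounded_series_small (fun k => sqr_ge0 _) hM e2.
exists N => k Nk; have := hN k Nk.
rewrite /f -[X in X <= _](real_normK (num_real _)) ler_sqr ?nnegrE ?(ltW e0)//.
by rewrite normrM normfV (gtr0_norm (Bz k)) ler_pdivrMr.
Qed.

Let B_nd i j : (i <= j)%N -> B i <= B j.
Proof.
move=> ij; rewrite /B !/wsum -!(big_mkord xpredT b) (big_cat_nat (n := i) (p := j))//=.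
by rewrite lerDl sumr_ge0.
Qed.

Let S_nd i j w : (i <= j)%N -> S i w <= S j w.
Proof.
move=> ij; rewrite /S -!(big_mkord xpredT (fun i => a i * xi i w)).
rewrite (big_cat_nat (n := i) (p := j))//=.
by rewrite lerDl sumr_ge0// => k _; rewrite mulr_ge0.
Qed.

Let ES_diff i j : (i <= j)%N -> 0 <= ES j - ES i <= (1 + C) * (B j - B i).
Proof.
move=> ij.
have dif (c : nat -> R) : \sum_(k < j) c k - \sum_(k < i) c k = \sum_(i <= k < j) c k.
  rewrite -!(big_mkord xpredT c) (big_cat_nat (n := i) (p := j))//=.
  by rewrite addrAC subrr add0r.
rewrite /ES /wsum dif (dif (fun k => a k * m k)).
rewrite sumr_ge0/=; last by move=> k _; rewrite mulr_ge0.
rewrite mulr_sumr; apply: ler_sum => k _; rewrite mulrC.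
by apply: ler_pM.
Qed.

(* Chebyshev and Borel-Cantelli along B_n ~ rho^k for rho = 1 + 1/(l+1); in
   between, S is monotone in n since xi >= 0. *)
Theorem weighted_slln : {ae P, forall w, forall e, 0 < e ->
  exists N, forall n, (N <= n)%N -> `|S n w - ES n| <= e * B n}.
Proof.
pose rho (l : nat) : R := 1 + l.+1%:R^-1.
have rho1 l : 1 < rho l by rewrite ltrDl invr_gt0 ltr0n.
have exu l k : exists n, (n0 <= n)%N && (rho l ^+ k <= B n).
  have [N hN] := Boo (rho l ^+ k).
  by exists (maxn n0 N); rewrite leq_maxl hN// leq_maxr.
pose u l k := ex_minn (exu l k).
have uP l k : (n0 <= u l k)%N /\ rho l ^+ k <= B (u l k).
  by rewrite /u; case: ex_minnP => n /andP[].
have umin l k n : (n0 <= n)%N -> rho l ^+ k <= B n -> (u l k <= n)%N.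
  by rewrite /u; case: ex_minnP => j _ h n1 n2; apply: h; rewrite n1 n2.
(* The last index before B reaches rho^(k+1), if admissible. It serves as the upper end of the
   sandwich in place of [u l k.+1], because B may jump past rho^(k+1) at the latter. *)
pose v l k := if (n0 <= (u l k.+1).-1)%N && (rho l ^+ k <= B (u l k.+1).-1) then (u l k.+1).-1 else u l k.
have vP l k : (n0 <= v l k)%N /\ rho l ^+ k <= B (v l k).
  by rewrite /v; case: ifPn => [/andP[]|_] //; exact: uP.
have aeu : {ae P, forall w, forall l, forall e, 0 < e -> exists N, forall k, (N <= k)%N ->
    `|S (u l k) w - ES (u l k)| <= e * B (u l k)}.
  by apply/ae_foralln => l; apply: (ae_sub (rho1 l)) => k; have [] := uP l k.
have aev : {ae P, forall w, forall l, forall e, 0 < e -> exists N, forall k, (N <= k)%N ->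
    `|S (v l k) w - ES (v l k)| <= e * B (v l k)}.
  by apply/ae_foralln => l; apply: (ae_sub (rho1 l)) => k; have [] := vP l k.
apply: filterS2 aeu aev => w hu hv e e0.
have C_0 := C0.
(* Each xi has mean at most 1 + C, so between the two ends of the sandwich the mean grows by at most
   (1 + C) (rho - 1) rho^k; this l makes that at most half of e B n. *)
pose l := Num.truncn (2 * (1 + C) / e).
have l1 : 0 < l.+1%:R :> R by rewrite ltr0n.
have hl : (1 + C) * (rho l - 1) <= e / 2.
  have := truncnS_gt (2 * (1 + C) / e); rewrite -/l ltr_pdivrMr// => hl.
  rewrite /rho addrAC subrr add0r ler_pdivrMr//; lra.
have e4 : 0 < e / 4 by rewrite divr_gt0.
have [N1 hN1] := hu l _ e4.
have [N2 hN2] := hv l _ e4.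
pose N3 := maxn N1 N2.
have rl0 : 0 < rho l by rewrite (lt_trans _ (rho1 l)).
have rl2 : rho l <= 2 by rewrite /rho lerD2l invf_le1// ler1n.
have [N4 hN4] := Boo (rho l ^+ N3).
exists (maxn n0 N4) => n; rewrite geq_max => /andP[nn0 nN4].
have exk : exists k, (rho l ^+ k.+1 > B n).
  have [Q hQ] : exists Q : nat, B n < rho l ^+ Q.
    have B0 : 0 <= B n by rewrite /wsum sumr_ge0.
    have gen Q : Q%:R / l.+1%:R <= rho l ^+ Q.
      elim: Q => [|Q IH]; first by rewrite mul0r exprn_ge0// ltW.
      have q1 : 1 <= rho l ^+ Q by apply: exprn_ege1; exact/ltW.
      rewrite -(natr1 Q) mulrDl mul1r exprS /rho [leRHS]mulrDl mul1r lerD//.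
      by rewrite ler_peMr// invr_ge0 ltW.
    exists (Num.truncn (B n * l.+1%:R)).+1.
    by rewrite (lt_le_trans _ (gen _))// ltr_pdivlMr// truncnS_gt.
  exists Q; rewrite (lt_le_trans hQ)// exprS ler_peMl ?exprn_ge0 ?(ltW rl0)// ltW//.
case: (ex_minnP exk) => k hk kmin.
have kN3 : (N3 <= k)%N.
  rewrite leqNgt; apply/negP => kN.
  have : rho l ^+ k.+1 <= rho l ^+ N3 by rewrite ler_weXn2l// ltW.
  have := hN4 _ nN4; lra.
have hk' : rho l ^+ k <= B n.
  case: k hk kmin kN3 => [|k] hk kmin kN3; last first.
    by rewrite leNgt; apply/negP => /kmin; rewrite ltnn.
  have : N3 = 0%N by apply/eqP; rewrite -leqn0.
  by move=> E; have := hN4 _ nN4; rewrite E.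
have un : (u l k <= n)%N by exact: umin.
have nu : (n < u l k.+1)%N.
  rewrite ltnNge; apply/negP => h.
  have [_ h2] := uP l k.+1; have := B_nd h; lra.
have nu' : (n <= (u l k.+1).-1)%N by rewrite -ltnS prednK// (leq_ltn_trans _ nu).
have vE : v l k = (u l k.+1).-1.
  rewrite /v ifT// (leq_trans nn0 nu') (le_trans hk')//; exact: B_nd.
have nv : (n <= v l k)%N by rewrite vE.
have Bv : B (v l k) <= rho l ^+ k.+1.
  rewrite leNgt; apply/negP => h.
  have := umin l k.+1 (v l k) (vP l k).1 (ltW h).
  by rewrite vE leqNgt prednK ?leqnn// (leq_ltn_trans _ nu).
have := hN1 k (leq_trans (leq_maxl _ _) kN3); rewrite ler_norml => /andP[p1 p2].
have := hN2 k (leq_trans (leq_maxr _ _) kN3); rewrite ler_norml => /andP[q1 q2].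
have s1 := S_nd w un; have s2 := S_nd w nv.
have /andP[d1 d2] := ES_diff un; have /andP[d3 d4] := ES_diff nv.
have b1 := B_nd un; have b2 := B_nd nv.
have Bu := (uP l k).2.
have rk0 : 0 <= rho l ^+ k by rewrite exprn_ge0// ltW.
have Bvn : B (v l k) <= 2 * B n.
  rewrite (le_trans Bv)// exprS; apply: ler_pM => //; exact: ltW.
have Bdiff : (1 + C) * (B (v l k) - B (u l k)) <= e / 2 * B n.
  apply: (@le_trans _ _ ((1 + C) * (rho l - 1) * rho l ^+ k)).
    rewrite -mulrA ler_wpM2l ?addr_ge0// mulrBl mul1r -exprS; lra.
  apply: ler_pM => //; apply: mulr_ge0; first exact: addr_ge0.
  by rewrite subr_ge0; exact/ltW.
have m1 : e / 4 * B (v l k) <= e / 4 * (2 * B n) by rewrite ler_pM2l.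
have m2 : e / 4 * B (u l k) <= e / 4 * B n by rewrite ler_pM2l.
have E0 : 0 <= e * B n by rewrite mulr_ge0 ?(ltW e0)// (le_trans rk0).
rewrite ler_norml; apply/andP; split; lra.
Qed.

End slln.

(** * Absolutely continuous functions and energy *)

Section absolute_continuity.
Context {R : realType}.
Implicit Types (T a b : R) (h : R -> R).

Lemma AC_finType T h : Defs.AC T h -> forall eps : R, 0 < eps ->
  exists2 delta : R, 0 < delta & forall (I : finType) (a b : I -> R),
    (forall i, [/\ 0 <= a i, a i <= b i & b i <= T]) ->
    trivIset setT (fun i => `]a i, b i[%classic) ->
    \sum_i (b i - a i) < delta -> \sum_i `|h (b i) - h (a i)| < eps.
Proof.
move=> hAC e e0; have [d d0 hd] := hAC _ e0; exists d => // I a b ab tab.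
have E (F : I -> R) : \sum_i F i = \sum_(j < #|I|) F (enum_val j).
  by rewrite -big_enum_val; apply: eq_bigl.
rewrite !E; apply: hd => [i|i j _ _]; first exact: ab.
by move=> ij; apply: enum_val_inj; apply: (tab _ _ Logic.I Logic.I).
Qed.

Lemma itv_partition_nth_homo a b s m n : itv_partition a b s ->
  (m <= n <= size s)%N -> nth b (a :: s) m <= nth b (a :: s) n.
Proof.
move=> [pas _] /andP[mn ns].
have srt : sorted <=%O (a :: s).
  by rewrite /=; apply: sub_path pas => x y /ltW.
by apply: (le_sorted_leq_nth b srt) => //; rewrite inE/= ltnS // (leq_trans mn).
Qed.

(** Subdivision does not change the total length, so the definition can be applied to all cells of
    all partitions at once. *)
Lemma AC_variation T h : Defs.AC T h -> forall eps : R, 0 < eps ->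
  exists2 delta : R, 0 < delta & forall (I : finType) (a b : I -> R)
      (s : I -> seq R),
    (forall i, [/\ 0 <= a i, a i <= b i & b i <= T]) ->
    trivIset setT (fun i => `]a i, b i[%classic) ->
    (forall i, itv_partition (a i) (b i) (s i)) ->
    \sum_i (b i - a i) < delta -> \sum_i variation (a i) (b i) h (s i) < eps.
Proof.
move=> hAC e e0; have [d d0 hd] := AC_finType hAC e0.
exists d => // I a b s ab tab abs sd.
pose x i n := nth (b i) (a i :: s i) n.
have x0 i : x i 0%N = a i by [].
have xs i : x i (size (s i)) = b i by rewrite /x; apply: itv_partition_nth_size.
have xle i m n : (m <= n <= size (s i))%N -> x i m <= x i n.
  by move=> mn; apply: itv_partition_nth_homo.
pose J := {i : I & 'I_(size (s i))}.
have := hd J (fun p => x (tag p) (tagged p)) (fun p => x (tag p) (tagged p).+1).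
rewrite (_ : \sum_(p : J) `|_| = \sum_i variation (a i) (b i) h (s i)); last first.
  rewrite -(sig_big_dep xpredT (fun _ _ => true)
    (fun i (j : 'I_(size (s i))) => `|h (x i j.+1) - h (x i j)|)) /=.
  by apply: eq_bigr => i _; rewrite /variation big_mkord.
rewrite (_ : \sum_(p : J) _ = \sum_i (b i - a i)); last first.
  rewrite -(sig_big_dep xpredT (fun _ _ => true)
    (fun i (j : 'I_(size (s i))) => x i j.+1 - x i j)) /=.
  apply: eq_bigr => i _.
  rewrite -(big_mkord xpredT (fun j => x i j.+1 - x i j)).
  by rewrite telescope_sumr// xs x0.
apply => //.
  move=> [i [j js]] /=; have [a0 aib bT] := ab i.
  split; first by rewrite (le_trans a0)// -[leLHS](x0 i) xle//= ltnW.
    by apply: xle; rewrite leqnSn.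
  by rewrite (le_trans _ bT)// -[leRHS](xs i) xle// js /=.
move=> [i [j js]] [i' [j' js']] _ _ [y []] /=.
rewrite !in_itv/= => /andP[y1 y2] /andP[y3 y4].
have ii' : i = i'.
  apply: (tab _ _ Logic.I Logic.I); exists y; split; rewrite /= in_itv/=.
    rewrite (le_lt_trans _ y1) ?(lt_le_trans y2)//.
      by rewrite -[leRHS](xs i) xle// js /=.
    by rewrite -[leLHS](x0 i) xle//= ltnW.
  rewrite (le_lt_trans _ y3) ?(lt_le_trans y4)//.
    by rewrite -[leRHS](xs i') xle// js' /=.
  by rewrite -[leLHS](x0 i') xle//= ltnW.
subst i'; suff jj : j = j' by subst j'; congr (existT _ _ _); apply: val_inj.
have [jj|jj|//] := ltngtP j j'.
- have := lt_trans y3 y2; rewrite ltNge xle//.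
  by rewrite jj/= ltnW.
- have := lt_trans y1 y4; rewrite ltNge xle//.
  by rewrite jj/= ltnW.
Qed.

(** Intervals shorter than d have variation at most 1, and [0, x] is exhausted in steps of length d
    / 2. *)
Lemma AC_total_variation_fin T h : Defs.AC T h ->
  forall x : R, 0 <= x <= T -> total_variation 0 x h \is a fin_num.
Proof.
move=> hAC; have [d d0 hd] := AC_variation hAC ltr01.
have short (a b : R) : 0 <= a -> a <= b -> b <= T -> b - a < d ->
    total_variation a b h \is a fin_num.
  move=> a0 ab bT bad; apply/bounded_variationP => //.
  exists 1 => _ [s abs <-].
  have := hd 'I_1 (fun=> a) (fun=> b) (fun=> s).
  rewrite !big_ord1 => H; apply/ltW/H => //.
  by move=> i j _ _ _; rewrite !ord1.
have step n : forall x : R, 0 <= x <= T -> x <= n%:R * (d / 2) ->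
    total_variation 0 x h \is a fin_num.
  elim: n => [|n ih] x /andP[x0 xT] xn.
    have -> : x = 0 by apply/eqP; rewrite eq_le x0 andbT (le_trans xn) ?mul0r.
    by rewrite total_variationxx.
  have [xd|dx] := leP x (d / 2).
    by apply: short => //; have := d0; lra.
  rewrite (@total_variationD _ 0 x (x - d / 2)); last 2 first.
  - by have := dx; lra.
  - by have := d0; lra.
  rewrite fin_numD ih/=; first apply: short => //.
  - by have := dx; lra.
  - by have := d0; lra.
  - by have := d0; lra.
  - by apply/andP; split; have := d0; lra.
  - by have := xn; rewrite -natr1 mulrDl; lra.
move=> x xT; apply: (step (`|Num.ceil (x / (d / 2))|%N)) => //.
have d2 : 0 < d / 2 by rewrite divr_gt0.
rewrite -ler_pdivrMr// (le_trans (ceil_ge _))//.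
by rewrite natr_absz ler_int ler_norm.
Qed.

Lemma total_variation_fin_sub T h a b : Defs.AC T h -> 0 <= a -> a <= b -> b <= T ->
  total_variation a b h \is a fin_num.
Proof.
move=> hAC a0 ab bT.
have := AC_total_variation_fin hAC (x := b).
rewrite bT (le_trans a0 ab) => /(_ isT).
by rewrite (total_variationD _ a0 ab) fin_numD => /andP[].
Qed.

(** On each of the n intervals some partition misses the total variation by at most e / (2 (n + 1)),
    so the errors add up to at most e / 2. *)
Lemma AC_total_variation T h : Defs.AC T h ->
  Defs.AC T (fun x => fine (total_variation 0 x h)).
Proof.
move=> hAC e e0; have e2 : 0 < e / 2 by rewrite divr_gt0.
have [d d0 hd] := AC_variation hAC e2; exists d => // n a b ab tab abd.
pose eta := e / 2 / n.+1%:R.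
have eta0 : 0 < eta by rewrite divr_gt0.
have TVE i : `|fine (total_variation 0 (b i) h) - fine (total_variation 0 (a i) h)|
    = fine (total_variation (a i) (b i) h).
  have [a0 aib bT] := ab i.
  rewrite (total_variationD _ a0 aib) fineD.
  - by rewrite addrAC subrr add0r ger0_norm// fine_ge0// total_variation_ge0.
  - by apply: (AC_total_variation_fin hAC); rewrite a0 (le_trans aib).
  - exact: (total_variation_fin_sub hAC).
have ex i : exists s, itv_partition (a i) (b i) s /\
    fine (total_variation (a i) (b i) h) - eta <= variation (a i) (b i) h s.
  have [a0 aib bT] := ab i.
  have [aEb|anb] := eqVneq (a i) (b i).
    exists [::]; split; first by rewrite aEb; split.
    by rewrite aEb total_variationxx variation_nil/= sub0r oppr_le0 ltW.
  have ltab : a i < b i by rewrite lt_neqAle anb.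
  have fin := total_variation_fin_sub hAC a0 aib bT.
  have : (ereal_sup (EFin @` variations (a i) (b i) h) \is a fin_num).
    by have := fin; rewrite /total_variation.
  move=> /(ub_ereal_sup_adherent eta0)[_ [_ [s abs <-] <-]].
  rewrite -[X in (X - _)%E]fineK; last by have := fin; rewrite /total_variation.
  rewrite -EFinB lte_fin => /ltW es; exists s; split => //.
pose s i := sval (cid (ex i)).
have ps i : itv_partition (a i) (b i) (s i) by rewrite /s; case: cid => ? [].
have vs i : fine (total_variation (a i) (b i) h) <= variation (a i) (b i) h (s i) + eta.
  by rewrite -lerBlDr /s; case: cid => ? [].
rewrite (eq_bigr _ (fun i _ => TVE i)).
rewrite (le_lt_trans (ler_sum _ (fun i _ => vs i)))// big_split/= sumr_const card_ord.
have := hd _ a b s ab tab ps abd.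
suff : eta *+ n <= e / 2 by lra.
rewrite -mulr_natl /eta mulrCA ger_pMr// ler_pdivrMr// mul1r ler_nat.
exact: leqnSn.
Qed.

Lemma AC_add T h k : Defs.AC T h -> Defs.AC T k -> Defs.AC T (fun x => h x + k x).
Proof.
move=> hAC kAC e e0; have e2 : 0 < e / 2 by rewrite divr_gt0.
have [d d0 hd] := hAC _ e2; have [d' d'0 kd] := kAC _ e2.
exists (Num.min d d'); first by rewrite lt_min d0.
move=> n a b ab tab; rewrite lt_min => /andP[/(hd _ _ _ ab tab) + /(kd _ _ _ ab tab)].
move=> hs ks.
rewrite (@le_lt_trans _ _ (\sum_(i < n) (`|h (b i) - h (a i)| + `|k (b i) - k (a i)|)))//.
  apply: ler_sum => i _.
  by rewrite (_ : _ - _ = (h (b i) - h (a i)) + (k (b i) - k (a i))) ?ler_normD//; ring.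
by rewrite big_split/=; have := hs; have := ks; lra.
Qed.

Lemma AC_opp T h : Defs.AC T h -> Defs.AC T (fun x => - h x).
Proof.
move=> hAC e /hAC[d d0 hd]; exists d => // n a b ab tab /(hd _ _ _ ab tab).
congr (_ < _); apply: eq_bigr => i _.
by rewrite -opprD normrN.
Qed.

Lemma AC_continuous T h : Defs.AC T h -> forall eps : R, 0 < eps ->
  exists2 delta : R, 0 < delta & forall x y : R, 0 <= x -> x <= y -> y <= T ->
    y - x < delta -> `|h y - h x| < eps.
Proof.
move=> hAC e /hAC[d d0 hd]; exists d => // x y x0 xy yT yxd.
have := hd 1%N (fun=> x) (fun=> y); rewrite !big_ord1; apply => //.
by move=> i j _ _ _; rewrite !ord1.
Qed.

End absolute_continuity.

Lemma lebesgue_stieltjes_measure_oc (R : realType) (f : cumulative R R) (a b : R) :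
  a <= b -> lebesgue_stieltjes_measure f `]a, b]%classic = (f b - f a)%:E.
Proof.
move=> ab; rewrite /lebesgue_stieltjes_measure /measure_extension/=.
by rewrite measurable_mu_extE/= ?wlength_itv_bnd//; exact: is_ocitv.
Qed.

(** Meant for the trace on ]0, T] of a component of an open set. Such a trace may contain its right
    end T, but never its left end, which matches the half-open intervals of the Stieltjes
    measure. *)
Lemma interval_endpoints (R : realType) (T : R) (J : set R) : 0 <= T ->
  (forall x, J x -> 0 < x <= T) -> (forall x, J x -> exists2 y, J y & y < x) ->
  (forall x y z, J x -> J y -> x <= z <= y -> J z) ->
  exists ab : R * R, [/\ 0 <= ab.1, ab.1 <= ab.2 & ab.2 <= T] /\
    J `<=` `]ab.1, ab.2] /\ `]ab.1, ab.2[ `<=` J.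
Proof.
move=> T0 JT Jleft Jitv; have [->|/set0P[x0 Jx0]] := eqVneq J set0.
  exists (0, 0); split; first by split.
  split; first exact: sub0set.
  by move=> z /=; rewrite in_itv/= => /andP[z0 /(lt_trans z0)]; rewrite ltxx.
have hl : has_lbound J by exists 0 => x /JT /andP[/ltW].
have hu : has_ubound J by exists T => x /JT /andP[].
exists (inf J, sup J) => /=; split; [split|split].
- by apply: lb_le_inf; [exists x0|move=> x /JT /andP[/ltW]].
- exact: le_trans (ge_inf hl Jx0) (ub_le_sup hu Jx0).
- by apply: sup_le_ub; [exists x0|move=> x /JT /andP[]].
- move=> x Jx /=; rewrite in_itv/= ub_le_sup// andbT.
  by have [y Jy yx] := Jleft _ Jx; rewrite (le_lt_trans _ yx)// ge_inf.
- have Jn : J !=set0 by exists x0.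
  move=> z /=; rewrite in_itv/= => /andP[/(inf_lt Jn)[x Jx xz] /(sup_gt Jn)[y Jy zy]].
  by apply: (Jitv x y) => //; rewrite !ltW.
Qed.

Section density.
Context {R : realType}.
Variables (T : R) (F : R -> R).
Hypotheses (T0 : 0 < T) (ndF : forall x y, 0 <= x -> x <= y -> y <= T -> F x <= F y)
  (acF : Defs.AC T F).
Local Notation lam := (@lebesgue_measure R).

(** Extends F by constants outside [0, T], to obtain a cumulative function on the whole line. *)
Let clamp (x : R) := Num.max 0 (Num.min x T).

Let clamp_itv x : 0 <= clamp x /\ clamp x <= T.
Proof.
have t0 := T0; rewrite /clamp /Num.max /Num.min.
by do 2 (case: ifPn); rewrite -?leNgt; lra.
Qed.

Let clamp_homo x y : x <= y ->
  clamp x <= clamp y /\ clamp y - clamp x <= y - x.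
Proof.
have t0 := T0; rewrite /clamp /Num.max /Num.min.
by do 4 (case: ifPn); rewrite -?leNgt; lra.
Qed.

Let clampE x : 0 <= x -> x <= T -> clamp x = x.
Proof.
move=> x0 xT; rewrite /clamp /Num.max /Num.min.
by do 2 (case: ifPn); rewrite -?leNgt; lra.
Qed.

Let Fc (x : R) := F (clamp x).

Let Fc_nd : nondecreasing Fc.
Proof.
move=> x y /clamp_homo[xy _]; have [x0 _] := clamp_itv x.
by have [_ yT] := clamp_itv y; exact: ndF.
Qed.

Let Fc_rc : forall x, Fc t @[t --> x^'+] --> Fc x.
Proof.
move=> x; apply/cvgrPdist_lt => e e0.
have [d d0 hd] := AC_continuous acF e0.
near=> t; rewrite distrC /Fc.
have xt : x <= t by [].
have [cxt cd] := clamp_homo xt.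
have [x0 _] := clamp_itv x; have [_ tT] := clamp_itv t.
apply: hd => //; apply: le_lt_trans cd _.
rewrite ltrBlDl; near: t; apply: nbhs_right_lt; by rewrite ltrDl.
Unshelve. all: by end_near. Qed.

Let Fcum : cumulative R R := HB.pack Fc (isCumulative.Build R _ R Fc Fc_nd Fc_rc).

Let nu0 := lebesgue_stieltjes_measure Fcum.

Let nu0_oc a b : a <= b -> nu0 `]a, b]%classic = (Fc b - Fc a)%:E.
Proof.
by move=> ab; rewrite /nu0 lebesgue_stieltjes_measure_oc.
Qed.

Let D : set (measurableTypeR R) := `]0, T]%classic.
Let mD : measurable D. Proof. exact: measurable_itv. Qed.
Let nu0D : (nu0 D < +oo)%E. Proof. by rewrite /D nu0_oc ?ltry// ltW. Qed.
Let nu : {finite_measure set (measurableTypeR R) -> \bar R} := mfrestr mD nu0D.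

(** A null set lies in an open set of measure below the d of absolute continuity. Over any finite
    number of its components the increments of F add up to less than e, and these increments bound
    the Stieltjes measure of the components. *)
Let nu_dom : nu `<< lam.
Proof.
apply/null_content_dominatesP => A mA lA.
have mAD : measurable (A `&` D) by exact: measurableI.
apply/eqP; rewrite eq_le measure_ge0 andbT.
apply/lee_addgt0Pr => e e0; rewrite add0e.
have [d d0 hd] := acF e0.
have lAD : lam (A `&` D) = 0%E.
  apply/eqP; rewrite eq_le measure_ge0 andbT -lA.
  by apply: le_measure; rewrite ?inE//; exact: subIsetl.
have [|U [oU ADU Ud]] := @lebesgue_regularity_outer _ _ d mAD _ d0.
  by rewrite [X in (X < _)%E](_ : _ = 0%E)//; exact: lAD.
have mU : measurable U by exact: open_measurable.
have lU : (lam U < d%:E)%E.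
  rewrite (le_lt_trans _ Ud)//.
  have UE : U = (U `\` (A `&` D)) `|` (A `&` D) by rewrite setUC setDUK.
  by rewrite {1}UE measureU0//; exact: measurableD.
pose I k := open_disjoint_itv oU k.
have oI k : open (I k) by exact: open_disjoint_itv_open.
have mI k : measurable (I k) by exact: open_measurable.
have tI : trivIset setT I by exact: open_disjoint_itv_trivIset.
have UI : U = \bigcup_k I k by exact: open_disjoint_itv_bigcup.
have /choice[ab abP] k : exists ab : R * R,
    [/\ 0 <= ab.1, ab.1 <= ab.2 & ab.2 <= T] /\
    I k `&` D `<=` `]ab.1, ab.2] /\ `]ab.1, ab.2[ `<=` I k `&` D.
  apply: (interval_endpoints (ltW T0)).
  - by move=> x [_]; rewrite /D/= in_itv.
  - move=> x [Ix]; rewrite /D/= in_itv/= => /andP[x0 xT].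
    have /nbhs_ballP[e' /= e'0 Ie'] : nbhs x (I k) by exact: open_nbhs_nbhs.
    exists (Num.max (x / 2) (x - e' / 2)); last by rewrite gt_max; lra.
    split; last first.
      by rewrite in_itv/= lt_max ge_max; apply/andP; split; lra.
    apply: Ie'; rewrite /ball/= ltr_distlC.
    by rewrite lt_max gt_max; apply/andP; split; lra.
  - move=> x y z [Ix Dx] [Iy Dy] xzy; split.
      exact: (open_disjoint_itv_is_interval Ix Iy).
    move: Dx Dy xzy; rewrite /D/= !in_itv/= => /andP[x0 _] /andP[_ yT] /andP[xz zy].
    by rewrite (lt_le_trans x0)//= (le_trans zy).
have nuI k : (nu (I k) <= (F (ab k).2 - F (ab k).1)%:E)%E.
  have [[a0 le_ab bT] [Iab abI]] := abP k.
  rewrite -(clampE a0 (le_trans le_ab bT)) -(clampE (le_trans a0 le_ab) bT).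
  rewrite -(nu0_oc le_ab) /nu/= /mfrestr /mrestr.
  apply: (@le_measure _ _ _ (lebesgue_stieltjes_measure Fcum)); rewrite ?inE//.
  exact: (@measurableI _ (measurableTypeR R) _ _ (mI k) mD).
rewrite (@le_trans _ _ (nu U))//.
  have -> : nu A = nu (A `&` D) by rewrite /nu/= /mfrestr /mrestr -setIA setIid.
  by rewrite le_measure ?inE.
rewrite UI measure_semi_bigcup//; last by rewrite -UI.
apply: lime_le; first by apply: is_cvg_nneseries => *; exact: measure_ge0.
near=> n; rewrite big_mkord.
apply: (@le_trans _ _ (\sum_(i < n) (F (ab i).2 - F (ab i).1)%:E)%E).
  by apply: lee_sum => i _; exact: nuI.
rewrite sumEFin lee_fin.
have := hd n (fun i => (ab i).1) (fun i => (ab i).2).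
move=> /(_ (fun i => (abP i).1)) H; apply: le_trans (ltW (H _ _)).
- by apply: ler_sum => i _; exact: ler_norm.
- move=> i j _ _ [y [/(abP i).2.2[Ii _] /(abP j).2.2[Ij _]]].
  by apply: val_inj; apply: (tI i j) => //; exists y.
- rewrite -lte_fin -sumEFin (le_lt_trans _ lU)//.
  apply: (@le_trans _ _ (\sum_(i < n) lam (I i))%E).
    apply: lee_sum => i _; have [[a0 le_ab bT] [Iab abI]] := abP i.
    apply: (@le_trans _ _ (lam `](ab i).1, (ab i).2[)).
      rewrite lebesgue_measure_itv/= lte_fin; case: ltP => //= ba.
      by rewrite lee_fin subr_le0.
    apply: le_measure; rewrite ?inE//; first exact: mI.
    by move=> y /abI[].
  rewrite -(@measure_bigsetU_ord _ _ _ lam n xpredT (fun i : 'I_n => I i)); last 2 first.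
  - by move=> i; exact: mI.
  - by move=> i j _ _ Iij; apply: val_inj; exact: (tI i j).
  apply: le_measure; rewrite ?inE//.
    by apply: bigsetU_measurable => i _; exact: mI.
  rewrite UI -(big_mkord xpredT I) => y; rewrite -bigcup_seq => -[k _ Iky].
  by exists k.
Unshelve. all: by end_near. Qed.

Lemma nondecreasing_AC_density : exists g : R -> R,
  lam.-integrable setT (EFin \o g) /\
  forall x, 0 <= x -> x <= T -> F x - F 0 = \int[lam]_(t in `]0, x]) g t.
Proof.
have [f [f0 ffin fint fE]] := radon_nikodym_sigma_finite nu_dom.
have fg : f = EFin \o (fine \o f) by apply/funext => x /=; rewrite fineK.
exists (fine \o f); rewrite -fg; split => // x x0 xT.
rewrite /Rintegral -[X in fine X](_ : nu `]0, x]%classic = _); last first.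
  by rewrite fE//; apply: eq_integral => y _; rewrite fineK.
rewrite /nu/= /mfrestr /mrestr setIidl.
  by rewrite lebesgue_stieltjes_measure_oc//= /Fc !clampE// ltW.
by apply: subset_itvl; rewrite bnd_simp.
Qed.


End density.

(** Jordan decomposition: with V the total variation, both V and V - h are nondecreasing and
    absolutely continuous. *)
Lemma AC_density (R : realType) (T : R) (h : R -> R) : 0 < T -> Defs.AC T h ->
  exists g : R -> R, (@lebesgue_measure R).-integrable setT (EFin \o g) /\
    forall x, 0 <= x -> x <= T ->
      h x - h 0 = \int[@lebesgue_measure R]_(t in `]0, x]) g t.
Proof.
move=> T0 hAC; pose V x := fine (total_variation 0 x h).
have VAC : Defs.AC T V by exact: AC_total_variation.
have Vd x y : 0 <= x -> x <= y -> y <= T -> `|h y - h x| <= V y - V x.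
  move=> x0 xy yT; rewrite /V (total_variationD _ x0 xy) fineD.
  - rewrite addrAC subrr add0r -lee_fin fineK; last exact: (total_variation_fin_sub hAC).
    exact: total_variation_ge.
  - by apply: (AC_total_variation_fin hAC); rewrite x0 (le_trans xy).
  - exact: (total_variation_fin_sub hAC).
have [x y x0 xy yT||g1 [ig1 g1E]] := @nondecreasing_AC_density _ T V T0.
- by rewrite -subr_ge0 (le_trans _ (Vd _ _ x0 xy yT)).
- by [].
have [x y x0 xy yT||g2 [ig2 g2E]] :=
    @nondecreasing_AC_density _ T (fun x => V x + - h x) T0.
- by have := Vd _ _ x0 xy yT; rewrite ler_norml => /andP[]; lra.
- exact/AC_add/AC_opp.
exists (fun x => g1 x - g2 x); split.
  exact: (integrableB measurableT ig1 ig2).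
move=> x x0 xT; rewrite RintegralB//; last 2 first.
- exact: (integrableS measurableT).
- exact: (integrableS measurableT).
by rewrite -g1E// -g2E//; ring.
Qed.

Section energy.
Context {R : realType}.
Local Notation lam := (@lebesgue_measure R).

(** Lebesgue differentiation of the integral of g; near an interior point h differs from that
    integral by the constant h 0. *)
Lemma AC_derive1 (T : R) (h : R -> R) : 0 < T -> Defs.AC T h ->
  exists g : R -> R, [/\ lam.-integrable setT (EFin \o g),
    forall x, 0 <= x -> x <= T ->
      h x - h 0 = \int[lam]_(t in `]0, x]) g t &
    {ae lam, forall x, 0 < x < T -> derive1 h x = g x}].
Proof.
move=> T0 hAC; have [g [ig gE]] := AC_density T0 hAC.
exists g; split => //.
have locg : locally_integrable [set: R] g.
  by apply: open_integrable_locally => //; exact: openT.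
have := @FTC1 R g (BRight 0) _ locg.
have intg y : lam.-integrable [set` Interval (BRight 0) (BRight y)] (EFin \o g).
  by apply: (integrableS measurableT) => //; exact: measurable_itv.
move=> /(_ intg); apply: filterS; first exact: (ae_filter_ringOfSetsType lam).
move=> x /[swap] /andP[x0 xT].
move=> /(_ x0)[_ <-]; rewrite !derive1E.
have -> : 'D_1 h x = 'D_1 (fun y : R => h 0 + \int[lam]_(t in `]0, y]) g t) x.
  apply: near_eq_derive; near=> y.
  rewrite -gE; first by rewrite addrC subrK.
    by apply: ltW; near: y; exact: lt_nbhsr.
  by apply: ltW; near: y; exact: lt_nbhsl.
rewrite /derive; set A := (X in lim (X @ _)); set B := (X in _ = lim (X @ _)).
suff -> : A = B by [].
by apply/funext => e; rewrite /A /B /=; congr (_ *: _); ring.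
Unshelve. all: by end_near. Qed.

(** Here f stands for psi(h'), whose measurability is not established. The integral of a nonnegative
    function is the supremum over simple functions below it, and off the null set whatever lies
    below G lies below f. *)
Lemma lower_integral_ge (D : set R) (f G : R -> R) : measurable D ->
  measurable_fun setT G -> (forall x, 0 <= f x) -> (forall x, 0 <= G x) ->
  {ae lam, forall x, D x -> G x <= f x} ->
  (\int[lam]_(x in D) (G x)%:E <= \int[lam]_(x in D) (f x)%:E)%E.
Proof.
move=> mD mG f0 G0 [N [mN N0 subN]].
have mGE : measurable_fun D (fun x => (G x)%:E).
  exact/measurable_EFinP/(measurable_funS measurableT).
rewrite (ge0_negligible_integral mN mD mGE _ N0); last by move=> x _; rewrite lee_fin.
rewrite [leLHS]integral_mkcond [leRHS]integral_mkcond.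
have r0 (A : set R) (k : R -> R) : (forall x, 0 <= k x) ->
    forall x, (0 <= ((EFin \o k) \_ A) x)%E.
  by move=> k0 x; apply: erestrict_ge0 => y _; rewrite lee_fin.
rewrite !ge0_integralTE; last 2 first.
- exact: r0.
- exact: r0.
apply: ereal_sup_le => _ [k kG <-].
exists k => // x; apply: le_trans (kG x) _.
rewrite !patchE; case: ifPn => [/set_mem[Dx Nx]|_]; last first.
  by case: ifPn => // _; rewrite lee_fin.
rewrite mem_set// lee_fin; apply: contrapT => Gf; apply: Nx; apply: subN => /=.
by move=> /(_ Dx).
Qed.

Lemma energy_ge (psi : R -> R) (T : R) (h : R -> R) (n : nat)
    (w c t : nat -> R) :
  0 < T -> Defs.AC T h -> (forall v, 0 <= psi v) ->
  (forall k, (k < n)%N -> 0 <= w k) ->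
  (forall k, (k < n)%N -> 0 <= t k <= T) ->
  (forall v, \sum_(k < n) w k * Num.max 0 (v - c k) <= psi v) ->
  ((\sum_(k < n) w k * ((h (t k) - h 0) - c k * t k))%:E
     <= energy psi T h)%E.
Proof.
move=> T0 hAC psi0 w0 tT psige.
have [g [ig gE dh]] := AC_derive1 T0 hAC.
have mg : measurable_fun setT g by apply/measurable_EFinP; exact: measurable_int ig.
pose G x := \sum_(k < n) w k * Num.max 0 (g x - c k).
have mGk k : measurable_fun setT (fun x => Num.max 0 (g x - c k)).
  apply: measurable_maxr => //; apply: measurable_funB => //.
have mGkA k (A : set R) : measurable_fun A (fun x => (Num.max 0 (g x - c k))%:E).
  by apply/measurable_EFinP; exact: (measurable_funTS (mGk k)).
have mGkwA k (A : set R) :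
    measurable_fun A (fun x => (w k * Num.max 0 (g x - c k))%:E).
  apply/measurable_EFinP; apply: measurable_funM => //.
  exact: (measurable_funTS (mGk k)).
have mG : measurable_fun setT G.
  apply: measurable_sum => k; exact: measurable_funM.
have max0 (a : R) : 0 <= Num.max 0 a by rewrite le_max lexx.
have G0 x : 0 <= G x by apply: sumr_ge0 => k _; rewrite mulr_ge0// w0.
have gk k : (k < n)%N -> (((h (t k) - h 0) - c k * t k)%:E <=
    \int[lam]_(x in `[0%R, T]) (Num.max 0 (g x - c k))%:E)%E.
  move=> kn; have /andP[t0 tkT] := tT _ kn.
  apply: (@le_trans _ _ (\int[lam]_(x in `]0%R, t k]) (Num.max 0 (g x - c k))%:E)%E);
    last first.
    apply: ge0_subset_integral => //=.
    - exact: mGkA.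
    - by move=> x _; rewrite lee_fin.
    - by apply: subset_itv; rewrite bnd_simp.
  have mI : measurable (`]0, t k]%classic : set (measurableTypeR R)).
    exact: measurable_itv.
  have igS : lam.-integrable `]0, t k] (EFin \o g).
    by apply: (integrableS measurableT) => //; exact: measurable_itv.
  have icst : lam.-integrable `]0, t k] (EFin \o cst (c k)).
    apply/integrableP; split; first exact/measurable_EFinP.
    rewrite (eq_integral (cst `|c k|%:E)) => [|x _ //].
    rewrite integral_cst/=; last exact: measurable_itv.
    rewrite lebesgue_measure_itv/=; case: ifP => _; last by rewrite mule0 ltry.
    by rewrite -EFinB -EFinM ltry.
  have ig2 : lam.-integrable `]0, t k] (EFin \o (fun x => g x - c k)).
    exact: (integrableB mI igS icst).
  have -> : (h (t k) - h 0) - c k * t k = \int[lam]_(x in `]0, t k]) (g x - c k).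
    rewrite RintegralB// -gE// Rintegral_cst//.
    rewrite [X in fine X](_ : _ = (t k)%:E)//.
    rewrite [LHS](lebesgue_measure_itv `]0, t k])/= lte_fin.
    by case: ltP => //= t00; [rewrite sube0|congr EFin; apply/eqP; rewrite eq_le t0 t00].
  rewrite /Rintegral fineK; last first.
    exact: (integrable_fin_num mI ig2).
  rewrite integralE; apply: (@le_trans _ _
      (\int[lam]_(x in `]0%R, t k]) ((EFin \o (fun x => g x - c k)%R) ^\+ x))%E).
    by rewrite geeDl// oppe_le0 integral_ge0.
  rewrite le_eqVlt; apply/orP; left; apply/eqP/eq_integral => x _.
  by rewrite funeposE/= EFin_max maxC.
have -> : (\sum_(k < n) w k * ((h (t k) - h 0) - c k * t k))%:E =
    (\sum_(k < n) (w k)%:E * ((h (t k) - h 0) - c k * t k)%:E)%E.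
  by rewrite -sumEFin; apply: eq_bigr => k _; rewrite EFinM.
apply: (@le_trans _ _ (\int[lam]_(x in `[0%R, T]) (G x)%:E)%E).
  have -> : (\int[lam]_(x in `[0%R, T]) (G x)%:E =
      \sum_(k < n) (w k)%:E * \int[lam]_(x in `[0%R, T]) (Num.max 0 (g x - c k))%:E)%E.
    under eq_integral do rewrite /G -sumEFin.
    rewrite ge0_integral_sum//=; last 2 first.
    - by move=> k; exact: mGkwA.
    - by move=> k x _; rewrite lee_fin mulr_ge0// w0.
    apply: eq_bigr => k _; under eq_integral do rewrite EFinM.
    rewrite ge0_integralZl//=.
    - exact: mGkA.
    - by move=> x _; rewrite lee_fin.
    - by rewrite lee_fin w0.
  by apply: lee_sum => k _; rewrite lee_wpmul2l ?gk// lee_fin w0.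
(* The density is identified with the derivative in the open interval only; the two endpoints are
   discarded as null sets. *)
have neq (a : R) : {ae lam, forall x : R, x != a}.
  exists [set a]; split; first exact: measurable_set1.
    exact: lebesgue_measure_set1.
  by move=> x /= /negP; rewrite negbK => /eqP.
apply: lower_integral_ge => //.
move: (neq 0) (neq T) dh.
apply: filterS3; first exact: (ae_filter_ringOfSetsType lam).
move=> x xn0 xnT dhx.
rewrite /= in_itv/= => /andP[x0 xT].
have -> : derive1 h x = g x by apply: dhx; rewrite !lt_neqAle x0 xT !andbT eq_sym xn0.
exact: psige.
Qed.
End energy.

(** * The convex integrand on a geometric grid of slopes *)

Lemma convex_function_line (R : realType) (psi : R -> R) :
  convex_function (setT : set R^o) psi -> forall t x y : R, 0 <= t -> t <= 1 ->
  psi (t * x + (1 - t) * y) <= t * psi x + (1 - t) * psi y.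
Proof.
move=> cpsi t x y t0 t1.
have := cpsi (Itv01 t0 t1) x y (mem_set I) (mem_set I).
by [].
Qed.

Section convex_slopes.
Context {R : realType}.
Variables (psi : R -> R) (q : R).
Hypotheses (psi_ge0 : forall u, 0 <= psi u)
  (psi_line : forall t x y : R, 0 <= t -> t <= 1 ->
     psi (t * x + (1 - t) * y) <= t * psi x + (1 - t) * psi y)
  (psi0 : psi 0 = 0) (q1 : 1 < q).

Let q0 : 0 < q. Proof. exact: lt_trans q1. Qed.

Lemma convex_chord (x y z : R) : x <= y -> y <= z ->
  (z - x) * psi y <= (z - y) * psi x + (y - x) * psi z.
Proof.
move=> xy yz; have [xz|xz] := eqVneq x z.
  have -> : y = x by apply/eqP; rewrite eq_le xy [X in _ <= X]xz yz.
  by rewrite -xz subrr !mul0r addr0.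
have zx : 0 < z - x by rewrite subr_gt0 lt_neqAle xz (le_trans xy).
have := @psi_line ((z - y) / (z - x)) x z.
have -> : 1 - (z - y) / (z - x) = (y - x) / (z - x).
  by field; rewrite gt_eqF.
have -> : (z - y) / (z - x) * x + (y - x) / (z - x) * z = y.
  by field; rewrite gt_eqF.
have t0 : 0 <= (z - y) / (z - x) by rewrite divr_ge0 ?subr_ge0// -subr_ge0 ltW.
have t1 : (z - y) / (z - x) <= 1 by rewrite ler_pdivrMr// mul1r lerD2l lerN2.
move=> /(_ t0 t1) h; rewrite mulrC -ler_pdivlMr// (le_trans h)//.
rewrite le_eqVlt; apply/orP; left; apply/eqP; field; by rewrite gt_eqF.
Qed.

Lemma convex_slope_le (x y z : R) : x < y -> y < z ->
  (psi y - psi x) / (y - x) <= (psi z - psi y) / (z - y).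
Proof.
move=> xy yz; rewrite ler_pdivrMr ?subr_gt0// mulrAC ler_pdivlMr ?subr_gt0//.
have := convex_chord (ltW xy) (ltW yz); lra.
Qed.

Lemma convex_nondecreasing (u v : R) : 0 <= u -> u <= v -> psi u <= psi v.
Proof.
move=> u0; rewrite le_eqVlt => /predU1P[->//|uv].
have v0 : 0 < v by exact: le_lt_trans u0 uv.
have := convex_chord u0 (ltW uv); rewrite psi0 !subr0 mulr0 add0r => h.
rewrite -(ler_pM2l v0) (le_trans h)//.
by rewrite ler_wpM2r// ltW.
Qed.

Definition grid (k : nat) : R := q ^- k.
Definition chord_slope (k : nat) : R :=
  (psi (grid k) - psi (grid k.+1)) / (grid k - grid k.+1).
(* This is theta (q^-k) when psi u = u^2 theta u. *)
Definition scaled_psi (k : nat) : R := psi (grid k) * q ^+ (2 * k).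

Local Notation c := grid.
Local Notation s := chord_slope.
Local Notation th := scaled_psi.

Lemma grid_gt0 k : 0 < c k. Proof. by rewrite invr_gt0 exprn_gt0. Qed.

Lemma gridS k : c k.+1 = c k / q.
Proof. by rewrite /grid exprS invfM mulrC. Qed.

Lemma gridS_lt k : c k.+1 < c k.
Proof. by rewrite gridS ltr_pdivrMr// ltr_pMr// grid_gt0. Qed.

Lemma grid_le m n : (m <= n)%N -> c n <= c m.
Proof.
by move=> mn; rewrite /grid lef_pV2 ?posrE ?exprn_gt0// ler_weXn2l// ltW.
Qed.

Lemma chord_slope_ge0 k : 0 <= s k.
Proof.
have h := gridS_lt k; rewrite /chord_slope divr_ge0 ?subr_ge0//; last exact: ltW.
by apply: convex_nondecreasing; rewrite ltW ?grid_gt0.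
Qed.

Lemma chord_slopeS_le k : s k.+1 <= s k.
Proof. exact: convex_slope_le (gridS_lt _) (gridS_lt _). Qed.

Lemma psi_grid_chord k : psi (c k) = psi (c k.+1) + s k * (c k - c k.+1).
Proof.
have := gridS_lt k; rewrite -subr_gt0 => h.
by rewrite /chord_slope divfK ?gt_eqF//; ring.
Qed.

Lemma chord_support k v : c k <= v -> psi (c k) + s k * (v - c k) <= psi v.
Proof.
rewrite le_eqVlt => /predU1P[<-|cv]; first by rewrite subrr mulr0 addr0.
have := convex_slope_le (gridS_lt k) cv.
by rewrite -/(s k) ler_pdivlMr ?subr_gt0// => h; have := h; lra.
Qed.

(** Between c (k+1) and c k the sum has slope s (k+1) - s n, which is below the slope s k of the
    chord there. The claim [above] goes from c n upwards cell by cell; the extra term with s n makes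
    its two sides linear with the same slope, so that the induction closes. *)
Lemma chord_sum_le m n v :
  \sum_(m <= k < n) (s k - s k.+1) * Num.max 0 (v - c k) <= psi v.
Proof.
have [nm|mn] := leqP n m; first by rewrite big_geq.
have S0 k : 0 <= s k - s k.+1 by rewrite subr_ge0 chord_slopeS_le.
have above j : (j <= n)%N -> forall v, c (n - j) <= v ->
    \sum_(n - j <= k < n) (s k - s k.+1) * Num.max 0 (v - c k)
      + s n * (v - c (n - j)) <= psi (c (n - j)) + s (n - j)%N * (v - c (n - j)).
  elim: j => [|j ih] jn u cu.
    by rewrite subn0 big_geq// add0r lerDr.
  have e : (n - j = (n - j.+1).+1)%N by rewrite subnSK.
  have := ih (ltnW jn) u; rewrite e.
  set i := (n - j.+1)%N in cu *; move=> H.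
  have iu : c i.+1 <= u by rewrite (le_trans _ cu)// ltW// gridS_lt.
  rewrite big_ltn; last by rewrite /i; lia.
  have -> : Num.max 0 (u - c i) = u - c i by apply/max_idPr; rewrite subr_ge0.
  have := H iu; rewrite [psi (c i)]psi_grid_chord.
  have g := gridS_lt i; have sn := chord_slope_ge0 n.
  set S := \sum_(_ <= _ < _) _; move: S (psi (c i.+1)) => S a.
  have : 0 <= s n * (c i - c i.+1) by rewrite mulr_ge0// subr_ge0 ltW.
  have : 0 <= (s i - s i.+1) * (c i - c i.+1).
    by rewrite mulr_ge0// subr_ge0 ltW.
  by move: (s n) (s i) (s i.+1) (c i) (c i.+1) => sn' si si' ci ci'; lra.
suff H j : (j <= n)%N ->
    \sum_(n - j <= k < n) (s k - s k.+1) * Num.max 0 (v - c k) <= psi v.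
  by have := H (n - m)%N (leq_subr _ _); rewrite subKn// ltnW.
elim: j => [|j ih] jn; first by rewrite subn0 big_geq.
have [cv|vc] := leP (c (n - j.+1)) v.
  apply: le_trans (chord_support cv).
  apply: le_trans (above _ jn _ cv).
  by rewrite lerDl mulr_ge0 ?chord_slope_ge0// subr_ge0.
rewrite big_ltn; last by lia.
have -> : Num.max 0 (v - c (n - j.+1)) = 0 by apply/max_idPl; rewrite subr_le0 ltW.
by rewrite mulr0 add0r subnSK//; apply: ih; exact: ltnW.
Qed.

Lemma scaled_psi_ge0 k : 0 <= th k.
Proof. by rewrite mulr_ge0// exprn_ge0// ltW. Qed.

Lemma gridX k : q ^+ k * c k = 1.
Proof. by rewrite mulfV// gt_eqF// exprn_gt0. Qed.

(** Since c k - c (k+1) is a multiple of q^-k, the scaled slope is a combination of two neighbouring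
    terms; this is what makes the total weight computable. *)
Lemma chord_slope_scaled k :
  s k * (q ^+ k.+1 - q ^+ k) = q * th k - th k.+1 / q.
Proof.
have qk : 0 < q ^+ k by rewrite exprn_gt0.
have e : c k - c k.+1 = (q - 1) / (q * q ^+ k).
  by rewrite gridS /grid; field; rewrite ?gt_eqF.
rewrite /chord_slope e /scaled_psi.
move: (psi (c k)) (psi (c k.+1)) => a b.
rewrite !mulSn !mul0n addn0 !exprD !exprS ?expr0.
move: (q ^+ k) qk => x x0; field.
have q1' := q1; have q0' := q0.
by rewrite !gt_eqF// ?mulr_gt0// subr_gt0.
Qed.

Lemma chord_slope_le_scaled k : s k * q ^+ k <= q / (q - 1) * th k.
Proof.
have q1' : 0 < q - 1 by rewrite subr_gt0.
have := chord_slope_scaled k; have t := scaled_psi_ge0 k.+1.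
rewrite exprS -[X in _ * (_ - X)]mul1r -mulrBl mulrCA => h.
rewrite [X in _ <= X]mulrAC ler_pdivlMr// mulrC h lerBlDr lerDl divr_ge0//.
exact: ltW.
Qed.

(** Coefficient of the supremum at slope c (k+1) after division by its size q^(k+1). The lower bound
    pairs the same weight with slope c k, of size q^k, which costs a factor 1 / q. *)
Definition chord_weight (k : nat) : R := (s k - s k.+1) * q ^+ k.+1.

Lemma chord_weight_ge0 k : 0 <= chord_weight k.
Proof. by rewrite mulr_ge0 ?subr_ge0 ?chord_slopeS_le// exprn_ge0// ltW. Qed.

Lemma chord_weight_le k : chord_weight k <= q ^+ 2 / (q - 1) * th k.
Proof.
have := chord_slope_le_scaled k; have sp := chord_slope_ge0 k.+1.
rewrite -(ler_pM2l q0) => h.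
rewrite (_ : q ^+ 2 / (q - 1) * th k = q * (q / (q - 1) * th k)); last by rewrite expr2; ring.
rewrite (le_trans _ h)// /chord_weight exprS mulrCA.
rewrite ler_wpM2l ?(ltW q0)// ler_wpM2r ?exprn_ge0// ?(ltW q0)//.
by rewrite lerBlDr lerDl.
Qed.

(** Summation by parts with [chord_slope_scaled]. As each scaled supremum has mean about 1/2, half
    of the factor q - 1/q is the leading constant of both energy bounds. *)
Lemma chord_weight_sum n : \sum_(k < n) chord_weight k =
  s 0%N + (q - q^-1) * wsum th n + th 0%N / q - th n / q - s n * q ^+ n.
Proof.
rewrite /wsum; elim: n => [|n ih]; first by rewrite !big_ord0 expr0; ring.
rewrite !big_ord_recr/= ih /chord_weight.
have := chord_slope_scaled n; rewrite mulrBr => /eqP; rewrite subr_eq => /eqP h.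
by rewrite [(s n - _) * _]mulrBl h; ring.
Qed.

End convex_slopes.

Section m_psi_bounds.
Context {R : realType}.
Variables (psi : R -> R).
Hypotheses (psi_ge0 : forall u, 0 <= psi u)
  (psi_nd : forall u v : R, 0 <= u -> u <= v -> psi u <= psi v).
Local Notation lam := (@lebesgue_measure R).

Let f (a : R) := a * psi a^-1.

(** With the inverse clamped below 1, psi of it is monotone on the whole line and hence measurable;
    on [1, b] nothing changes. *)
Let f_integrable (b : R) : lam.-integrable `[1, b] (EFin \o f).
Proof.
have mI : measurable (`[1, b]%classic : set (measurableTypeR R)).
  exact: measurable_itv.
pose g (a : R) := a * psi (Num.max 1 a)^-1.
have mg : measurable_fun setT g.
  apply: measurable_funM => //.
  apply: nonincreasing_measurable => // x y xy; apply: psi_nd.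
    by rewrite invr_ge0 le_max ler01.
  rewrite lef_pV2 ?posrE ?lt_max ?ltr01//.
  by rewrite ge_max le_max lexx/= le_max xy orbT.
have fg (a : R) : 1 <= a -> f a = g a by move=> a1; rewrite /f /g max_r.
apply: (eq_integrable mI (EFin \o g)).
  by move=> x; rewrite inE/= in_itv/= => /andP[x1 _]; rewrite fg.
apply: measurable_bounded_integrable => //.
- by rewrite [X in (X < _)%E](lebesgue_measure_itv `[1, b])/=; case: ifP => // _; rewrite ltry.
- exact: measurable_funTS.
- exists (`|b| * psi 1); split; first exact: num_real.
  move=> M bM x /=; rewrite in_itv/= => /andP[x1 xb].
  rewrite (le_trans _ (ltW bM))// /g normrM ler_pM//.
    rewrite !ger0_norm//; first by rewrite (le_trans ler01)// (le_trans x1).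
    by rewrite (le_trans ler01).
  rewrite ger0_norm//; apply: psi_nd; first by rewrite invr_ge0 le_max ler01.
  by rewrite invf_le1 ?lt_max ?ltr01// le_max lexx.
Qed.

Let m_psiB (a b : R) : 1 <= a -> a <= b ->
  m_psi psi b - m_psi psi a = \int[lam]_(x in `]a, b]) f x.
Proof.
by move=> a1 ab; rewrite /m_psi (@Rintegral_itvB _ f)// ?bnd_simp//; exact: f_integrable.
Qed.

Let f_integrable' (a b : R) : 1 <= a -> lam.-integrable `]a, b] (EFin \o f).
Proof.
have mI (i : interval R) : measurable ([set` i] : set (measurableTypeR R)).
  exact: measurable_itv.
move=> a1; apply: (integrableS (mI _) (mI _) _ (f_integrable b)).
by apply: subset_itv; rewrite bnd_simp.
Qed.

Lemma m_psi_increment (a b : R) : 1 <= a -> a <= b ->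
  a * psi b^-1 * (b - a) <= m_psi psi b - m_psi psi a <= b * psi a^-1 * (b - a).
Proof.
move=> a1 ab; rewrite m_psiB//.
have mI : measurable (`]a, b]%classic : set (measurableTypeR R)).
  exact: measurable_itv.
have lI : fine (lam `]a, b]) = b - a.
  rewrite [X in fine X](_ : _ = (b - a)%:E)//.
  rewrite [LHS](lebesgue_measure_itv `]a, b])/= lte_fin.
  by case: ltP => // ba; congr EFin; apply/eqP; rewrite eq_sym subr_eq0 eq_le ab ba.
have icst (k : R) : lam.-integrable `]a, b] (EFin \o cst k).
  apply/integrableP; split; first exact/measurable_EFinP.
  rewrite (eq_integral (cst `|k|%:E)) => [|x _ //].
  rewrite integral_cst//= [X in (_ * X)%E](lebesgue_measure_itv `]a, b])/=.
  by case: ifP => _; rewrite ?mule0 ?ltry// -EFinB -EFinM ltry.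
have cstE (k : R) : \int[lam]_(x in `]a, b]) cst k x = k * (b - a).
  by rewrite Rintegral_cst// lI.
have a0 : 0 < a by exact: lt_le_trans a1.
have b0 : 0 < b by exact: lt_le_trans ab.
rewrite -!cstE; apply/andP; split; apply: le_Rintegral => //; try exact: f_integrable'.
  move=> x /=; rewrite in_itv/= => /andP[ax xb].
  have x0 : 0 < x by exact: lt_trans ax.
  rewrite /f ler_pM ?(ltW a0) ?(ltW ax)//; apply: psi_nd; first by rewrite invr_ge0 ltW.
  by rewrite lef_pV2.
move=> x /=; rewrite in_itv/= => /andP[ax xb].
have x0 : 0 < x by exact: lt_trans ax.
rewrite /f ler_pM ?(ltW x0)//; apply: psi_nd; first by rewrite invr_ge0 ltW.
by rewrite lef_pV2// ltW.
Qed.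

Lemma m_psi_le (a b : R) : 1 <= a -> a <= b -> m_psi psi a <= m_psi psi b.
Proof.
move=> a1 ab; rewrite -subr_ge0.
have /andP[h _] := m_psi_increment a1 ab; apply: le_trans h.
by rewrite !mulr_ge0// ?subr_ge0// (le_trans _ a1).
Qed.

Variables (q : R) (q1 : 1 < q).
Local Notation th := (scaled_psi psi q).

Lemma m_psi_geometric n :
  (q - 1) / q ^+ 2 * (\sum_(k < n) th k.+1) <= m_psi psi (q ^+ n)
    <= q * (q - 1) * wsum th n.
Proof.
have q0 : 0 < q by exact: lt_trans q1.
rewrite /wsum; elim: n => [|n ih].
  rewrite !big_ord0 !mulr0 expr0 /m_psi set_itv1 Rintegral_set1.
  by rewrite lexx.
have qn : 1 <= q ^+ n by rewrite exprn_ege1// ltW.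
have qnS : q ^+ n <= q ^+ n.+1 by rewrite ler_weXn2l// ltW.
have := m_psi_increment qn qnS; rewrite !big_ord_recr/=.
have -> : q ^+ n * psi (q ^+ n.+1)^-1 * (q ^+ n.+1 - q ^+ n)
    = (q - 1) / q ^+ 2 * th n.+1.
  rewrite /scaled_psi /grid mulnS mul2n -addnn !exprD exprS.
  by field; rewrite gt_eqF.
have -> : q ^+ n.+1 * psi (q ^+ n)^-1 * (q ^+ n.+1 - q ^+ n)
    = q * (q - 1) * th n.
  rewrite /scaled_psi /grid mul2n -addnn !exprD exprS.
  by ring.
by move: ih; rewrite !mulrDr => /andP[h1 h2] /andP[h3 h4]; apply/andP; split; lra.
Qed.

End m_psi_bounds.

(** * Growth of the scaled values and of their partial sums *)

Section growth.
Context {R : realType}.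
Variables (psi theta : R -> R) (alo aup : R).
Hypotheses (psi_ge0 : forall u, 0 <= psi u)
  (psi_line : forall t x y : R, 0 <= t -> t <= 1 ->
     psi (t * x + (1 - t) * y) <= t * psi x + (1 - t) * psi y)
  (psi_theta : forall u, 0 < u -> psi u = u ^+ 2 * theta u)
  (theta_lo : (fun u : R => `|ln u| `^ alo) =O_ ((0 : R)^'+) theta)
  (theta_up : theta =O_ ((0 : R)^'+) (fun u : R => `|ln u| `^ aup)).

Lemma theta_up_near : exists C d : R, [/\ 0 < C, 0 < d &
  forall u, 0 < u -> u < d -> theta u <= C * `|ln u| `^ aup].
Proof.
have /eqO_exP[C C0 [d /= d0 hd]] := theta_up.
exists C, d; split => // u u0 ud.
have := hd u; rewrite /ball/= sub0r normrN gtr0_norm// => /(_ ud u0).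
rewrite [`|_ `^ _|]ger0_norm ?powR_ge0//.
by apply: le_trans; exact: ler_norm.
Qed.

Lemma theta_ge0 u : 0 < u -> 0 <= theta u.
Proof.
by move=> u0; have := psi_ge0 u; rewrite psi_theta// pmulr_rge0// exprn_gt0.
Qed.

Lemma theta_lo_near : exists C d : R, [/\ 0 < C, 0 < d &
  forall u, 0 < u -> u < d -> `|ln u| `^ alo <= C * theta u].
Proof.
have /eqO_exP[C C0 [d /= d0 hd]] := theta_lo.
exists C, d; split => // u u0 ud.
have := hd u; rewrite /ball/= sub0r normrN gtr0_norm// => /(_ ud u0).
by rewrite ger0_norm ?powR_ge0// (ger0_norm (theta_ge0 u0)).
Qed.

Lemma powR_le_factorial (m : nat) (a y : R) : a <= m%:R -> 1 <= y ->
  y `^ a <= m`!%:R * expR y.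
Proof.
move=> am y1; apply: (le_trans (y := y `^ m%:R)); first by rewrite ler_powR.
by rewrite powR_mulrn ?exprn_le_expR// (le_trans ler01).
Qed.

(** Convexity between -1 and a small u > 0 gives psi 0 <= u psi(-1) + psi u. Moreover psi u is of
    order u, since a power of |ln u| is at most a constant times 1 / u; m! is the constant of y^m <=
    m! e^y at y = -ln u. *)
Lemma psi_at0 : psi 0 = 0.
Proof.
apply/eqP; rewrite eq_le psi_ge0 andbT; apply/ler_addgt0Pr => e e0; rewrite add0r.
have [C [d [C0 d0 hd]]] := theta_up_near.
pose m := `|Num.ceil aup|%N.
have am : aup <= m%:R.
  by rewrite (le_trans (ceil_ge _))// natr_absz ler_int ler_norm.
pose K := psi (-1) + C * m`!%:R.
have K0 : 0 <= K by rewrite addr_ge0// mulr_ge0 ?ler0n// ltW.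
pose u := Num.min (Num.min (d / 2) (expR (-1))) (e / (K + 1)).
have K1 : 0 < K + 1 by rewrite ltr_wpDl.
have u0 : 0 < u by rewrite !lt_min expR_gt0 !divr_gt0.
have ud : u < d by rewrite !gt_min; have := d0; lra.
have ue : u <= expR (-1) by rewrite !ge_min lexx orbT.
have uK : u * (K + 1) <= e by rewrite -ler_pdivlMr// ge_min lexx orbT.
have lnu : 1 <= - ln u.
  by rewrite lerNr -[leRHS]expRK ler_ln ?posrE ?expR_gt0.
have u1 : u <= 1 by rewrite (le_trans ue)// -expR0 ler_expR.
have pu : psi u <= C * m`!%:R * u.
  rewrite psi_theta// (le_trans (ler_wpM2l _ (hd u u0 ud))) ?exprn_ge0 ?(ltW u0)//.
  rewrite ltr0_norm; last by rewrite -oppr_gt0 (lt_le_trans ltr01).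
  rewrite (le_trans (ler_wpM2l _ (ler_wpM2l _ (powR_le_factorial am lnu))))//.
  - by rewrite exprn_ge0// ltW.
  - exact: ltW.
  rewrite expRN lnK ?posrE//.
  rewrite le_eqVlt; apply/orP; left; apply/eqP; field; by rewrite gt_eqF.
have t0 : 0 <= u / (1 + u) by rewrite divr_ge0 ?addr_ge0// ltW.
have t1 : u / (1 + u) <= 1 by rewrite ler_pdivrMr ?addr_gt0// mul1r lerDr.
have := psi_line (-1) u t0 t1.
have -> : u / (1 + u) * -1 + (1 - u / (1 + u)) * u = 0.
  by field; rewrite gt_eqF// addr_gt0.
move=> /le_trans; apply; apply: le_trans uK.
have h1 : u / (1 + u) * psi (-1) <= u * psi (-1).
  by rewrite ler_wpM2r// ler_pdivrMr ?addr_gt0// ler_peMr ?lerDl// ?(ltW u0).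
have h2 : (1 - u / (1 + u)) * psi u <= C * m`!%:R * u.
  by rewrite (le_trans _ pu)// ler_piMl// lerBlDr lerDl.
rewrite (le_trans (lerD h1 h2))// /K.
by move: (C * m`!%:R) (psi (-1)) u0 => A B; lra.
Qed.

Variables (q : R) (q1 : 1 < q).
Local Notation th := (scaled_psi psi q).
Local Notation c := (grid q).

Lemma scaled_psi_theta k : th k = theta (c k).
Proof.
rewrite /scaled_psi psi_theta ?grid_gt0// /grid mul2n -addnn exprD.
have : 0 < q ^+ k by rewrite exprn_gt0// (lt_trans _ q1).
by move=> h; field; rewrite gt_eqF.
Qed.

Lemma ln_grid k : `|ln (c k)| = k%:R * ln q.
Proof.
have q0 : 0 < q by rewrite (lt_trans _ q1).
rewrite /grid lnV ?posrE ?exprn_gt0// lnXn// normrN -[ln q *+ k]mulr_natl.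
by rewrite ger0_norm// mulr_ge0// ln_ge0// ltW.
Qed.

Lemma grid_small (d : R) : 0 < d -> exists k0 : nat, forall k, (k0 <= k)%N -> c k < d.
Proof.
move=> d0.
have := cvg_expr (z := q^-1).
have q0 : 0 < q by rewrite (lt_trans _ q1).
have qV : `|q^-1| < 1 by rewrite gtr0_norm ?invr_gt0// invf_lt1.
move=> /(_ qV) /cvgrPdist_lt /(_ d d0)[k0 _ h]; exists k0 => k kk.
have := h k kk; rewrite sub0r normrN exprVn; apply: le_lt_trans; exact: ler_norm.
Qed.

(** At q^-k the logarithm is k ln q. The maximum with 0 makes the bound nondecreasing in k, and the
    finitely many k at which q^-k is not yet small go into the constant. *)
Lemma scaled_psi_le_powR : exists2 C : R, 0 < C &
  forall k, th k <= C * k.+1%:R `^ (Num.max aup 0).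
Proof.
have [C [d [C0 d0 hd]]] := theta_up_near.
have [k0 hk] := grid_small d0.
have lq : 0 < ln q by rewrite ln_gt0.
pose C1 := C * (ln q) `^ aup.
have C10 : 0 <= C1 by rewrite mulr_ge0 ?powR_ge0// ltW.
pose S := \sum_(i < k0.+1) th i.
have S0 : 0 <= S by apply: sumr_ge0 => i _; exact: scaled_psi_ge0.
exists (C1 + S + 1); first by rewrite ltr_wpDl// addr_ge0.
move=> k.
have k1 : 1 <= k.+1%:R `^ (Num.max aup 0).
  rewrite -[leLHS](powRr0 (k.+1%:R : R)) ler_powR//; last by rewrite le_max lexx orbT.
  by rewrite ler1n.
have [kk0|k0k] := ltnP k k0.+1.
  have h : th k <= S.
    rewrite /S (bigD1 (Ordinal kk0))//= lerDl sumr_ge0// => i _.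
    exact: scaled_psi_ge0.
  rewrite (le_trans h)//.
  rewrite (@le_trans _ _ (C1 + S + 1))//; first by have := C10; lra.
  by rewrite ler_peMr// addr_ge0// addr_ge0.
have kpos : 1 <= k%:R :> R by rewrite ler1n (leq_ltn_trans _ k0k).
have h : th k <= C1 * k%:R `^ aup.
  rewrite scaled_psi_theta (le_trans (hd _ (grid_gt0 q1 k) (hk _ (ltnW k0k))))//.
  by rewrite ln_grid powRM ?ler0n ?(ltW lq)// /C1 mulrA [C * _ * _]mulrAC.
have h2 : k%:R `^ aup <= k.+1%:R `^ (Num.max aup 0).
  apply: (@le_trans _ _ (k%:R `^ (Num.max aup 0))).
    by rewrite ler_powR// le_max lexx.
  by rewrite ge0_ler_powR ?nnegrE// ?le_max ?lexx ?orbT// ler_nat leqnSn.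
rewrite (le_trans h)// (le_trans (ler_wpM2l C10 h2))// ler_wpM2r ?powR_ge0//.
by have := S0; lra.
Qed.

(** Keep the upper half of the sum: there k and n are comparable, so k^alo >= [e] n^alo whatever the
    sign of [alo], and at least n / 4 terms remain. *)
Lemma wsum_scaled_psi_ge_powR : exists2 c0 : R, 0 < c0 &
  exists n0 : nat, forall n, (n0 <= n)%N -> c0 * n%:R `^ (alo + 1) <= wsum th n.
Proof.
have [C [d [C0 d0 hd]]] := theta_lo_near.
have [k0 hk] := grid_small d0.
have lq : 0 < ln q by rewrite ln_gt0.
pose e : R := Num.min 1 (2^-1 `^ alo).
have e0 : 0 < e by rewrite lt_min ltr01 powR_gt0.
pose c1 := (ln q) `^ alo / C * e.
have c10 : 0 < c1 by rewrite mulr_gt0// divr_gt0// powR_gt0.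
exists (c1 / 4); first by rewrite divr_gt0.
exists (4 * k0.+1)%N => n nn.
have n0 : (0 < n)%N by lia.
have npos : 0 < n%:R :> R by rewrite ltr0n.
have term k : (uphalf n <= k)%N -> (k < n)%N -> c1 * n%:R `^ alo <= th k.
  move=> nk kn; rewrite scaled_psi_theta.
  have kp : 0 < k%:R :> R by rewrite ltr0n; lia.
  have kn2 : 2^-1 * n%:R <= k%:R :> R.
    by rewrite mulrC ler_pdivrMr// -natrM ler_nat; lia.
  have kk0 : (k0 <= k)%N by lia.
  have := hd _ (grid_gt0 q1 k) (hk k kk0).
  rewrite ln_grid powRM ?(ltW kp) ?(ltW lq)//= => h.
  have h2 : e * n%:R `^ alo <= k%:R `^ alo.
    have [a0|a0] := leP 0 alo.
      rewrite (@le_trans _ _ (2^-1 `^ alo * n%:R `^ alo))//.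
        by rewrite ler_wpM2r ?powR_ge0// ge_min lexx orbT.
      by rewrite -powRM// ge0_ler_powR// ?nnegrE ?mulr_ge0// ltW.
    rewrite (@le_trans _ _ (n%:R `^ alo))//.
      by rewrite ler_piMl ?powR_ge0// ge_min lexx.
    rewrite -[alo]opprK !(powRN _ (- alo)) lef_pV2 ?posrE ?powR_gt0//.
    have a0' : 0 <= - alo by rewrite oppr_ge0 ltW.
    have kn' : k%:R <= n%:R :> R by rewrite ler_nat ltnW.
    by apply: (ge0_ler_powR a0') kn'; rewrite nnegrE ler0n.
  rewrite /c1 -mulrA (le_trans (ler_wpM2l _ h2)) ?divr_ge0 ?powR_ge0 ?(ltW C0)//.
  by rewrite mulrAC ler_pdivrMr// mulrC (le_trans h)// mulrC.
rewrite /wsum -(big_mkord xpredT th) (@big_cat_nat _ _ _ (uphalf n))//=; last by lia.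
apply: (@le_trans _ _ (\sum_(uphalf n <= i < n) (c1 * n%:R `^ alo))); last first.
  rewrite -[leLHS]add0r lerD//; first by apply: sumr_ge0 => i _; exact: scaled_psi_ge0.
  by rewrite !big_nat; apply: ler_sum => i /andP[]; exact: term.
rewrite sumr_const_nat -[_ *+ (n - _)]mulr_natr powRD; last by rewrite (gt_eqF npos) implybT.
rewrite powRr1 ?ler0n//.
rewrite (_ : c1 / 4 * _ = c1 * n%:R `^ alo * (n%:R / 4)); last by ring.
rewrite ler_wpM2l//; first by rewrite mulr_ge0 ?powR_ge0// (ltW c10).
by rewrite ler_pdivrMr// -natrM ler_nat; lia.
Qed.

End growth.

Section power_growth.
Context {R : realType}.
Variables (th : nat -> R) (C c0 beta kappa : R) (n0 : nat).
Hypotheses (th_ge0 : forall k, 0 <= th k) (C0 : 0 < C) (c00 : 0 < c0)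
  (beta0 : 0 <= beta) (bk : beta < kappa)
  (th_le : forall k, th k <= C * k.+1%:R `^ beta)
  (A_ge : forall n, (n0 <= n)%N -> c0 * n%:R `^ kappa <= wsum th n).
Local Notation A := (wsum th).

Let kappa0 : 0 < kappa. Proof. exact: le_lt_trans bk. Qed.

Lemma powR_unbounded (g : R) : 0 < g -> forall M : R, exists N : nat,
  forall n, (N <= n)%N -> M <= n%:R `^ g.
Proof.
move=> g0 M; pose x := (Num.max 1 M) `^ g^-1.
have M1 : 0 < Num.max 1 M by rewrite lt_max ltr01.
exists (`|Num.ceil x|%N) => n xn.
have xn' : x <= n%:R.
  rewrite (le_trans (ceil_ge _))//.
  by rewrite (le_trans (ler_norm _))// -intr_norm -natr_absz ler_nat.
have x0 : 0 <= x by exact: powR_ge0.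
rewrite (@le_trans _ _ (x `^ g))//; last first.
  by apply: (ge0_ler_powR (ltW g0)) xn'; rewrite nnegrE// ler0n.
rewrite /x -powRrM mulVf ?gt_eqF// powRr1 ?(ltW M1)//.
by rewrite le_max lexx orbT.
Qed.

Lemma wsum_unbounded (M : R) : exists N : nat, forall n, (N <= n)%N -> M <= A n.
Proof.
have [N hN] := powR_unbounded kappa0 (M / c0).
exists (maxn n0 N) => n; rewrite geq_max => /andP[h1 h2].
by apply: le_trans (A_ge h1); rewrite mulrC -ler_pdivrMr// hN.
Qed.

Lemma power_negligible (m : nat) (K e : R) : 0 <= K -> 0 < e ->
  exists N : nat, forall n, (N <= n)%N -> K * (n + m)%:R `^ beta <= e * A n.
Proof.
move=> K0 e0; have kb : 0 < kappa - beta by rewrite subr_gt0.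
pose D := K * m.+1%:R `^ beta.
have D0 : 0 <= D by rewrite mulr_ge0 ?powR_ge0.
have [N hN] := powR_unbounded kb (D / (e * c0)).
exists (maxn 1 (maxn n0 N)) => n; rewrite !geq_max => /andP[n1 /andP[h1 h2]].
have nm : (n + m)%:R <= n%:R * m.+1%:R :> R.
  by rewrite -natrM ler_nat mulnS leq_add2l leq_pmull.
have h3 : (n + m)%:R `^ beta <= n%:R `^ beta * m.+1%:R `^ beta.
  rewrite -powRM ?ler0n//.
  by apply: (ge0_ler_powR beta0) nm; rewrite nnegrE ?mulr_ge0 ?ler0n.
apply: (@le_trans _ _ (e * (c0 * n%:R `^ kappa))); last first.
  by rewrite ler_wpM2l ?(ltW e0)// A_ge.
apply: (le_trans (ler_wpM2l K0 h3)).
have -> : kappa = (kappa - beta) + beta by ring.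
rewrite powRD; last by rewrite pnatr_eq0 -lt0n n1 implybT.
have := hN _ h2; rewrite ler_pdivrMr ?mulr_gt0// => h4.
have p0 : 0 <= n%:R `^ beta :> R by exact: powR_ge0.
rewrite (_ : K * _ = D * n%:R `^ beta); last by rewrite /D; ring.
rewrite (_ : e * _ = (n%:R `^ (kappa - beta) * (e * c0)) * n%:R `^ beta); last by ring.
by rewrite ler_wpM2r.
Qed.

Lemma scaled_negligible (m : nat) (K e : R) : 0 <= K -> 0 < e ->
  exists N : nat, forall n, (N <= n)%N -> K * th (n + m) <= e * A n.
Proof.
move=> K0 e0; have KC : 0 <= K * C by rewrite mulr_ge0// ltW.
have [N hN] := power_negligible m.+1 KC e0.
exists N => n /hN; apply: le_trans; rewrite -mulrA ler_wpM2l//.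
by rewrite addnS th_le.
Qed.

Lemma wsumS n : A n.+1 = A n + th n.
Proof. by rewrite /wsum big_ord_recr. Qed.

Lemma wsum_le m n : (m <= n)%N -> A m <= A n.
Proof.
elim: n => [|n ih]; first by rewrite leqn0 => /eqP ->.
rewrite leq_eqVlt => /predU1P[->//|]; rewrite ltnS => /ih h.
by rewrite wsumS (le_trans h)// lerDl.
Qed.

Lemma wsum_shift (m : nat) (e : R) : 0 < e ->
  exists N : nat, forall n, (N <= n)%N -> A (n + m) <= (1 + e) * A n.
Proof.
elim: m e => [|m ih] e e0.
  exists 0%N => n _; rewrite addn0 mulrDl mul1r lerDl mulr_ge0 ?(ltW e0)//.
  by rewrite /wsum sumr_ge0.
have e2 : 0 < e / 2 by rewrite divr_gt0.
have [N1 h1] := ih _ e2; have [N2 h2] := scaled_negligible m ler01 e2.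
exists (maxn N1 N2) => n; rewrite geq_max => /andP[/h1 g1 /h2 g2].
by rewrite addnS wsumS; have := g1; have := g2; lra.
Qed.

(** n^beta is (n^kappa)^(beta/kappa), hence at most a constant times B^(beta/kappa); the gain is g =
    1 - beta / kappa. Adding [th] to [a] yields weights whose sums are known to grow. *)
Lemma weights_slln_rate (a : nat -> R) (K : R) : 0 <= K -> (forall i, 0 <= a i) ->
  (forall i, a i <= K * i.+1%:R `^ beta) ->
  exists g D n1, [/\ 0 < g, 0 <= D & forall n i, (n1 <= n)%N -> (i < n)%N ->
    (a i + th i) * wsum (fun i => a i + th i) n `^ g
      <= D * wsum (fun i => a i + th i) n].
Proof.
move=> K0 a0 aK; pose b i := a i + th i.
pose g := 1 - beta / kappa.
have g0 : 0 < g by rewrite subr_gt0 ltr_pdivrMr// mul1r.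
pose D := (K + C) * (c0^-1) `^ (beta / kappa).
have KC : 0 <= K + C by rewrite addr_ge0// ltW.
exists g, D, (maxn 1 n0); split => //; first by rewrite mulr_ge0 ?powR_ge0.
move=> n i; rewrite geq_max => /andP[n1 nn0] iN; rewrite -/b.
have AB : A n <= wsum b n by apply: ler_sum => j _; rewrite lerDr.
have npos : 0 < n%:R :> R by rewrite ltr0n.
have B0 : 0 < wsum b n.
  by rewrite (lt_le_trans _ AB)// (lt_le_trans _ (A_ge nn0))// mulr_gt0// powR_gt0.
have bi : b i <= (K + C) * n%:R `^ beta.
  rewrite (@le_trans _ _ ((K + C) * i.+1%:R `^ beta))//.
    by rewrite mulrDl lerD.
  rewrite ler_wpM2l//.
  by apply: (ge0_ler_powR beta0); rewrite ?nnegrE ?ler0n ?ler_nat.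
have nB : n%:R `^ beta <= (c0^-1) `^ (beta / kappa) * wsum b n `^ (beta / kappa).
  rewrite -powRM ?invr_ge0 ?(ltW c00) ?(ltW B0)//.
  have -> : n%:R `^ beta = (n%:R `^ kappa) `^ (beta / kappa) :> R.
    by rewrite -powRrM mulrCA mulfV ?mulr1// gt_eqF.
  have bk0 : 0 <= beta / kappa by rewrite divr_ge0// ltW.
  apply: (ge0_ler_powR bk0); rewrite ?nnegrE ?powR_ge0 ?mulr_ge0 ?invr_ge0 ?(ltW c00) ?(ltW B0)//.
  by rewrite mulrC ler_pdivlMr// mulrC (le_trans (A_ge nn0)).
apply: (@le_trans _ _ ((K + C) * ((c0^-1) `^ (beta / kappa) * wsum b n `^ (beta / kappa))
    * wsum b n `^ g)).
  by rewrite ler_wpM2r ?powR_ge0// (le_trans bi)// ler_wpM2l.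
rewrite -!mulrA -powRD; last by rewrite (gt_eqF B0) implybT.
have -> : beta / kappa + g = 1 by rewrite /g; ring.
by rewrite powRr1 ?(ltW B0)// /D mulrA.
Qed.

End power_growth.

(** * Majorants of a path *)

Section lipschitz.
Context {R : realType}.

Lemma lipschitz_AC (T L : R) (h : R -> R) : 0 <= L ->
  (forall x y, 0 <= x -> x <= y -> `|h y - h x| <= L * (y - x)) -> Defs.AC T h.
Proof.
move=> L0 hL e e0; have L1 : 0 < L + 1 by rewrite ltr_wpDl.
exists (e / (L + 1)); first by rewrite divr_gt0.
move=> n a b ab _ hd.
apply: (@le_lt_trans _ _ (L * \sum_(i < n) (b i - a i))).
  by rewrite mulr_sumr; apply: ler_sum => i _; have [a0 aib _] := ab i; exact: hL.
have S0 : 0 <= \sum_(i < n) (b i - a i).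
  by apply: sumr_ge0 => i _; have [_ aib _] := ab i; rewrite subr_ge0.
move: hd; rewrite ltr_pdivlMr//; set S := \sum_(_ < _) _ in S0 *.
by move=> hS; apply: le_lt_trans hS; rewrite mulrC ler_wpM2l// lerDl.
Qed.

Import HBNNSimple.

(** Counterpart of [lower_integral_ge] for bounds from above: a simple function below f is below G
    off a finite, hence null, set. *)
Lemma integral_le_off_finite (T : R) (f G : R -> R) (s : seq R) :
  measurable_fun setT G -> (forall x, 0 <= f x) -> (forall x, 0 <= G x) ->
  (forall x, 0 <= x -> x <= T -> x \notin s -> f x <= G x) ->
  (\int[@lebesgue_measure R]_(x in `[0%R, T]) (f x)%:E <=
   \int[@lebesgue_measure R]_(x in `[0%R, T]) (G x)%:E)%E.
Proof.
move=> mG f0 G0 fG; pose lam := @lebesgue_measure R.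
pose N : set (measurableTypeR R) := [set` s].
have mN : measurable N.
  rewrite (_ : N = \bigcup_(x in [set` s]) [set x]); last first.
    by apply/seteqP; split => [x xs|x [y ys ->]//]; exists x.
  by apply: fin_bigcup_measurable => // x _; exact: measurable_set1.
have N0 : lam N = 0%E.
  by apply: countable_lebesgue_measure0; apply: finite_set_countable; exact: finite_seq.
have mD : measurable (`[0%R, T]%classic : set (measurableTypeR R)).
  exact: measurable_itv.
rewrite integral_mkcond [leRHS]integral_mkcond.
have r0 (k : R -> R) : (forall x, 0 <= k x) ->
    forall x, (0 <= ((EFin \o k) \_ `[0%R, T]) x)%E.
  by move=> k0 x; apply: erestrict_ge0 => y _; rewrite lee_fin.
have mG' : measurable_fun setT ((EFin \o G) \_ `[0%R, T] : measurableTypeR R -> \bar R).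
  apply/(measurable_restrictT _ _).1 => //.
  by apply/measurable_EFinP; exact: measurable_funTS.
rewrite ge0_integralTE; last exact: r0.
apply: ge_ereal_sup => _ [k kf <-]; rewrite -integralT_nnsfun.
have mk : measurable_fun setT (fun x => (k x)%:E).
  exact/measurable_EFinP.
rewrite (ge0_negligible_integral mN measurableT mk _ N0); last first.
  by move=> x _; rewrite lee_fin.
rewrite [leRHS](ge0_negligible_integral mN measurableT mG' _ N0); last first.
  by move=> x _; exact: r0.
have mC : measurable (setT `\` N) by exact: measurableD.
apply: ge0_le_integral => //.
- by move=> x _; rewrite lee_fin.
- exact: (measurable_funTS mk).
- exact: (measurable_funTS mG').
move=> x [_ Nx]; apply: le_trans (kf x) _; rewrite !patchE; case: ifPn => //.
rewrite inE/= in_itv/= => /andP[x0 xT]; rewrite lee_fin fG//.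
by apply/negP => xs; apply: Nx.
Qed.

End lipschitz.

Section lines.
Context {R : realType}.
Variables (psi w : R -> R) (T r : R) (n : nat) (u b : nat -> R).
Hypotheses (psi_ge0 : forall v, 0 <= psi v)
  (psi_nd : forall x y : R, 0 <= x -> x <= y -> psi x <= psi y)
  (T0 : 0 < T) (u_gt0 : forall i, (i <= n)%N -> 0 < u i)
  (u_dec : forall i j, (i < j)%N -> (j <= n)%N -> u j < u i)
  (b0 : b 0%N = r) (b_nd : forall i j, (i <= j)%N -> (j <= n)%N -> b i <= b j)
  (b_convex : forall i j, (j <= i)%N -> (i < n)%N ->
     (b i.+1 - b j) * (u i - u i.+1) <= (b i.+1 - b i) * (u j - u i.+1))
  (w_le : forall i t, (i <= n)%N -> 0 <= t -> t <= T -> w t <= b i + u i * t).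

Let line (i : nat) (t : R) := b i + u i * t.
Let active (t : R) : 'I_n.+1 := [arg min_(i < ord0) line i t]%O.
Let h (t : R) := line (active t) t.

Let h_le (i : 'I_n.+1) t : h t <= line i t.
Proof.
rewrite /h /active; case: (arg_minP (fun i : 'I_n.+1 => line i t) (erefl true : xpredT ord0)).
by move=> j _; apply.
Qed.

Let u_le0 (i : 'I_n.+1) : u i <= u 0%N.
Proof.
case: i => -[|i] //= ilt; apply: ltW; apply: u_dec => //.
Qed.

(** The line active at t lies above the envelope at s, so h s - h t is at most its slope times s -
    t; exchanging s and t gives a Lipschitz bound by the steepest slope. *)
Let hAC : Defs.AC T h.
Proof.
have u00 : 0 <= u 0%N by rewrite ltW// u_gt0.
apply: (@lipschitz_AC R T (u 0%N) h u00) => x y x0 xy.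
have H (s t : R) : h s - h t <= u (active t) * (s - t).
  have := h_le (active t) s; rewrite /h {2}/line /line; lra.
have uge (i : 'I_n.+1) : 0 <= u i by rewrite ltW// u_gt0// -ltnS.
have d : 0 <= y - x by rewrite subr_ge0.
have := H x y; have := H y x.
have := ler_wpM2r d (u_le0 (active x)); have := ler_wpM2r d (u_le0 (active y)).
have := mulr_ge0 (uge (active x)) d; have := mulr_ge0 (uge (active y)) d.
rewrite ler_norml => *; apply/andP; split; lra.
Qed.

Let crossings : seq R :=
  [seq (b j - b i) / (u i - u j) | i <- iota 0 n.+1, j <- iota 0 n.+1].

(** The time at which lines i and i+1 cross. *)
Let sigma i := (b i.+1 - b i) / (u i - u i.+1).

Let strict t (i : 'I_n.+1) : t \notin crossings -> i != active t ->
  line (active t) t < line i t.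
Proof.
move=> tc ia; rewrite lt_neqAle h_le andbT; apply: contra tc => /eqP E.
apply/allpairsP; exists (val i, val (active t)).
have mi (k : 'I_n.+1) : val k \in iota 0 n.+1 by rewrite mem_iota add0n ltn_ord.
split; [exact: mi|exact: mi|].
have une : u i != u (active t).
  have [il|il|/val_inj il] := ltngtP (val i) (val (active t)).
  - by rewrite gt_eqF// u_dec// -ltnS.
  - by rewrite lt_eqF// u_dec// -ltnS.
  - by rewrite il eqxx in ia.
apply: (mulIf (x := u i - u (active t))); first by rewrite subr_eq0.
rewrite divfK ?subr_eq0//.
by move: E; rewrite /line; lra.
Qed.

Let h_derive t : t \notin crossings -> derive1 h t = u (active t).
Proof.
move=> tc; rewrite derive1E.
have line_cts (i : nat) : {for t, continuous (line i)}.
  by apply: cvgD; [exact: cvg_cst|apply: cvgM; [exact: cvg_cst|exact: cvg_id]].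
have -> : 'D_1 h t = 'D_1 (line (active t)) t.
  apply: near_eq_derive.
  have : \forall x \near t, forall i : 'I_n.+1,
      i != active t -> line (active t) x < line i x.
    apply: (@filter_forall _ _
      (fun i x => i != active t -> line (active t) x < line i x) (nbhs t)) => i.
    have [->|ia] := eqVneq i (active t); first exact: nearW.
    have lt0 : line (active t) t < line i t by exact: strict.
    have : (line (active t) - line i) t < 0 by rewrite !fctE subr_lt0.
    move=> lt1; near=> x => _; rewrite -subr_lt0.
    near: x; apply: cvgr_lt lt1.
    by apply: cvgB; exact: line_cts.
  apply: filterS => x hx; rewrite /h; have [->//|ax] := eqVneq (active x) (active t).
  by have := hx _ ax; rewrite ltNge h_le.
rewrite /line; set a := active t.
have dl : is_derive t 1 (fun s : R => b a + u a * s) (u a).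
  rewrite [X in is_derive _ _ _ X](_ : _ = 0 + u a *: 1); first exact: is_deriveD.
  by rewrite add0r /GRing.scale/= mulr1.
exact: derive_val.
Unshelve. all: by end_near. Qed.

Let drop i := psi (u i) - psi (u i.+1).

Let drop_ge0 i : (i < n)%N -> 0 <= drop i.
Proof.
move=> iN; rewrite subr_ge0 psi_nd//; first by rewrite ltW// u_gt0.
by rewrite ltW// u_dec.
Qed.

Let G (t : R) := psi (u n) + \sum_(0 <= i < n) drop i * \1_(`[0, sigma i]) t.

Let sigma_ge0 i : (i < n)%N -> 0 <= sigma i.
Proof.
move=> iN; rewrite divr_ge0 ?subr_ge0 ?b_nd//.
by rewrite ltW// u_dec.
Qed.

(** If line j is lowest at t, convexity of the intercepts places t before the crossings sigma i for
    all i >= j. The drops from j on are then all present and telescope to psi (u j) - psi (u n). *)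
Let psi_active t : 0 <= t -> psi (u (active t)) <= G t.
Proof.
move=> t0; set j := active t.
have jn : (j <= n)%N by rewrite -ltnS.
rewrite /G (@big_cat_nat _ _ _ (val j))//=.
have tele : \sum_(j <= i < n) drop i = psi (u j) - psi (u n).
  rewrite -[RHS]opprB -(telescope_sumr (fun i => psi (u i)))// -sumrN.
  by apply: eq_bigr => i _; rewrite opprB.
have -> : psi (u j) = psi (u n) + \sum_(j <= i < n) drop i by rewrite tele; ring.
rewrite lerD2l -[leLHS]add0r lerD//.
  rewrite big_nat; apply: sumr_ge0 => i /andP[_ ij].
  by rewrite mulr_ge0// drop_ge0// (leq_trans ij).
rewrite !big_nat; apply: ler_sum => i /andP[ji iN].
rewrite indicE mem_set ?mulr1//= in_itv/= t0/=.
have iN' : (i.+1 < n.+1)%N by [].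
have ui : 0 < u i - u i.+1 by rewrite subr_gt0 u_dec.
have uj : 0 < u j - u i.+1 by rewrite subr_gt0 u_dec.
have := h_le (Ordinal iN') t; rewrite /h -/j /line/= => hl.
have := b_convex ji iN => bc; rewrite ler_pdivlMr//.
rewrite -(ler_pM2r uj) (le_trans _ bc)// mulrAC ler_pM2r//.
by move: hl; lra.
Qed.

(* The lower envelope of the lines b_i + u_i t has slope u_j exactly where the
   j-th line is lowest; summation by parts gives its energy. *)
Lemma min_energy_lines : (min_energy psi w T r <=
  (psi (u n) * T + \sum_(0 <= i < n) (psi (u i) - psi (u i.+1)) *
    ((b i.+1 - b i) / (u i - u i.+1)))%:E)%E.
Proof.
have h0 : h 0 = r.
  apply/eqP; rewrite eq_le -{1}b0; apply/andP; split.
    by have := h_le ord0 0; rewrite /line mulr0 addr0.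
  by rewrite /h /line mulr0 addr0 -b0 b_nd// -ltnS.
have hw t : 0 <= t <= T -> w t <= h t.
  by move=> /andP[t0 tT]; rewrite /h /line w_le// -ltnS.
apply: (@le_trans _ _ (energy psi T h)).
  by apply: ereal_inf_lbound; exists h.
have mI i : measurable_fun setT (\1_(`[0, sigma i]) : R -> R).
  exact: measurable_indic.
have mG : measurable_fun setT G.
  rewrite /G; apply: measurable_funD => //.
  under eq_fun do rewrite big_mkord.
  by apply: measurable_sum => i; exact: measurable_funM.
have G0 t : 0 <= G t.
  rewrite addr_ge0// big_nat; apply: sumr_ge0 => i /andP[_ iN].
  by rewrite mulr_ge0// drop_ge0.
rewrite /energy; apply: (@le_trans _ _
    (\int[@lebesgue_measure R]_(x in `[0%R, T]) (G x)%:E)%E).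
  apply: (@integral_le_off_finite R T _ G crossings) => //= x x0 xT xc.
  by rewrite h_derive// psi_active.
have mD : measurable (`[0%R, T]%classic : set (measurableTypeR R)).
  exact: measurable_itv.
have E (t : R) : (G t)%:E = ((psi (u n))%:E +
    \sum_(i < n) (drop i)%:E * (\1_(`[0, sigma i]) t)%:E)%E.
  by rewrite /G big_mkord EFinD -sumEFin.
under eq_integral do rewrite E.
have mI' i : measurable_fun (`[0%R, T]%classic : set (measurableTypeR R))
    (fun t => (drop i)%:E * (\1_(`[0, sigma i]) t)%:E)%E.
  by apply/measurable_EFinP; apply: measurable_funM => //; exact: (measurable_funTS (mI i)).
have I0 (i : 'I_n) t : (0 <= (drop i)%:E * (\1_(`[0, sigma i]) t)%:E)%E.
  by rewrite mule_ge0// lee_fin drop_ge0.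
rewrite ge0_integralD//=; last 3 first.
- by move=> x _; rewrite lee_fin.
- by move=> x _; exact: sume_ge0.
- by apply: emeasurable_sum => i; exact: mI'.
rewrite integral_cst//= [X in (_ * X)%E](lebesgue_measure_itv `[0, T])/= lte_fin T0 sube0.
rewrite ge0_integral_sum//.
rewrite EFinD EFinM; apply: leeD => //.
rewrite big_mkord -sumEFin; apply: lee_sum => i _.
rewrite ge0_integralZl//=; last 2 first.
- by apply/measurable_EFinP; exact: (measurable_funTS (mI i)).
- by rewrite lee_fin drop_ge0.
rewrite EFinM lee_wpmul2l ?lee_fin ?drop_ge0//.
have mS : measurable (`[0, sigma i]%classic : set (measurableTypeR R)).
  exact: measurable_itv.
rewrite integral_indic//.
apply: (@le_trans _ _ (@lebesgue_measure R `[0, sigma i])).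
  by apply: le_measure; rewrite ?inE//; exact: measurableI.
rewrite [leLHS](lebesgue_measure_itv `[0, sigma i])/= lte_fin.
by case: ifP => _; rewrite ?sube0// lee_fin sigma_ge0.
Qed.

End lines.

Lemma abel_summation (R : realType) (sg Q : nat -> R) n :
  \sum_(j < n) (sg j - sg j.+1) * Q j + sg n * Q n =
  sg 0%N * Q 0%N + \sum_(j < n) sg j.+1 * (Q j.+1 - Q j).
Proof.
elim: n => [|n ih]; first by rewrite !big_ord0 add0r addr0.
rewrite !big_ord_recr/= [RHS]addrA -ih.
ring.
Qed.

Lemma abel_summation_diff (R : realType) (sg Q : nat -> R) n :
  \sum_(j < n) sg j * (Q j.+1 - Q j) =
  \sum_(j < n) (sg j - sg j.+1) * Q j.+1 + sg n * Q n - sg 0%N * Q 0%N.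
Proof.
elim: n => [|n ih]; first by rewrite !big_ord0 add0r subrr.
by rewrite !big_ord_recr/= ih; ring.
Qed.

(** * Chaining a path over geometric blocks *)

Section path_chaining.
Context {R : realType}.
Variables (q : R) (w : R -> R) (Dst : R) (D : nat -> R).
Hypotheses (q1 : 1 < q) (D0 : forall i, 0 <= D i).
Local Notation tau i := (q ^+ (2 * i)%N).
Hypotheses (w01 : forall t, 0 <= t -> t <= 1 -> w t <= Dst)
  (w_block : forall i t, tau i <= t -> t <= tau i.+1 -> w t - w (tau i) <= D i).

Let q0 : 0 < q. Proof. exact: lt_trans q1. Qed.

Lemma tau_le i j : (i <= j)%N -> tau i <= tau j.
Proof. by move=> ij; rewrite ler_weXn2l ?(ltW q1)// leq_pmul2l. Qed.

Lemma tau_gt0 i : 0 < tau i.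
Proof. by rewrite exprn_gt0. Qed.

Lemma tauS i : tau i.+1 = q ^+ 2 * tau i.
Proof. by rewrite mulnS exprD. Qed.

Lemma tau_block a n t : (a < n)%N -> tau a <= t -> t <= tau n ->
  exists m, [/\ (a <= m)%N, (m < n)%N, tau m <= t & t <= tau m.+1].
Proof.
elim: n => // n ih; rewrite ltnS => an ta tn.
have [tn'|tn'] := leP t (tau n); last by exists n; split => //; exact: ltW.
have [aEn|an'] := eqVneq a n; first by exists n; split => //; rewrite -aEn.
have [|m [am mn tm1 tm2]] := ih _ ta tn'; first by rewrite ltn_neqAle an' an.
by exists m; split => //; exact: ltnW.
Qed.

Lemma chain_le a m : (a <= m)%N ->
  w (tau m) <= w (tau a) + \sum_(a <= i < m) D i.
Proof.
elim: m => [|m ih]; first by rewrite leqn0 => /eqP ->; rewrite big_geq// addr0.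
rewrite leq_eqVlt => /predU1P[<-|]; first by rewrite big_geq// addr0.
rewrite ltnS => am; rewrite big_nat_recr//= addrA.
have := w_block (tau_le (leqnSn m)) (lexx _); have := ih am; lra.
Qed.

Lemma chain_sup n t : 0 <= t -> t <= tau n -> w t <= Dst + \sum_(i < n) D i.
Proof.
move=> t0 tn; have tau0 : tau 0 = 1 by rewrite muln0 expr0.
have S0 : 0 <= \sum_(i < n) D i by exact: sumr_ge0.
have [t1|t1] := leP t 1.
  by rewrite (le_trans (w01 t0 t1))// lerDl.
have n0 : (0 < n)%N.
  by case: n tn S0 => // tn _; have := lt_le_trans t1 tn; rewrite tau0 ltxx.
have [|m [_ mn tm1 tm2]] := @tau_block 0 n t n0 _ tn; first by rewrite tau0 ltW.
have h1 : w (tau 0) <= Dst by rewrite tau0; apply: w01.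
have h2 := chain_le (leq0n m); have h3 := w_block tm1 tm2.
have h4 : \sum_(0 <= i < m.+1) D i <= \sum_(i < n) D i.
  rewrite -(big_mkord xpredT D) (@big_cat_nat _ _ _ m.+1 0 n)//= lerDl.
  exact: sumr_ge0.
rewrite big_nat_recr//= in h4.
by move: h1 h2 h3 h4; lra.
Qed.

(** The constant is the ratio of the two sides at m = a + 1, the worst case. It lets the drift
    accumulated since tau a be shared out among the blocks in proportion to their starting times. *)
Lemma tau_sum_le a m : (a < m)%N ->
  (q ^+ 2 - 1) / (q ^+ 2 + 1) * (\sum_(a <= i < m.+1) tau i) <= tau m - tau a.
Proof.
have qq : 0 < q ^+ 2 + 1 by rewrite addr_gt0// exprn_gt0.
have q21 : 0 < q ^+ 2 - 1 by rewrite subr_gt0 exprn_egt1.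
elim: m => // m ih; rewrite ltnS leq_eqVlt => /predU1P[->|am].
  rewrite big_nat_recr//= big_nat1 tauS le_eqVlt; apply/orP; left; apply/eqP.
  by field; rewrite gt_eqF.
have := ih am; rewrite [X in _ -> _ * X <= _]big_nat_recr//=; last by exact: ltnW (ltnW _).
rewrite mulrDr tauS => h.
have : (q ^+ 2 - 1) / (q ^+ 2 + 1) * (q ^+ 2 * tau m) <= q ^+ 2 * tau m - tau m.
  rewrite (_ : q ^+ 2 * tau m - tau m = (q ^+ 2 - 1) / (q ^+ 2 + 1) * ((q ^+ 2 + 1) * tau m)); last first.
    by field; rewrite gt_eqF.
  rewrite ler_wpM2l ?divr_ge0 ?(ltW q21) ?(ltW qq)// ler_wpM2r ?(ltW (tau_gt0 _))//.
  by rewrite lerDl.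
by move: h; lra.
Qed.

Variables (p : nat) (V : nat -> R) (X : nat -> nat -> R).
Hypotheses (V0 : forall j, 0 <= V j) (X0 : forall j i, 0 <= X j i)
  (w_window : forall j t, tau j <= t -> t <= tau (j + 2 * p).+1 ->
     w t - w (tau j) - grid q (j + p) * (t - tau j) <= q ^+ (j + p) * V j)
  (D_le : forall j i, (j + 2 * p <= i)%N ->
     D i - (q ^+ 2 - 1) / (q ^+ 2 + 1) * grid q (j + p) * tau i <= X j i).

(** Up to tau j the oscillations D are chained without using the drift; inside the window [V j] is
    the bound; beyond it each block has to beat its own share of the drift, and [X j i] bounds the
    excess. *)
Lemma drifted_sup j n t : 0 <= t -> t <= tau n ->
  w t - grid q (j + p) * t <= Dst + \sum_(i < j) D i + q ^+ (j + p) * V j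
    + \sum_(j + 2 * p <= i < n) X j i.
Proof.
move=> t0 tn; have c0 := grid_gt0 q1 (j + p).
have S0 : 0 <= \sum_(j + 2 * p <= i < n) X j i by exact: sumr_ge0.
have qV : 0 <= q ^+ (j + p) * V j by rewrite mulr_ge0// exprn_ge0// ltW.
have ct : 0 <= grid q (j + p) * t by rewrite mulr_ge0// ltW.
have [tj|tj] := leP t (tau j).
  by have := chain_sup t0 tj; lra.
have base := chain_sup (ltW (tau_gt0 j)) (lexx _).
have cj : 0 <= grid q (j + p) * tau j by rewrite mulr_ge0// ltW// tau_gt0.
have [tm|tm] := leP t (tau (j + 2 * p).+1).
  by have := w_window (ltW tj) tm; lra.
have an : ((j + 2 * p).+1 < n)%N.
  rewrite ltnNge; apply/negP => na; have := lt_le_trans tm (le_trans tn (tau_le na)).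
  by rewrite ltxx.
have [m [am mn tm1 tm2]] := tau_block an (ltW tm) tn.
set a := (j + 2 * p)%N in an am S0 *.
have h1 := chain_le (ltnW am); have h2 := w_block tm1 tm2.
have h3 : w (tau a) - w (tau j) - grid q (j + p) * (tau a - tau j) <= q ^+ (j + p) * V j.
  by apply: w_window; apply: tau_le; rewrite /a ?leq_addr// leqnSn.
have h4 := tau_sum_le am.
have h5 : \sum_(a <= i < m.+1) (D i - (q ^+ 2 - 1) / (q ^+ 2 + 1) * grid q (j + p) * tau i)
    <= \sum_(a <= i < n) X j i.
  rewrite (@big_cat_nat _ _ _ m.+1 a n)//=; last by rewrite ltnW// ltnW.
  rewrite -[leLHS]addr0 lerD//; last exact: sumr_ge0.
  by rewrite !big_nat; apply: ler_sum => i /andP[ai _]; exact: D_le.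
rewrite big_split/= sumrN -mulr_sumr in h5.
rewrite big_nat_recr//= in h5; last exact: ltnW.
have h6 : grid q (j + p) * ((q ^+ 2 - 1) / (q ^+ 2 + 1) * \sum_(a <= i < m.+1) tau i)
    <= grid q (j + p) * (tau m - tau a) by rewrite ler_wpM2l// ltW.
have h7 : grid q (j + p) * tau m <= grid q (j + p) * t by rewrite ler_wpM2l// ltW.
rewrite mulrA [grid q (j + p) * (_ / _)]mulrC in h6.
by move: h1 h2 h3 h5 h6 h7 base cj; lra.
Qed.

End path_chaining.

Section envelope.
Context {R : realType}.
Variables (w : R -> R) (T r M : R).
Hypotheses (T0 : 0 < T) (w_le : forall t, 0 <= t -> t <= T -> w t <= M).

(** The least intercept, not below r, of a line of slope c above the path on [0, T]. *)
Definition intercept (c : R) : R :=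
  Num.max r (sup [set w t - c * t | t in `[0, T]]).

Let sup_bound c y : 0 <= c -> (forall t, 0 <= t -> t <= T -> w t - c * t <= y) ->
  sup [set w t - c * t | t in `[0, T]] <= y.
Proof.
move=> c0 h; apply: ge_sup.
  by exists (w 0 - c * 0), 0 => //=; rewrite in_itv/= lexx ltW.
by move=> _ [t /= + <-]; rewrite in_itv/= => /andP[t0 tT]; exact: h.
Qed.

Lemma intercept_ge c t : 0 <= c -> 0 <= t -> t <= T -> w t <= intercept c + c * t.
Proof.
move=> c0 t0 tT; rewrite -lerBlDr /intercept le_max; apply/orP; right.
apply: ub_le_sup; last by exists t => //=; rewrite in_itv/= t0.
exists M => _ [s /= + <-]; rewrite in_itv/= => /andP[s0 sT].
by rewrite (le_trans _ (w_le s0 sT))// lerBlDr lerDl mulr_ge0.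
Qed.

Lemma intercept_ge_start c : r <= intercept c.
Proof. by rewrite le_max lexx. Qed.

Lemma intercept_le c y : 0 <= c -> r <= y ->
  (forall t, 0 <= t -> t <= T -> w t <= y + c * t) -> intercept c <= y.
Proof.
move=> c0 ry h; rewrite ge_max ry/=; apply: sup_bound => // t t0 tT.
by rewrite lerBlDr h.
Qed.

Lemma intercept_nonincreasing c c' : 0 <= c -> c <= c' -> intercept c' <= intercept c.
Proof.
move=> c0 cc; apply: intercept_le.
- exact: le_trans cc.
- exact: intercept_ge_start.
move=> t t0 tT; rewrite (le_trans (intercept_ge c0 t0 tT))// lerD2l ler_wpM2r//.
Qed.

(** A convex combination of two lines above the path is again above it, and its intercept is the
    same combination. *)
Lemma intercept_convex c1 c2 c3 : 0 <= c3 -> c3 < c2 -> c2 <= c1 ->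
  (intercept c3 - intercept c1) * (c2 - c3) <= (intercept c3 - intercept c2) * (c1 - c3).
Proof.
move=> c30 c32 c21; have c13 : 0 < c1 - c3 by rewrite subr_gt0 (lt_le_trans c32).
pose y := (intercept c3 * (c1 - c2) + intercept c1 * (c2 - c3)) / (c1 - c3).
have c20 : 0 <= c2 by rewrite ltW// (le_lt_trans c30).
suff h : intercept c2 <= y by move: h; rewrite /y ler_pdivlMr//; lra.
have d1 : 0 <= c1 - c2 by rewrite subr_ge0.
have d2 : 0 <= c2 - c3 by rewrite subr_ge0 ltW.
apply: intercept_le => //.
  rewrite ler_pdivlMr//.
  have := ler_wpM2r d1 (intercept_ge_start c3).
  have := ler_wpM2r d2 (intercept_ge_start c1); lra.
move=> t t0 tT; rewrite -lerBlDr ler_pdivlMr//.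
have := ler_wpM2r d1 (intercept_ge c30 t0 tT).
have := ler_wpM2r d2 (intercept_ge (le_trans c20 c21) t0 tT); lra.
Qed.

End envelope.

(** * Energy bounds for a single path *)

Section upper_path.
Context {R : realType}.
Variables (psi : R -> R) (q : R).
Hypotheses (psi_ge0 : forall u, 0 <= psi u)
  (psi_line : forall t x y : R, 0 <= t -> t <= 1 ->
     psi (t * x + (1 - t) * y) <= t * psi x + (1 - t) * psi y)
  (psi0 : psi 0 = 0) (q1 : 1 < q).
Variables (w : R -> R) (r Dst C0 v0 K1 K3 : R) (p : nat) (D V G : nat -> R).
Local Notation tau i := (q ^+ (2 * i)%N).
Local Notation s := (chord_slope psi q).
Local Notation om := (chord_weight psi q).
Hypotheses (D0 : forall i, 0 <= D i) (V0 : forall i, 0 <= V i) (G0 : forall i, 0 <= G i)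
  (K30 : 0 <= K3)
  (w01 : forall t, 0 <= t -> t <= 1 -> w t <= Dst)
  (w_block : forall i t, tau i <= t -> t <= tau i.+1 -> w t - w (tau i) <= D i)
  (w_window : forall j t, tau j <= t -> t <= tau (j + 2 * p).+1 ->
     w t - w (tau j) - grid q (j + p) * (t - tau j) <= q ^+ (j + p) * V j)
  (D_G : forall i, D i <= q ^+ i * (K1 * G i))
  (D_le : forall j i, (j + 2 * p <= i)%N ->
     D i - (q ^+ 2 - 1) / (q ^+ 2 + 1) * grid q (j + p) * tau i
       <= K3 * (q ^+ (2 * (j + p)) * grid q i) * G i)
  (r0 : 0 <= r) (Dst0 : 0 <= Dst) (rC0 : r <= C0) (v0_gt : grid q p < v0)
  (w_C0 : forall t, 0 <= t -> w t <= C0 + grid q p * t)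
  (w_v0 : forall t, 0 <= t -> w t <= r + v0 * t).

(** Coefficient of block i collected from the tails beyond the earlier windows; the index j stands
    for window j + 1. *)
Definition remote_weight (i : nat) : R :=
  \sum_(j < i - 2 * p) om (j + p) * q ^+ (j + p).+1 * grid q i.

(** The first term comes from chaining before the windows, after summation by parts; the second from
    the tails after them. *)
Definition path_weight (i : nat) : R := K1 * (s (i + p) * q ^+ i) + K3 * remote_weight i.

(** The majorant is the envelope of lines of slopes v0, c p, ..., c (p + K) with their least
    intercepts. The line of slope v0 has intercept exactly r and makes the envelope start there. The
    last slope is charged on the whole of [0, T], which gives the first summand. *)
Lemma min_energy_upper (K : nat) (T : R) : tau K <= T -> T <= tau K.+1 ->
  (min_energy psi w T r <= (psi (grid q (K + p)) * tau K.+1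
    + (psi v0 / (v0 - grid q p) * C0 + s p * (r + Dst))
    + (\sum_(j < K) om (j + p) * V j.+1 + \sum_(i < K.+1) path_weight i * G i))%:E)%E.
Proof.
move=> KT TK; have q0 : 0 < q by exact: lt_trans q1.
have T0 : 0 < T by rewrite (lt_le_trans _ KT)// exprn_gt0.
have psi_nd := convex_nondecreasing psi_ge0 psi_line psi0.
have s_ge0 := chord_slope_ge0 psi_ge0 psi_line psi0 q1.
have s_dec k : 0 <= s k - s k.+1 by rewrite subr_ge0 chord_slopeS_le.
have c0 := grid_gt0 q1.
have v00 : 0 < v0 by exact: lt_trans v0_gt.
pose M := Dst + \sum_(i < K.+1) D i.
have wM t : 0 <= t -> t <= T -> w t <= M.
  by move=> t0 tT; apply: (chain_sup q1 D0 w01 w_block t0); exact: le_trans TK.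
pose u i := if i is j.+1 then grid q (j + p) else v0.
pose b := intercept w T r.
have u0 i : 0 < u i by case: i => [|j]; [exact: v00|exact: c0].
have uS i : u i.+1 < u i.
  by case: i => [|i] //=; rewrite addSn; exact: gridS_lt.
have u_dec i j : (i < j)%N -> u j < u i.
  elim: j => // j ih; rewrite ltnS leq_eqVlt => /predU1P[->//|/ih].
  exact: lt_trans.
have b_ge c t : 0 <= c -> 0 <= t -> t <= T -> w t <= b c + c * t.
  exact: (intercept_ge r wM).
have b_nd c c' : 0 <= c -> c <= c' -> b c' <= b c.
  exact: (intercept_nonincreasing r T0 wM).
have b0r : b v0 = r.
  apply/eqP; rewrite eq_le intercept_ge_start andbT.
  by apply: (intercept_le T0) => //; [exact: ltW|move=> t t0 _; exact: w_v0].
have := @min_energy_lines R psi w T r K.+1 u (fun i => b (u i)) psi_ge0 psi_nd T0.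
have -> : psi (u K.+1) * T + \sum_(0 <= i < K.+1) (psi (u i) - psi (u i.+1)) *
    ((b (u i.+1) - b (u i)) / (u i - u i.+1)) = psi (grid q (K + p)) * T +
    ((psi v0 - psi (grid q p)) / (v0 - grid q p) * (b (grid q p) - r) +
     \sum_(j < K) s (j + p) * (b (grid q (j.+1 + p)) - b (grid q (j + p)))).
  rewrite big_mkord big_ord_recl/= b0r; congr (_ + (_ + _)).
    by rewrite mulrCA mulrC.
  by apply: eq_bigr => i _; rewrite /bump/= add1n /chord_slope addSn mulrCA mulrC.
move=> H; apply: (le_trans (H _ _ _ _ _ _)) => //.
- by move=> i j ij _; exact: u_dec.
- move=> i j; rewrite leq_eqVlt => /predU1P[->//|ij] _; apply: b_nd; first exact: ltW.
  by rewrite ltW// u_dec.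
- move=> i j ji iK; apply: (intercept_convex r T0 wM); [exact: ltW|exact: uS|].
  by move: ji; rewrite leq_eqVlt => /predU1P[->//|ji]; rewrite ltW// u_dec.
- by move=> i t _ t0 tT; apply: b_ge => //; exact: ltW.
rewrite lee_fin; pose B j := b (grid q (j + p)).
have psT : psi (grid q (K + p)) * T <= psi (grid q (K + p)) * tau K.+1.
  by rewrite ler_wpM2l.
have bp : b (grid q p) <= C0.
  by apply: (intercept_le T0) => //; [exact: ltW|move=> t t0 _; exact: w_C0].
have first_piece : (psi v0 - psi (grid q p)) / (v0 - grid q p) * (b (grid q p) - r) <=
    psi v0 / (v0 - grid q p) * C0.
  have d0 : 0 < (v0 - grid q p)^-1 by rewrite invr_gt0 subr_gt0.
  have br : 0 <= b (grid q p) - r by rewrite subr_ge0; exact: intercept_ge_start.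
  apply: ler_pM => //.
  - by rewrite mulr_ge0 ?(ltW d0)// subr_ge0 psi_nd// ltW.
  - by rewrite ler_wpM2r ?(ltW d0)// lerBlDr lerDl.
  - by rewrite (le_trans _ bp)// lerBlDr lerDl.
(* The chaining bound of the path up to tau (j + 1). Summation by parts turns its slope differences
   into the sum of the D i with weights s (i + p). *)
pose Q j := r + Dst + \sum_(i < j.+1) D i.
pose sg j := s (j + p).
have D_sum : \sum_(j < K) (sg j - sg j.+1) * Q j + sg K * Q K =
    s p * (r + Dst) + \sum_(i < K.+1) s (i + p) * D i.
  rewrite abel_summation /sg /Q big_ord_recl big_ord0/= big_ord_recl/=.
  rewrite add0n mulrDr addr0 -addrA; congr (_ + (_ + _)); apply: eq_bigr => i _.
  by rewrite /bump/= add1n big_ord_recr/=; congr (_ * _); ring.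
have BK : B K <= Q K.
  apply: (intercept_le T0); first exact: ltW.
    by rewrite /Q -addrA lerDl addr_ge0// sumr_ge0.
  move=> t t0 tT; rewrite (le_trans (wM t t0 tT))// /M /Q -!addrA.
  rewrite -[leLHS]add0r lerD// addrA lerDl mulr_ge0// ltW//.
have Bj j : B j.+1 <= Q j + q ^+ (j.+1 + p) * V j.+1 +
    \sum_(j.+1 + 2 * p <= i < K.+1) K3 * (q ^+ (2 * (j.+1 + p)) * grid q i) * G i.
  have X0 j' i : 0 <= K3 * (q ^+ (2 * (j' + p)) * grid q i) * G i.
    by rewrite !mulr_ge0// ?exprn_ge0// ltW.
  have S0 : 0 <= \sum_(j.+1 + 2 * p <= i < K.+1) K3 * (q ^+ (2 * (j.+1 + p)) * grid q i) * G i.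
    by apply: sumr_ge0 => i _; exact: X0.
  have qV : 0 <= q ^+ (j.+1 + p) * V j.+1 by rewrite mulr_ge0// exprn_ge0// ltW.
  apply: (intercept_le T0); first exact: ltW.
    have : 0 <= \sum_(i < j.+1) D i by apply: sumr_ge0.
    by rewrite /Q; move: Dst0; lra.
  move=> t t0 tT; rewrite -lerBlDr.
  have := @drifted_sup R q w Dst D q1 D0 w01 w_block p V
    (fun j i => K3 * (q ^+ (2 * (j + p)) * grid q i) * G i) V0 X0 w_window D_le
    j.+1 K.+1 t t0 (le_trans tT TK).
  by move/le_trans; apply; rewrite /Q; move: r0; lra.
have rest : \sum_(j < K) s (j + p) * (b (grid q (j.+1 + p)) - b (grid q (j + p))) <=
    s p * (r + Dst) + (\sum_(j < K) om (j + p) * V j.+1 +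
      \sum_(i < K.+1) path_weight i * G i).
  rewrite (abel_summation_diff sg B).
  have sB : 0 <= sg 0%N * B 0%N.
    by rewrite mulr_ge0 ?s_ge0// (le_trans r0)// intercept_ge_start.
  pose Xs j := \sum_(j.+1 + 2 * p <= i < K.+1)
    K3 * (q ^+ (2 * (j.+1 + p)) * grid q i) * G i.
  have step1 : \sum_(j < K) (sg j - sg j.+1) * B j.+1 <=
      \sum_(j < K) ((sg j - sg j.+1) * Q j + om (j + p) * V j.+1
        + (sg j - sg j.+1) * Xs j).
    apply: ler_sum => j _.
    have -> : om (j + p) * V j.+1 = (sg j - sg j.+1) * (q ^+ (j.+1 + p) * V j.+1).
      by rewrite /chord_weight /sg !addSn; ring.
    by rewrite -!mulrDr ler_wpM2l// s_dec.
  have step2 : sg K * B K <= sg K * Q K by rewrite ler_wpM2l ?s_ge0.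
  have step3 : \sum_(i < K.+1) s (i + p) * D i <=
      \sum_(i < K.+1) (K1 * (s (i + p) * q ^+ i)) * G i.
    apply: ler_sum => i _.
    rewrite (_ : _ * G i = s (i + p) * (q ^+ i * (K1 * G i))); last by ring.
    by rewrite ler_wpM2l ?s_ge0.
  (* Exchange of summation: block i collects from the j with j + 1 + 2 p <= i, that is j < i - 2
     p. *)
  have step4 : \sum_(j < K) (sg j - sg j.+1) * Xs j =
      \sum_(i < K.+1) (K3 * remote_weight i) * G i.
    rewrite /Xs; under eq_bigr => j _ do rewrite big_geq_mkord mulr_sumr.
    rewrite (exchange_big_dep xpredT)//=; apply: eq_bigr => i _.
    have iK : (i - 2 * p <= K)%N.
      by rewrite (leq_trans (leq_subr _ _))// -ltnS.
    rewrite /remote_weight (big_ord_widen K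
      (fun j => om (j + p) * q ^+ (j + p).+1 * grid q i) iK).
    rewrite mulr_sumr mulr_suml; apply: eq_big => [j|j _].
      by rewrite ltn_subRL (addnC (2 * p)%N).
    have -> : tau (j.+1 + p) = q ^+ (j + p).+1 * q ^+ (j + p).+1.
      by rewrite addSn mul2n -addnn exprD.
    by rewrite /chord_weight /sg addSn; ring.
  rewrite !big_split/= in step1.
  have E : \sum_(i < K.+1) path_weight i * G i =
    \sum_(i < K.+1) (K1 * (s (i + p) * q ^+ i)) * G i +
    \sum_(i < K.+1) (K3 * remote_weight i) * G i.
    by rewrite -big_split/=; apply: eq_bigr => i _; rewrite /path_weight mulrDl.
  by rewrite E; move: step1 step2 step3 step4 D_sum sB; lra.
by move: psT first_piece rest; lra.
Qed.

End upper_path.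

Section lower_path.
Context {R : realType}.
Variables (psi : R -> R) (q : R).
Hypotheses (psi_ge0 : forall u, 0 <= psi u)
  (psi_line : forall t x y : R, 0 <= t -> t <= 1 ->
     psi (t * x + (1 - t) * y) <= t * psi x + (1 - t) * psi y)
  (psi0 : psi 0 = 0) (q1 : 1 < q).
Variables (w : R -> R) (r Dst K1 : R) (p : nat) (D V G : nat -> R).
Local Notation tau i := (q ^+ (2 * i)%N).
Local Notation s := (chord_slope psi q).
Local Notation om := (chord_weight psi q).
Hypotheses (D0 : forall i, 0 <= D i)
  (w01 : forall t, 0 <= t -> t <= 1 -> - w t <= Dst)
  (w_block : forall i t, tau i <= t -> t <= tau i.+1 -> - w t - - w (tau i) <= D i)
  (w_window : forall j e, 0 < e -> exists t, [/\ tau j <= t, t <= tau (j + 2 * p).+1 &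
     q ^+ (j + p) * (V j - e) <= w t - w (tau j) - grid q (j + p) * (t - tau j)])
  (D_G : forall i, D i <= q ^+ i * (K1 * G i)) (G0 : forall i, 0 <= G i) (K10 : 0 <= K1)
  (r0 : 0 <= r) (Dst0 : 0 <= Dst).

(** Near-maximizers of the windows are the test times of [energy_ge]; all windows j < n end by tau
    (n + 2 p) <= T. A window measures increments from tau j instead of 0, which costs the downward
    oscillation before tau j; this is why the D i bound -w. *)
Lemma min_energy_lower (n : nat) (T : R) : tau (n + 2 * p) <= T ->
  ((q^-1 * \sum_(j < n) om (j + p) * (V j - 2 * grid q (2 * p))
    - s p * (r + Dst) - \sum_(i < n) (K1 * (s (i + p) * q ^+ i)) * G i)%:E
   <= min_energy psi w T r)%E.
Proof.
move=> nT; have q0 : 0 < q by exact: lt_trans q1.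
have T0 : 0 < T by rewrite (lt_le_trans _ nT)// exprn_gt0.
have s_ge0 := chord_slope_ge0 psi_ge0 psi_line psi0 q1.
have s_dec k : 0 <= s k - s k.+1 by rewrite subr_ge0 chord_slopeS_le.
have c0 := grid_gt0 q1.
apply: le_ereal_inf_tmp => _ [h [hAC h0 hw] <-].
(* The precision [grid q (2 * p)] has the size of the other loss: the drift before the window is c j
   tau j = q^(j+p) grid q (2 p). Together they make the factor 2 in the statement. *)
have /choice[t ht] j : exists t, [/\ tau j <= t, t <= tau (j + 2 * p).+1 &
     q ^+ (j + p) * (V j - grid q (2 * p)) <=
     w t - w (tau j) - grid q (j + p) * (t - tau j)] by exact: w_window.
have tT j : (j < n)%N -> 0 <= t j <= T.
  move=> jn; have [t1 t2 _] := ht j; apply/andP; split.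
    by rewrite (le_trans _ t1)// exprn_ge0// ltW.
  by rewrite (le_trans t2)// (le_trans _ nT)// (tau_le q1)// ltn_add2r.
pose sg j := s (j + p).
pose c j := grid q (j + p).
have := @energy_ge R psi T h n (fun j => sg j - sg j.+1) c t T0 hAC psi_ge0
  (fun j _ => s_dec (j + p)) tT.
have chord v : \sum_(k < n) (sg k - sg k.+1) * Num.max 0 (v - c k) <= psi v.
  have := chord_sum_le psi_ge0 psi_line psi0 q1 p (n + p) v.
  by rewrite -{1}[p]add0n big_addn addnK big_mkord.
move=> /(_ chord); apply: le_trans; rewrite lee_fin.
pose Q j := r + Dst + \sum_(i < j) D i.
have Q0 j : 0 <= Q j by rewrite addr_ge0 ?addr_ge0// sumr_ge0.
have term j : (j < n)%N ->
    q ^+ (j + p) * (V j - 2 * grid q (2 * p)) - Q j <= h (t j) - h 0 - c j * t j.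
  move=> jn; have [t1 t2 t3] := ht j.
  have wt := hw _ (tT _ jn).
  have wj : - w (tau j) <= Dst + \sum_(i < j) D i.
    by apply: (chain_sup q1 D0 w01 w_block) => //; rewrite exprn_ge0// ltW.
  have cE : c j * tau j <= q ^+ (j + p) * grid q (2 * p).
    rewrite /c /grid mul2n -addnn mul2n -addnn !exprD le_eqVlt; apply/orP; left; apply/eqP.
    by field; rewrite !gt_eqF// exprn_gt0.
  move: t3; rewrite h0 /Q -/(c j); move: wt wj cE.
  by move: (c j) => cj; lra.
have Q_sum : \sum_(j < n) (sg j - sg j.+1) * Q j <=
    s p * (r + Dst) + \sum_(i < n) (K1 * (s (i + p) * q ^+ i)) * G i.
  have := abel_summation sg Q n.
  rewrite /Q big_ord0 addr0 -/(Q n) => E.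
  have sQ : 0 <= sg n * Q n by rewrite mulr_ge0 ?s_ge0.
  have S : \sum_(j < n) sg j.+1 * (r + Dst + \sum_(i < j.+1) D i - (r + Dst + \sum_(i < j) D i))
      <= \sum_(i < n) (K1 * (s (i + p) * q ^+ i)) * G i.
    apply: ler_sum => i _; rewrite big_ord_recr/=.
    rewrite (_ : _ - _ = D i); last by ring.
    rewrite (_ : K1 * _ * G i = sg i * (q ^+ i * (K1 * G i))); last by rewrite /sg; ring.
    apply: ler_pM => //; first exact: s_ge0.
    by rewrite -subr_ge0 s_dec.
  by move: E S sQ; rewrite /sg add0n; lra.
have main : \sum_(j < n) (sg j - sg j.+1) * (q ^+ (j + p) * (V j - 2 * grid q (2 * p)) - Q j)
    <= \sum_(j < n) (sg j - sg j.+1) * (h (t j) - h 0 - c j * t j).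
  by apply: ler_sum => j _; rewrite ler_wpM2l ?s_dec ?term.
have E : \sum_(j < n) (sg j - sg j.+1) * (q ^+ (j + p) * (V j - 2 * grid q (2 * p)) - Q j)
   = q^-1 * (\sum_(j < n) om (j + p) * (V j - 2 * grid q (2 * p)))
     - \sum_(j < n) (sg j - sg j.+1) * Q j.
  rewrite mulr_sumr -sumrB; apply: eq_bigr => j _.
  by rewrite /chord_weight /sg !addSn exprS; field; rewrite gt_eqF.
by move: main E Q_sum; lra.
Qed.

End lower_path.

Lemma normal_prob_opp (R : realType) (s : R) (B : set R) : 0 < s -> measurable B ->
  normal_prob 0 s (-%R @^-1` B) = normal_prob 0 s B.
Proof.
move=> s0 mB.
have mf : measurable_fun setT (fun x => (normal_pdf 0 s x)%:E).
  by apply/measurable_EFinP; exact: measurable_normal_pdf.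
have f0 x : (0 <= (normal_pdf 0 s x)%:E)%E by rewrite lee_fin normal_pdf_ge0.
have E x : normal_pdf 0 s (- x) = normal_pdf 0 s x.
  by rewrite /normal_pdf (gt_eqF s0) /normal_fun !subr0 sqrrN.
have mopp : measurable_fun setT (-%R : R -> measurableTypeR R).
  exact: oppr_measurable.
rewrite /normal_prob.
have -> : (\int[lebesgue_measure]_(x in (-%R @^-1` B)) (normal_pdf 0 s x)%:E =
    \int[lebesgue_measure]_(x in (-%R @^-1` B)) ((fun y => (normal_pdf 0 s y)%:E) \o -%R) x)%E.
  by apply: eq_integral => x _ /=; rewrite E.
have mopp' : measurable_fun setT (-%R : measurableTypeR R -> measurableTypeR R).
  exact: oppr_measurable.
have mB' : measurable (B : set (measurableTypeR R)) by [].
rewrite -(@ge0_integral_pushforward _ _ (measurableTypeR R) (measurableTypeR R) R _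
  mopp' (@lebesgue_measure R) B (fun x => (normal_pdf 0 s x)%:E))//=; last exact: measurable_funS mf.
by apply: eq_measure_integral => //= A mA AS; exact: lebesgue_measureN.
Qed.

(** * Almost sure asymptotics *)

Section wiener_opp.
Context {R : realType} d (Omega : measurableType d) (P : probability Omega R).
Context (W : R -> {RV P >-> R}) (hW : standard_wiener W).

(** The lower bound needs downward oscillations of W, and these are block suprema of -W. *)
Lemma standard_wiener_opp : standard_wiener (fun t => (- W t)%R : {RV P >-> R}).
Proof.
have oppE t w : (- W t)%R w = - W t w by [].
have incE s t : (fun w => (- W t)%R w - (- W s)%R w) = -%R \o (fun w => W t w - W s w).
  by apply/funext => w; rewrite /= opprD -!oppE.
split.
- by have := wiener_start hW; apply: filterS => w w0; rewrite oppE w0 oppr0.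
- move=> n t t0 tt B mB.
  have mB' (i : 'I_n) : measurable (-%R @^-1` B i).
    rewrite -[X in measurable X]setTI; exact: oppr_measurable.
  have E (i : 'I_n) : (fun w => (- W (t i.+1))%R w - (- W (t i))%R w) @^-1` B i =
      (fun w => W (t i.+1) w - W (t i) w) @^-1` (-%R @^-1` B i).
    by rewrite incE.
  have := wiener_increments_independent hW t0 tt mB'.
  have -> : \bigcap_i ((fun w => (- W (t (i : 'I_n).+1))%R w - (- W (t i))%R w) @^-1` B i) =
      \bigcap_i ((fun w => W (t (i : 'I_n).+1) w - W (t i) w) @^-1` (-%R @^-1` B i)).
    by apply: eq_bigcapr => i _; rewrite E.
  by move=> ->; apply: eq_bigr => i _; rewrite E.
- move=> s t s0 st B mB.
  have mB' : measurable (-%R @^-1` B).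
    rewrite -[X in measurable X]setTI; exact: oppr_measurable.
  rewrite -normal_prob_opp//; last by rewrite sqrtr_gt0 subr_gt0.
  rewrite -(wiener_increments_normal hW s0 st mB') /pushforward; congr (P _).
  by rewrite incE.
- have := wiener_continuous hW; apply: filterS => w cw.
  rewrite (_ : (fun t => _) = (fun t => - W t w))//.
  by move=> x; apply: continuousN; exact: cw.
Qed.

End wiener_opp.

(** * Law of large numbers for windows, and the weights *)

Section slln_power.
Context {R : realType} d (T : measurableType d) (P : probability T R).
Variables (th : nat -> R) (C c0 beta kappa : R) (n0 : nat).
Hypotheses (th_ge0 : forall k, 0 <= th k) (C0 : 0 < C) (c00 : 0 < c0)
  (beta0 : 0 <= beta) (bk : beta < kappa)
  (th_le : forall k, th k <= C * k.+1%:R `^ beta)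
  (A_ge : forall n, (n0 <= n)%N -> c0 * n%:R `^ kappa <= wsum th n).

(** The law of large numbers is applied with the larger weights a + th. Their sums are at most (2 K'
    + 1) A n for large n, since A (n + m) <= 2 A n, so errors can be measured by A n. *)
Lemma slln_power (xi : nat -> T -> R) (C2 K K' : R) (p m : nat) (a : nat -> R) :
  (forall i, measurable_fun setT (xi i)) -> (forall i w, 0 <= xi i w) ->
  (forall i, (\int[P]_w (xi i w ^+ 2)%:E <= C2%:E)%E) ->
  (forall i j, (i + p <= j)%N ->
    (\int[P]_w (xi i w * xi j w)%:E =
     (\int[P]_w (xi i w)%:E) * \int[P]_w (xi j w)%:E)%E) ->
  0 <= K -> 0 <= K' -> (forall i, 0 <= a i) ->
  (forall i, a i <= K * i.+1%:R `^ beta) ->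
  (forall n, wsum a n <= K' * wsum th (n + m)) ->
  {ae P, forall w, forall e, 0 < e -> exists N, forall n, (N <= n)%N ->
    `|\sum_(i < n) a i * xi i w - \sum_(i < n) a i * \int[P]_w xi i w|
      <= e * wsum th n}.
Proof.
move=> mxi xi0 xi2 xiu K0 K'0 a0 aK aA.
have [g [D [n1 [g0 D0 bD]]]] := weights_slln_rate C0 c00 beta0 bk th_le A_ge K0 a0 aK.
have ab i : a i <= a i + th i by rewrite lerDl.
have Boo (M : R) : exists N, forall n, (N <= n)%N -> M <= wsum (fun i => a i + th i) n.
  have [N hN] := wsum_unbounded c00 beta0 bk A_ge M.
  exists N => n Nn; rewrite (le_trans (hN n Nn))//.
  by apply: ler_sum => i _; rewrite lerDr.
have := weighted_slln mxi xi0 xi2 xiu a0 ab g0 D0 bD Boo.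
have [N1 hN1] := wsum_shift th_ge0 C0 c00 beta0 bk th_le A_ge m ltr01.
apply: filterS => w hw e e0.
have L0 : 0 < 2 * K' + 1 by rewrite ltr_wpDl// mulr_ge0.
have [N hN] := hw (e / (2 * K' + 1)) (divr_gt0 e0 L0).
exists (maxn N N1) => n; rewrite geq_max => /andP[Nn N1n].
apply: le_trans (hN n Nn) _.
rewrite mulrAC ler_pdivrMr// -mulrA ler_wpM2l ?(ltW e0)//.
rewrite /wsum big_split/= -!/(wsum _ n) mulrC.
have h1 := hN1 n N1n; have h2 := aA n.
have h3 : K' * wsum th (n + m) <= K' * ((1 + 1) * wsum th n) by rewrite ler_wpM2l.
by move: h2 h3; lra.
Qed.

End slln_power.

Section windows.
Context {R : realType} d (Omega : measurableType d) (P : probability Omega R).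
Context (W : R -> {RV P >-> R}) (hW : standard_wiener W).
Variables (c a b : nat -> R) (p : nat).
Hypotheses (c0 : forall i, 0 < c i) (a0 : forall i, 0 <= a i) (ab : forall i, a i < b i)
  (gap : forall i j, (i + p <= j)%N -> b i <= a j).

Definition window_seq (i : nat) : Omega -> R := window_sup W (c i) (a i) (b i).
(** The half makes the second moment equal to the exponential moment of the window, which is at most
    4. *)
Definition exp_window_seq (i : nat) (w : Omega) : R := expR (window_seq i w / 2).

Lemma measurable_window_seq i : measurable_fun setT (window_seq i).
Proof. exact: measurable_window_sup. Qed.

Lemma measurable_exp_window_seq i : measurable_fun setT (exp_window_seq i).
Proof.
apply: measurableT_comp => //; apply: measurable_funM => //.
exact: measurable_window_seq.
Qed.

Lemma window_seq_ge0 i w : 0 <= window_seq i w.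
Proof. exact: window_sup_ge0. Qed.

Lemma exp_window_seq_ge0 i w : 0 <= exp_window_seq i w.
Proof. exact: expR_ge0. Qed.

Let expW i : (\int[P]_w (expR (window_seq i w))%:E <= 4%:E)%E.
Proof. exact: window_sup_expR_le. Qed.

Let mexp i : measurable_fun setT (fun w => (expR (window_seq i w))%:E).
Proof.
apply/measurable_EFinP; apply: measurableT_comp => //.
exact: measurable_window_seq.
Qed.

Lemma window_seq_second i : (\int[P]_w (window_seq i w ^+ 2)%:E <= 8%:E)%E.
Proof.
apply: (@le_trans _ _ (\int[P]_w (2%:E * (expR (window_seq i w))%:E))%E).
  apply: ge0_le_integral => //.
  - by move=> w _; rewrite lee_fin sqr_ge0.
  - apply/measurable_EFinP; apply: measurable_funX; exact: measurable_window_seq.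
  - exact: measurable_funeM.
  - move=> w _; rewrite -EFinM lee_fin.
    exact: (exprn_le_expR 2 (window_seq_ge0 i w)).
rewrite ge0_integralZl//.
apply: (@le_trans _ _ (2%:E * 4%:E)%E); first by apply: lee_wpmul2l; [rewrite lee_fin|exact: expW].
by rewrite -EFinM lee_fin -natrM.
Qed.

Lemma exp_window_seq_second i : (\int[P]_w (exp_window_seq i w ^+ 2)%:E <= 4%:E)%E.
Proof.
apply: le_trans (expW i); rewrite le_eqVlt; apply/orP; left; apply/eqP.
apply: eq_integral => w _; congr EFin; rewrite /exp_window_seq expr2 -expRD.
by congr expR; lra.
Qed.

Lemma exp_window_seq_mean_le i : (\int[P]_w (exp_window_seq i w)%:E <= 4%:E)%E.
Proof.
apply: le_trans (expW i); apply: ge0_le_integral => //.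
- by move=> w _; rewrite lee_fin expR_ge0.
- apply/measurable_EFinP; exact: measurable_exp_window_seq.
- move=> w _; rewrite lee_fin ler_expR.
  by have := window_seq_ge0 i w; lra.
Qed.

Lemma window_seq_mean_le i : (\int[P]_w (window_seq i w)%:E <= (1 / 2)%:E)%E.
Proof. exact: window_sup_mean_le. Qed.

Let fin_of (f : Omega -> R) (M : R) : (forall w, 0 <= f w) ->
  (\int[P]_w (f w)%:E <= M%:E)%E -> (\int[P]_w (f w)%:E)%E \is a fin_num.
Proof.
move=> f0 fM; rewrite ge0_fin_numE ?(le_lt_trans fM) ?ltry//.
by apply: integral_ge0 => w _; rewrite lee_fin.
Qed.

Lemma window_seq_uncorrelated i j : (i + p <= j)%N ->
  (\int[P]_w (window_seq i w * window_seq j w)%:E =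
   (\int[P]_w (window_seq i w)%:E) * \int[P]_w (window_seq j w)%:E)%E.
Proof.
(* The product formula wants a function that is nonnegative on the whole line; the positive part is
   one, and it fixes the suprema. *)
move=> ij; pose f (x : R) := Num.max 0 x.
have fE k w : f (window_seq k w) = window_seq k w.
  by apply/max_idPr; exact: window_seq_ge0.
have finf k : (\int[P]_w (f (window_seq k w))%:E)%E \is a fin_num.
  under eq_integral do rewrite fE.
  exact: fin_of (window_seq_ge0 k) (window_seq_mean_le k).
have := window_sup_expectationM hW (c0 i) (a0 i) (ab i) (c0 j) (ab j) (gap ij)
  (f := f) _ _ _ _ (finf i) (finf j).
rewrite -!/(window_seq _ _).
have -> : (\int[P]_w (f (window_sup W (c i) (a i) (b i) w) * f (window_sup W (c j) (a j) (b j) w))%:E =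
  \int[P]_w (window_seq i w * window_seq j w)%:E)%E.
  by apply: eq_integral => w _; rewrite -!/(window_seq _ w) !fE.
have -> : (\int[P]_w (f (window_sup W (c i) (a i) (b i) w))%:E = \int[P]_w (window_seq i w)%:E)%E.
  by apply: eq_integral => w _; rewrite -!/(window_seq _ w) fE.
have -> : (\int[P]_w (f (window_sup W (c j) (a j) (b j) w))%:E = \int[P]_w (window_seq j w)%:E)%E.
  by apply: eq_integral => w _; rewrite -!/(window_seq _ w) fE.
apply.
- by move=> x; rewrite le_max lexx.
- by move=> x y xy; rewrite /f ge_max !le_max lexx xy orbT.
- by move=> x; apply: continuous_max; [exact: cst_continuous|exact: id].
- exact: measurable_maxr.
Qed.

Lemma exp_window_seq_uncorrelated i j : (i + p <= j)%N ->
  (\int[P]_w (exp_window_seq i w * exp_window_seq j w)%:E =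
   (\int[P]_w (exp_window_seq i w)%:E) * \int[P]_w (exp_window_seq j w)%:E)%E.
Proof.
move=> ij.
have finf k := fin_of (exp_window_seq_ge0 k) (exp_window_seq_mean_le k).
apply: (window_sup_expectationM hW (c0 i) (a0 i) (ab i) (c0 j) (ab j) (gap ij)
  (f := fun x => expR (x / 2)) _ _ _ _ (finf i) (finf j)).
- by move=> x; exact: expR_ge0.
- by move=> x y xy; rewrite ler_expR; lra.
- move=> x; apply: continuous_comp; last exact: continuous_expR.
  by apply: cvgM; [exact: cvg_id|exact: cvg_cst].
- by apply: measurableT_comp => //; exact: measurable_funM.
Qed.

Lemma Rintegral_window_seq_le i : \int[P]_w window_seq i w <= 1 / 2.
Proof.
rewrite -lee_fin fineK ?window_seq_mean_le//.
exact: fin_of (window_seq_ge0 i) (window_seq_mean_le i).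
Qed.

Lemma Rintegral_window_seq_ge i :
  1 / 2 - 4 / (c i ^+ 2 * (b i - a i)) <= \int[P]_w window_seq i w.
Proof.
rewrite -lee_fin fineK; first exact: window_sup_mean_ge.
exact: fin_of (window_seq_ge0 i) (window_seq_mean_le i).
Qed.

Lemma Rintegral_exp_window_seq_le i : \int[P]_w exp_window_seq i w <= 4.
Proof.
rewrite -lee_fin fineK ?exp_window_seq_mean_le//.
exact: fin_of (exp_window_seq_ge0 i) (exp_window_seq_mean_le i).
Qed.

End windows.

Lemma addn_ltn_mulS j p : (j + p < p.+1 * j.+1)%N.
Proof. by rewrite mulSn mulnS addSn ltnS addnA leq_addr. Qed.

Lemma addn_sub_double_le p i : (2 * p <= i -> p + (i - 2 * p) <= i)%N.
Proof. by move=> h; rewrite addnBA// leq_subLR leq_add2r leq_pmull. Qed.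

Section weights.
Context {R : realType}.
Variables (psi : R -> R) (q : R).
Hypotheses (psi_ge0 : forall u, 0 <= psi u)
  (psi_line : forall t x y : R, 0 <= t -> t <= 1 ->
     psi (t * x + (1 - t) * y) <= t * psi x + (1 - t) * psi y)
  (psi0 : psi 0 = 0) (q1 : 1 < q).
Variables (C beta K1 K3 : R) (p : nat).
Local Notation th := (scaled_psi psi q).
Local Notation s := (chord_slope psi q).
Local Notation om := (chord_weight psi q).
Hypotheses (C0 : 0 < C) (beta0 : 0 <= beta) (K10 : 0 <= K1) (K30 : 0 <= K3)
  (th_le : forall k, th k <= C * k.+1%:R `^ beta).

Let q0 : 0 < q. Proof. exact: lt_trans q1. Qed.
Let q10 : 0 < q - 1. Proof. by rewrite subr_gt0. Qed.
Let s_ge0 := chord_slope_ge0 psi_ge0 psi_line psi0 q1.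
Let om_ge0 := chord_weight_ge0 psi_line q1.
Let om_le := chord_weight_le psi_ge0 psi_line psi0 q1.
Let s_le := chord_slope_le_scaled psi_ge0 q1.
Let c0 := grid_gt0 q1.
Let th0 := scaled_psi_ge0 psi_ge0 q1.

Lemma scaled_psi_shift_le j : th (j + p) <= C * p.+1%:R `^ beta * j.+1%:R `^ beta.
Proof.
rewrite (le_trans (th_le _))// -mulrA ler_wpM2l ?(ltW C0)//.
rewrite -powRM ?ler0n// -natrM.
apply: (ge0_ler_powR beta0); rewrite ?nnegrE ?ler0n// ler_nat.
exact: addn_ltn_mulS.
Qed.

Lemma wsum_shifted_le n : \sum_(j < n) th (j + p) <= wsum th (n + p).
Proof.
rewrite /wsum -(big_mkord xpredT th) -(big_mkord xpredT (fun j => th (j + p))).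
rewrite [leRHS](@big_cat_nat _ _ _ p)//= ?leq_addl//.
have -> : \sum_(p <= i < n + p) th i = \sum_(0 <= j < n) th (j + p).
  by rewrite -{1}[p]add0n big_addn addnK.
by rewrite lerDr sumr_ge0.
Qed.

Lemma chord_weight_shift_le j :
  om (j + p) <= q ^+ 2 / (q - 1) * (C * p.+1%:R `^ beta) * j.+1%:R `^ beta.
Proof.
rewrite (le_trans (om_le _))// -[leRHS]mulrA.
by apply: ler_wpM2l (scaled_psi_shift_le j); rewrite divr_ge0 ?exprn_ge0// ltW.
Qed.

Lemma chord_weight_wsum_le n :
  wsum (fun j => om (j + p)) n <= q ^+ 2 / (q - 1) * wsum th (n + p).
Proof.
apply: (@le_trans _ _ (\sum_(j < n) q ^+ 2 / (q - 1) * th (j + p))).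
  by apply: ler_sum => j _; exact: om_le.
rewrite -mulr_sumr ler_wpM2l ?wsum_shifted_le//.
by rewrite divr_ge0 ?exprn_ge0// ltW.
Qed.

(** The gain q^-p reflects that block i meets only slopes from c (i + p) on, p scales flatter than
    its own. *)
Lemma slope_weight_le i :
  s (i + p) * q ^+ i <= grid q p * (q / (q - 1) * th (i + p)).
Proof.
have -> : s (i + p) * q ^+ i = grid q p * (s (i + p) * q ^+ (i + p)).
  by rewrite exprD; have := gridX q1 p => h; rewrite [RHS]mulrCA [X in _ = _ * X]mulrCA [grid _ _ * _]mulrC h mulr1.
by rewrite ler_wpM2l ?(ltW (c0 _))// s_le.
Qed.

Lemma geometric_tail a n : \sum_(a <= i < n) grid q i <= q / (q - 1) * grid q a.
Proof.
have qq : 0 <= q / (q - 1) by rewrite divr_ge0// ltW.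
have [na|an] := leqP n a; first by rewrite big_geq// mulr_ge0// ltW.
suff : \sum_(a <= i < n) grid q i + (q - 1)^-1 * grid q n.-1 <= q / (q - 1) * grid q a.
  move=> h; apply: le_trans h; rewrite lerDl; apply: mulr_ge0; last exact/ltW/c0.
  by rewrite invr_ge0 ltW.
elim: n an => // n ih; rewrite ltnS leq_eqVlt => /predU1P[<-|an].
  rewrite big_nat1/= le_eqVlt; apply/orP; left; apply/eqP.
  by field; rewrite gt_eqF.
rewrite big_nat_recr/=; last exact: ltnW.
apply: le_trans (ih an); rewrite -addrA lerD2l.
case: n {ih} an => // n _ /=; rewrite gridS.
rewrite le_eqVlt; apply/orP; left; apply/eqP.
by field; rewrite !gt_eqF.
Qed.

Lemma remote_weight_ge0 i : 0 <= remote_weight psi q p i.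
Proof.
apply: sumr_ge0 => j _; apply: mulr_ge0; last exact/ltW/c0.
by apply: mulr_ge0; [exact: om_ge0|exact/exprn_ge0/ltW].
Qed.

(** All weights that occur are at most a constant times (i + 1)^beta, and the increasing geometric
    sum of the q^(j+p+1) is compensated by q^-i. *)
Lemma remote_weight_le i : remote_weight psi q p i <=
  q ^+ 2 / (q - 1) * C * (q / (q - 1)) * i.+1%:R `^ beta.
Proof.
have qq : 0 <= q ^+ 2 / (q - 1) by rewrite divr_ge0 ?exprn_ge0// ltW.
have [i2p|i2p] := leqP i (2 * p).
  rewrite /remote_weight (eqP (_ : i - 2 * p == 0)%N) ?big_ord0; last by rewrite subn_eq0.
  by rewrite !mulr_ge0 ?powR_ge0 ?exprn_ge0 ?invr_ge0 ?(ltW C0) ?(ltW q0) ?(ltW q10).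
pose B := q ^+ 2 / (q - 1) * (C * i.+1%:R `^ beta).
have B0 : 0 <= B.
  by rewrite !mulr_ge0 ?powR_ge0 ?exprn_ge0 ?invr_ge0 ?(ltW C0) ?(ltW q0) ?(ltW q10).
apply: (@le_trans _ _ (\sum_(j < i - 2 * p) B * (q ^+ (j + p).+1 * grid q i))).
  apply: ler_sum => j _; rewrite -mulrA ler_wpM2r//.
    by rewrite mulr_ge0 ?exprn_ge0// ltW.
  rewrite (le_trans (om_le _))// ler_wpM2l// (le_trans (th_le _))//.
  rewrite ler_wpM2l ?(ltW C0)//; apply: (ge0_ler_powR beta0); rewrite ?nnegrE ?ler0n//.
  rewrite ler_nat ltnS addnC (leq_trans _ (addn_sub_double_le (ltnW i2p)))//.
  by rewrite leq_add2l ltnW.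
rewrite -mulr_sumr (_ : q ^+ 2 / _ * _ * _ * _ = B * (q / (q - 1))); last first.
  by rewrite /B; ring.
rewrite ler_wpM2l// -mulr_suml.
have -> : \sum_(j < i - 2 * p) q ^+ (j + p).+1 = q ^+ p.+1 * ((q ^+ (i - 2 * p) - 1) / (q - 1)).
  rewrite subrX1 mulrAC mulfV ?gt_eqF// mul1r mulr_sumr.
  by apply: eq_bigr => j _; rewrite -exprD addSn addnC.
have -> : q ^+ p.+1 * ((q ^+ (i - 2 * p) - 1) / (q - 1)) * grid q i =
    q ^+ p.+1 * (q ^+ (i - 2 * p) - 1) * grid q i / (q - 1) by ring.
rewrite ler_wpM2r ?invr_ge0 ?(ltW q10)//.
apply: (@le_trans _ _ (q ^+ i.+1 * grid q i)); last first.
  by rewrite exprS -mulrA gridX// mulr1.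
rewrite ler_wpM2r ?(ltW (c0 _))//.
apply: (@le_trans _ _ (q ^+ p.+1 * q ^+ (i - 2 * p))).
  by rewrite ler_wpM2l ?exprn_ge0 ?(ltW q0)// lerBlDr lerDl.
rewrite -exprD ler_weXn2l ?(ltW q1)// addSn ltnS.
exact: addn_sub_double_le (ltnW i2p).
Qed.

(** After exchanging the sums, the tail of q^-i from i = j + 1 + 2 p on is geometric, and multiplied
    by q^(j+p+1) it is of order q^-p. *)
Lemma remote_weight_wsum_le n : wsum (remote_weight psi q p) n <=
  grid q p * (q / (q - 1) * (q ^+ 2 / (q - 1))) * wsum th (n + p).
Proof.
have -> : wsum (remote_weight psi q p) n =
    \sum_(j < n) \sum_(j.+1 + 2 * p <= i < n) om (j + p) * q ^+ (j + p).+1 * grid q i.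
  under [RHS]eq_bigr => j _ do rewrite big_geq_mkord.
  rewrite (exchange_big_dep xpredT)//=; apply: eq_bigr => i _.
  have iK : (i - 2 * p <= n)%N by rewrite (leq_trans (leq_subr _ _))// ltnW.
  rewrite /remote_weight (big_ord_widen n
    (fun j => om (j + p) * q ^+ (j + p).+1 * grid q i) iK).
  by apply: eq_bigl => j; rewrite ltn_subRL (addnC (2 * p)%N).
apply: (@le_trans _ _ (\sum_(j < n) grid q p * (q / (q - 1)) * om (j + p))).
  apply: ler_sum => j _; rewrite -mulr_sumr.
  have o0 : 0 <= om (j + p) * q ^+ (j + p).+1.
    by apply: mulr_ge0; [exact: om_ge0|exact/exprn_ge0/ltW].
  rewrite (le_trans (ler_wpM2l o0 (geometric_tail _ _)))//.
  rewrite le_eqVlt; apply/orP; left; apply/eqP.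
  have -> : grid q (j.+1 + 2 * p) = grid q (j + p).+1 * grid q p.
    by rewrite /grid addSn mul2n -addnn addnA -addSn exprD invfM.
  have h := gridX q1 (j + p).+1.
  rewrite (_ : _ * q ^+ _ * _ = om (j + p) * (q / (q - 1)) *
    (q ^+ (j + p).+1 * grid q (j + p).+1) * grid q p); last by ring.
  by rewrite h; ring.
rewrite -mulr_sumr -!mulrA ler_wpM2l ?(ltW (c0 _))// ler_wpM2l ?(ltW q0)//.
rewrite ler_wpM2l ?invr_ge0 ?(ltW q10)// !mulrA.
exact: chord_weight_wsum_le.
Qed.

Local Notation pw := (path_weight psi q K1 K3 p).

Lemma path_weight_ge0 i : 0 <= pw i.
Proof.
apply: addr_ge0; apply: mulr_ge0 => //; last exact: remote_weight_ge0.
by apply: mulr_ge0; [exact: s_ge0|exact/exprn_ge0/ltW].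
Qed.

Definition weight_const : R :=
  K1 * (q / (q - 1)) + K3 * (q / (q - 1) * (q ^+ 2 / (q - 1))).

Lemma slope_weight_wsum_le n : wsum (fun i => s (i + p) * q ^+ i) n <=
  grid q p * (q / (q - 1)) * wsum th (n + p).
Proof.
apply: (@le_trans _ _ (\sum_(i < n) grid q p * (q / (q - 1)) * th (i + p))).
  by apply: ler_sum => i _; rewrite -mulrA; exact: slope_weight_le.
rewrite -mulr_sumr ler_wpM2l ?wsum_shifted_le// mulr_ge0 ?(ltW (c0 _))//.
exact: divr_ge0 (ltW q0) (ltW q10).
Qed.

Lemma path_weight_wsum_le n :
  wsum pw n <= grid q p * weight_const * wsum th (n + p).
Proof.
rewrite /wsum big_split/= -!mulr_sumr -!/(wsum _ n).
have h1 := ler_wpM2l K10 (slope_weight_wsum_le n).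
have h2 := ler_wpM2l K30 (remote_weight_wsum_le n).
apply: (le_trans (lerD h1 h2)); rewrite /weight_const -/(wsum th (n + p)).
by rewrite le_eqVlt; apply/orP; left; apply/eqP; ring.
Qed.

Lemma slope_weight_bound : exists2 K, 0 <= K &
  forall i, s (i + p) * q ^+ i <= K * i.+1%:R `^ beta.
Proof.
have qq : 0 <= q / (q - 1) by rewrite divr_ge0// ltW.
exists (grid q p * (q / (q - 1) * (C * p.+1%:R `^ beta))).
  apply: mulr_ge0; first exact/ltW/c0.
  by apply: mulr_ge0 => //; apply: mulr_ge0; [exact: ltW|exact: powR_ge0].
move=> i; apply: le_trans (slope_weight_le i) _; rewrite -[leRHS]mulrA.
apply: ler_wpM2l; first exact/ltW/c0.
by rewrite -[leRHS]mulrA; apply: ler_wpM2l => //; exact: scaled_psi_shift_le.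
Qed.

Lemma path_weight_bound : exists2 K, 0 <= K & forall i, pw i <= K * i.+1%:R `^ beta.
Proof.
have [K K0 hK] := slope_weight_bound.
exists (K1 * K + K3 * (q ^+ 2 / (q - 1) * C * (q / (q - 1)))).
  apply: addr_ge0; apply: mulr_ge0 => //; apply: mulr_ge0; last exact: divr_ge0 (ltW q0) (ltW q10).
  by apply: mulr_ge0 (ltW C0); apply: divr_ge0 (ltW q10); exact/exprn_ge0/ltW.
move=> i; rewrite mulrDl; apply: lerD.
  by rewrite -[leRHS]mulrA; apply: ler_wpM2l.
by rewrite -[leRHS]mulrA; apply: ler_wpM2l => //; exact: remote_weight_le.
Qed.


End weights.

Section block_bounds.
Context {R : realType}.
Variables (q : R) (q1 : 1 < q).

(** Undoes the scaling of the block supremum at slope q^-i: the size is q^i Z, and q^i (q^2 - 1) is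
    the drift over the block, added back. *)
Definition block_range (Z : nat -> R) (i : nat) : R := q ^+ i * (Z i + (q ^+ 2 - 1)).
(** 2 + (q^2 - 1), from Z <= 2 exp(Z/2) and 1 <= exp(Z/2). *)
Definition block_const : R := q ^+ 2 + 1.
(** 48 = 2^3 * 3!, from x^3 <= 3! e^x at half of Z + (q^2 - 1); the denominator is the squared
    constant of [tau_sum_le]. *)
Definition cubic_const : R :=
  48 * expR ((q ^+ 2 - 1) / 2) / ((q ^+ 2 - 1) / (q ^+ 2 + 1)) ^+ 2.

Let q0 : 0 < q. Proof. exact: lt_trans q1. Qed.
Let q21 : 0 < q ^+ 2 - 1. Proof. by rewrite subr_gt0 exprn_egt1. Qed.
Let q2 : 0 < q ^+ 2 + 1. Proof. by rewrite addr_gt0// exprn_gt0. Qed.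

Lemma block_const_ge0 : 0 <= block_const. Proof. exact: ltW. Qed.

Lemma cubic_const_ge0 : 0 <= cubic_const.
Proof.
apply: divr_ge0; last exact: sqr_ge0.
by apply: mulr_ge0; [rewrite ler0n|exact: expR_ge0].
Qed.

Variables (Z : nat -> R) (Z0 : forall i, 0 <= Z i).

Lemma block_range_ge0 i : 0 <= block_range Z i.
Proof.
apply: mulr_ge0; first exact/exprn_ge0/ltW.
by apply: addr_ge0 => //; exact: ltW.
Qed.

Lemma block_range_le i : block_range Z i <= q ^+ i * (block_const * expR (Z i / 2)).
Proof.
apply: ler_wpM2l; first exact/exprn_ge0/ltW.
have g := expR_ge1Dx (Z i / 2); have g1 := Z0 i.
have h : 0 <= (q ^+ 2 - 1) * (expR (Z i / 2) - 1).
  by apply: mulr_ge0; [exact: ltW|lra].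
by move: h; rewrite /block_const; lra.
Qed.

(** The third power is needed for summability over blocks: with x of size q^i and y of size q^(2i -
    j - p), the bound is q^(2(j + p) - i), whereas x^2 / y would not decrease in i. *)
Lemma positive_part_cubic (x y : R) : 0 <= x -> 0 < y -> x - y <= x ^+ 3 / y ^+ 2.
Proof.
move=> x0 y0; have y2 : 0 < y ^+ 2 by rewrite exprn_gt0.
rewrite ler_pdivlMr//; have [xy|yx] := leP x y.
  apply: (@le_trans _ _ 0); last exact: exprn_ge0.
  by apply: mulr_le0_ge0; [rewrite subr_le0|exact: ltW].
have : y ^+ 2 <= x ^+ 2 by rewrite ler_sqr ?nnegrE ?(ltW y0)// ltW.
move=> h; apply: (@le_trans _ _ (x * y ^+ 2)).
  by apply: ler_wpM2r; [exact: ltW|rewrite lerBlDr lerDl ltW].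
by rewrite exprS; apply: ler_wpM2l.
Qed.

(* x - y <= x^3 / y^2 turns the exponential moments into cubic decay in the
   distance between the block and the window. *)
Lemma block_range_cubic i j p :
  block_range Z i - (q ^+ 2 - 1) / (q ^+ 2 + 1) * grid q (j + p) * q ^+ (2 * i) <=
  cubic_const * (q ^+ (2 * (j + p)) * grid q i) * expR (Z i / 2).
Proof.
set l := (q ^+ 2 - 1) / (q ^+ 2 + 1).
have l0 : 0 < l by exact: divr_gt0.
have qi : 0 < q ^+ i by rewrite exprn_gt0.
have qj : 0 < q ^+ (j + p) by rewrite exprn_gt0.
have y0 : 0 < l * grid q (j + p) * q ^+ (2 * i).
  by apply: mulr_gt0; [apply: mulr_gt0 => //; exact: grid_gt0|rewrite exprn_gt0].
apply: le_trans (positive_part_cubic (block_range_ge0 i) y0) _.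
have X0 : 0 <= (Z i + (q ^+ 2 - 1)) / 2.
  by apply: divr_ge0 => //; apply: addr_ge0 => //; exact: ltW.
have := exprn_le_expR 3 X0.
have -> : expR ((Z i + (q ^+ 2 - 1)) / 2) = expR ((q ^+ 2 - 1) / 2) * expR (Z i / 2).
  by rewrite -expRD; congr expR; ring.
rewrite /cubic_const -/l /block_range => h.
have -> : (q ^+ i * (Z i + (q ^+ 2 - 1))) ^+ 3 / (l * grid q (j + p) * q ^+ (2 * i)) ^+ 2
   = 8 * ((Z i + (q ^+ 2 - 1)) / 2) ^+ 3 * (q ^+ (2 * (j + p)) * grid q i) / l ^+ 2.
  have e1 : q ^+ (2 * i) = q ^+ i * q ^+ i by rewrite mul2n -addnn exprD.
  have e2 : q ^+ (2 * (j + p)) = q ^+ (j + p) * q ^+ (j + p).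
    by rewrite mul2n -addnn exprD.
  rewrite e1 e2 /grid; clear y0; move: (q ^+ i) qi (q ^+ (j + p)) qj l l0 => a' a0 b b0 l' l'0.
  by field; rewrite !gt_eqF.
have -> : 48 * expR ((q ^+ 2 - 1) / 2) / l ^+ 2 * (q ^+ (2 * (j + p)) * grid q i) * expR (Z i / 2)
  = 8 * (6 * (expR ((q ^+ 2 - 1) / 2) * expR (Z i / 2))) * (q ^+ (2 * (j + p)) * grid q i) / l ^+ 2.
  by field; rewrite gt_eqF.
apply: ler_wpM2r; first by rewrite invr_ge0 sqr_ge0.
apply: ler_wpM2r.
  by apply: mulr_ge0; [exact/exprn_ge0/ltW|exact/ltW/grid_gt0].
by apply: ler_wpM2l => //; rewrite (_ : 6 = 3`!%:R).
Qed.

End block_bounds.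

Section windows_of_path.
Context {R : realType} d (Omega : measurableType d) (P : probability Omega R).
Context (W : R -> {RV P >-> R}) (q : R) (p : nat).
Hypothesis q1 : 1 < q.
Local Notation tau i := (q ^+ (2 * i)%N).

(** For slope c (j + p) the natural time is tau (j + p); the window has p blocks before it and p + 1
    after it. *)
Definition wide_window : nat -> Omega -> R :=
  window_seq W (fun j => grid q (j + p)) (fun j => tau j) (fun j => tau (j + 2 * p).+1).
Definition block_window : nat -> Omega -> R :=
  window_seq W (grid q) (fun j => tau j) (fun j => tau j.+1).

Variable w : Omega.
Hypothesis cw : {within `[0, +oo[, continuous (fun t => W t w)}.

Let q0 : 0 < q. Proof. exact: lt_trans q1. Qed.
Let tau0 i : 0 <= tau i. Proof. exact/exprn_ge0/ltW. Qed.
Let tau_lt i j : (i < j)%N -> tau i < tau j.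
Proof. by move=> ij; rewrite ltr_eXn2l// ltn_pmul2l. Qed.

Let window_unscale (c x y V : R) : 0 < c -> c * x - c ^+ 2 * y <= V ->
  x - c * y <= c^-1 * V.
Proof.
by move=> c0 h; rewrite [leRHS]mulrC ler_pdivlMr// (le_trans _ h)//; lra.
Qed.

Lemma wide_window_ge j t : tau j <= t -> t <= tau (j + 2 * p).+1 ->
  W t w - W (tau j) w - grid q (j + p) * (t - tau j) <= q ^+ (j + p) * wide_window j w.
Proof.
move=> t1 t2; have c0 := grid_gt0 q1 (j + p).
have jp : (j < (j + 2 * p).+1)%N by rewrite ltnS leq_addr.
have ttau : tau j <= t <= tau (j + 2 * p).+1 by rewrite t1.
have := window_sup_ge c0 (tau0 j) (tau_lt jp) cw ttau.
by move=> /(window_unscale c0); rewrite /grid invrK.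
Qed.

Lemma wide_window_attained j e : 0 < e ->
  exists t, [/\ tau j <= t, t <= tau (j + 2 * p).+1 &
    q ^+ (j + p) * (wide_window j w - e) <=
      W t w - W (tau j) w - grid q (j + p) * (t - tau j)].
Proof.
move=> e0; have c0 := grid_gt0 q1 (j + p).
have jp : (j < (j + 2 * p).+1)%N by rewrite ltnS leq_addr.
apply: contrapT => /forallNP H.
have : wide_window j w <= wide_window j w - e.
  apply: window_sup_le => //; first exact: tau_lt.
  move=> t /andP[t1 t2]; rewrite leNgt; apply/negP => lt1; apply: (H t); split => //.
  rewrite -(ler_pM2l c0) mulrA /grid mulVf ?mul1r ?gt_eqF ?exprn_gt0// -/(grid q (j + p)).
  by move: lt1; rewrite -/(grid q (j + p)); lra.
by have := e0; lra.
Qed.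

Lemma block_window_ge i t : tau i <= t -> t <= tau i.+1 ->
  W t w - W (tau i) w <= block_range q (block_window ^~ w) i.
Proof.
move=> t1 t2; have c0 := grid_gt0 q1 i.
have ttau : tau i <= t <= tau i.+1 by rewrite t1.
have := window_sup_ge c0 (tau0 i) (tau_lt (ltnSn i)) cw ttau.
move=> /(window_unscale c0); rewrite -lerBrDr opprK => h; apply: le_trans h _.
have -> : block_range q (block_window ^~ w) i =
    (grid q i)^-1 * window_sup W (grid q i) (tau i) (tau i.+1) w + q ^+ i * (q ^+ 2 - 1).
  by rewrite /block_range mulrDr /grid invrK.
rewrite lerD2l.
have : grid q i * (t - tau i) <= grid q i * (tau i.+1 - tau i).
  by apply: ler_wpM2l; [exact: ltW|lra].
move/le_trans; apply; rewrite le_eqVlt; apply/orP; left; apply/eqP.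
have qi : 0 < q ^+ i by rewrite exprn_gt0.
rewrite /grid mulnS exprD mul2n -addnn exprD.
by field; rewrite gt_eqF.
Qed.

End windows_of_path.

Section asymptotics.
Context {R : realType} d (Omega : measurableType d) (P : probability Omega R).
Variables (psi : R -> R) (q : R).
Hypotheses (psi_ge0 : forall u, 0 <= psi u)
  (psi_line : forall t x y : R, 0 <= t -> t <= 1 ->
     psi (t * x + (1 - t) * y) <= t * psi x + (1 - t) * psi y)
  (psi0 : psi 0 = 0) (q1 : 1 < q).
Local Notation th := (scaled_psi psi q).
Local Notation s := (chord_slope psi q).
Local Notation om := (chord_weight psi q).
Local Notation A := (wsum th).
Variables (C cA beta kappa : R) (n0 : nat).
Hypotheses (C0 : 0 < C) (cA0 : 0 < cA) (beta0 : 0 <= beta) (bk : beta < kappa)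
  (th_le : forall k, th k <= C * k.+1%:R `^ beta)
  (A_ge : forall n, (n0 <= n)%N -> cA * n%:R `^ kappa <= A n).
Variables (r : R) (p : nat).
Hypothesis r0 : 0 < r.
Local Notation tau i := (q ^+ (2 * i)%N).
Local Notation K1 := (block_const q).
Local Notation K3 := (cubic_const q).
Local Notation pw := (path_weight psi q K1 K3 p).

Let q0 : 0 < q. Proof. exact: lt_trans q1. Qed.
Let q10 : 0 < q - 1. Proof. by rewrite subr_gt0. Qed.
Let th0 := scaled_psi_ge0 psi_ge0 q1.
Let om_ge0 := chord_weight_ge0 psi_line q1.
Let K10 := block_const_ge0 q1.
Let K30 := cubic_const_ge0 q.
Let c0 := grid_gt0 q1.
Let s_ge0 := chord_slope_ge0 psi_ge0 psi_line psi0 q1.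
Let tau0 i : 0 <= tau i. Proof. exact/exprn_ge0/ltW. Qed.
Let tau_lt i j : (i < j)%N -> tau i < tau j.
Proof. by move=> ij; rewrite ltr_eXn2l// ltn_pmul2l. Qed.

Let wide_gap i j : (i + (2 * p).+1 <= j)%N -> tau (i + 2 * p).+1 <= tau j.
Proof. by rewrite addnS => ij; exact: tau_le. Qed.

Let block_gap i j : (i + 1 <= j)%N -> tau i.+1 <= tau j.
Proof. by rewrite addn1 => ij; exact: tau_le. Qed.

Lemma wsum_shifted_weight_le n : \sum_(j < n) om (j + p) <= \sum_(k < n + p) om k.
Proof.
rewrite -(big_mkord xpredT om) -(big_mkord xpredT (fun j => om (j + p))).
rewrite [leRHS](@big_cat_nat _ _ _ p)//= ?leq_addl//.
have -> : \sum_(p <= i < n + p) om i = \sum_(0 <= j < n) om (j + p).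
  by rewrite -{1}[p]add0n big_addn addnK.
by rewrite lerDr sumr_ge0.
Qed.

Section one_wiener.
Variables (W : R -> {RV P >-> R}) (hW : standard_wiener W).
Local Notation V := (wide_window W q p).
Local Notation Z := (block_window W q).
Local Notation G i w := (expR (block_window W q i w / 2)).

Let wide_lt j : tau j < tau (j + 2 * p).+1.
Proof. by apply: tau_lt; rewrite ltnS leq_addr. Qed.

Let block_lt j : tau j < tau j.+1.
Proof. exact: tau_lt. Qed.

(** Windows whose indices differ by at least 2 p + 1 do not overlap. The shift m is 1 in the upper
    bound and 0 in the lower one, according to the slope with which the weight is paired. *)
Lemma wide_window_slln (m : nat) :
  {ae P, forall w, forall e, 0 < e -> exists N, forall n, (N <= n)%N ->
    `|\sum_(j < n) om (j + p) * V (j + m) w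
      - \sum_(j < n) om (j + p) * \int[P]_w V (j + m) w| <= e * A n}.
Proof.
have cp k : 0 < grid q (k + p) by exact: c0.
pose K := q ^+ 2 / (q - 1) * (C * p.+1%:R `^ beta).
have K0 : 0 <= K.
  apply: mulr_ge0; first by apply: divr_ge0 (ltW q10); exact/exprn_ge0/ltW.
  by apply: mulr_ge0; [exact: ltW|exact: powR_ge0].
have K'0 : 0 <= q ^+ 2 / (q - 1) by apply: divr_ge0 (ltW q10); exact/exprn_ge0/ltW.
apply: (@slln_power R d Omega P th C cA beta kappa n0 th0 C0 cA0 beta0 bk th_le A_ge
  (fun j => V (j + m)) 8 K (q ^+ 2 / (q - 1)) (2 * p).+1 p (fun j => om (j + p))) => //.
- by move=> i; exact: measurable_window_seq.
- by move=> i w; exact: window_seq_ge0.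
- by move=> i; exact: (window_seq_second hW cp tau0 wide_lt).
- move=> i j ij; apply: (window_seq_uncorrelated hW cp tau0 wide_lt wide_gap).
  by rewrite addnAC leq_add2r.
- by move=> i; apply: chord_weight_shift_le.
- by move=> n; apply: chord_weight_wsum_le.
Qed.

Lemma block_window_slln (a : nat -> R) (K K' : R) : 0 <= K -> 0 <= K' ->
  (forall i, 0 <= a i) -> (forall i, a i <= K * i.+1%:R `^ beta) ->
  (forall n, wsum a n <= K' * A (n + p)) ->
  {ae P, forall w, forall e, 0 < e -> exists N, forall n, (N <= n)%N ->
    \sum_(i < n) a i * G i w <= 4 * wsum a n + e * A n}.
Proof.
move=> KK KK' a0 aK aA.
have := @slln_power R d Omega P th C cA beta kappa n0 th0 C0 cA0 beta0 bk th_le A_ge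
  (exp_window_seq W (grid q) (fun j => tau j) (fun j => tau j.+1)) 4 K K' 1 p a.
have m1 i : measurable_fun setT (exp_window_seq W (grid q) (fun j => tau j) (fun j => tau j.+1) i).
  exact: measurable_exp_window_seq.
have m2 i w : 0 <= exp_window_seq W (grid q) (fun j => tau j) (fun j => tau j.+1) i w.
  exact: exp_window_seq_ge0.
move=> /(_ m1 m2 (exp_window_seq_second hW c0 tau0 block_lt)
  (exp_window_seq_uncorrelated hW c0 tau0 block_lt block_gap) KK KK' a0 aK aA).
apply: filterS => w hw e e0; have [N hN] := hw e e0; exists N => n Nn.
have := hN n Nn; rewrite ler_norml => /andP[_ h].
have : \sum_(i < n) a i * \int[P]_w (exp_window_seq W (grid q) (fun j => tau j) (fun j => tau j.+1) i w)
    <= 4 * wsum a n.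
  rewrite /wsum mulr_sumr; apply: ler_sum => i _; rewrite mulrC.
  by apply: ler_wpM2r => //; exact: (Rintegral_exp_window_seq_le hW c0 tau0 block_lt).
by move: h; rewrite /exp_window_seq /block_window; lra.
Qed.

(** The means are bounded by 4 q^-i. The convergence makes the tail beyond the window of index 0
    bounded uniformly in time. *)
Lemma block_window_series : {ae P, forall w, exists M, forall n,
  \sum_(0 <= i < n) grid q i * G i w <= M}.
Proof.
apply: (@ae_geometric_series_bounded R d Omega P (fun i w => grid q i * G i w) 4 q^-1) => //.
- by rewrite invr_ge0 (ltW q0) invf_lt1.
- move=> i; apply: measurable_funM => //.
  exact: (measurable_exp_window_seq W (grid q) (fun j => tau j) (fun j => tau j.+1)).
- by move=> i w; apply: mulr_ge0; [exact: ltW|exact: expR_ge0].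
move=> i; under eq_integral do rewrite EFinM.
rewrite ge0_integralZl//.
- rewrite exprVn -/(grid q i) mulrC EFinM.
  apply: lee_wpmul2l; first by rewrite lee_fin ltW.
  exact: (exp_window_seq_mean_le hW c0 tau0 block_lt).
- apply/measurable_EFinP.
  exact: (measurable_exp_window_seq W (grid q) (fun j => tau j) (fun j => tau j.+1)).
- by rewrite lee_fin ltW.
Qed.

Lemma path_start_bound w : {within `[0, +oo[, continuous (fun t => W t w)} ->
  exists2 M : R, 0 <= M & forall t, 0 <= t -> t <= 1 -> `|W t w| <= M.
Proof.
move=> cw; have [M M0 hM] := halfline_bounded cw ler01; exists M => // t t0 t1.
by apply: hM; rewrite t0.
Qed.

(** C1 is the bound of [drifted_sup] at j = 0, uniform in the number of blocks. The slope v comes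
    from continuity at 0: before time del the path stays below r, and after it C1 <= (C1 / del)
    t. *)
Lemma path_linear_bound w : {within `[0, +oo[, continuous (fun t => W t w)} ->
  W 0 w = 0 -> (exists M, forall n, \sum_(0 <= i < n) grid q i * G i w <= M) ->
  exists C1 v, [/\ r <= C1, grid q p < v,
    forall t, 0 <= t -> W t w <= C1 + grid q p * t &
    forall t, 0 <= t -> W t w <= r + v * t].
Proof.
move=> cw w0 [M hM].
have [B B0 hB] := path_start_bound cw.
have Z0 i : 0 <= Z i w by exact: window_seq_ge0.
pose X (j i : nat) := K3 * (q ^+ (2 * (j + p)) * grid q i) * G i w.
have X0 j i : 0 <= X j i.
  apply: mulr_ge0; last exact: expR_ge0.
  by apply: mulr_ge0 => //; apply: mulr_ge0; [exact: tau0|exact: ltW].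
have M0 : 0 <= M by have := hM 0%N; rewrite big_geq.
pose C1 := r + B + q ^+ p * V 0 w + K3 * tau p * M.
have V0 j : 0 <= V j w by exact: window_seq_ge0.
have C10 : r <= C1.
  rewrite /C1 -!addrA lerDl; apply: addr_ge0 => //; apply: addr_ge0.
    by apply: mulr_ge0 => //; exact/exprn_ge0/ltW.
  by apply: mulr_ge0 => //; apply: mulr_ge0.
have line1 t : 0 <= t -> W t w <= C1 + grid q p * t.
  move=> t0.
  have [n tn] : exists n, t <= tau n.
    have [k hk] := grid_small q1 (d := (1 + t)^-1) (ltac:(by rewrite invr_gt0 ltr_wpDr)).
    exists k; have := hk k (leqnn k); rewrite /grid ltf_pV2 ?posrE ?exprn_gt0// ?ltr_wpDr// => h.
    have h2 : q ^+ k <= tau k by rewrite ler_weXn2l ?(ltW q1)// leq_pmull.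
    by move: h h2; lra.
  have h01 t' : 0 <= t' -> t' <= 1 -> W t' w <= B.
    by move=> t'0 t'1; rewrite (le_trans (ler_norm _))// hB.
  have := @drifted_sup R q (fun t => W t w) B (block_range q (Z ^~ w)) q1
    (block_range_ge0 q1 Z0) h01 (block_window_ge q1 cw) p (V ^~ w) X V0 X0
    (wide_window_ge q1 cw) (fun j i _ => block_range_cubic q1 Z0 i j p) 0%N n t t0 tn.
  rewrite big_ord0 !add0n addr0 => h.
  have SX : \sum_(2 * p <= i < n) X 0%N i <= K3 * tau p * M.
    apply: (@le_trans _ _ (\sum_(0 <= i < n) X 0%N i)).
      have [pn|np] := leqP (2 * p) n.
        by rewrite [leRHS](@big_cat_nat _ _ _ (2 * p))//= lerDr sumr_ge0.
      by rewrite big_geq ?sumr_ge0// ltnW.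
    have -> : \sum_(0 <= i < n) X 0%N i = K3 * tau p * \sum_(0 <= i < n) grid q i * G i w.
      by rewrite mulr_sumr; apply: eq_bigr => i _; rewrite /X add0n; ring.
    by apply: ler_wpM2l (hM n); exact: mulr_ge0.
  by move: h SX r0; rewrite /C1; lra.
have [del del0 hdel] := halfline_continuous_eps cw (lexx 0) r0.
have C1pos : 0 < C1 by exact: lt_le_trans C10.
exists C1, (grid q p + C1 / del); split => //.
  by rewrite ltrDl divr_gt0.
move=> t t0; have [td|td] := ltP t del.
  have := hdel t t0; rewrite subr0 (ger0_norm t0) => /(_ td); rewrite w0 subr0 => h.
  have : 0 <= (grid q p + C1 / del) * t.
    by apply: mulr_ge0 => //; apply: addr_ge0; [exact: ltW|apply: divr_ge0; exact: ltW].
  by have := ler_norm (W t w); move: h; lra.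
have : C1 <= C1 / del * t by rewrite mulrAC ler_pdivlMr// ler_wpM2l// ltW.
by have := line1 t t0; move: r0; lra.
Qed.

Lemma chord_weight_shift_sum_le n : \sum_(j < n) om (j + p) <=
  s 0%N + th 0%N / q + (q - q^-1) * A (n + p).
Proof.
apply: (@le_trans _ _ (\sum_(k < n + p) om k)); first exact: wsum_shifted_weight_le.
rewrite chord_weight_sum//.
have : 0 <= th (n + p) / q by apply: divr_ge0 (ltW q0); exact: th0.
have : 0 <= s (n + p) * q ^+ (n + p).
  by apply: mulr_ge0; [exact: s_ge0|exact/exprn_ge0/ltW].
by lra.
Qed.

Lemma upper_asymptotics : {ae P, forall w, forall e, 0 < e ->
  exists N, forall n, (N <= n)%N -> forall T, tau n <= T -> T <= tau n.+1 ->
  (min_energy psi (fun t => W t w) T r <=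
   (((q - q^-1) / 2 + 4 * (grid q p * weight_const q K1 K3) + e) * A n)%:E)%E}.
Proof.
have [K KK hK] : exists2 K, 0 <= K & forall i, pw i <= K * i.+1%:R `^ beta.
  exact: (path_weight_bound psi_ge0 psi_line psi0 q1 p C0 beta0 K10 K30 th_le).
have pw0 i : 0 <= pw i by apply: path_weight_ge0.
have pwA n : wsum pw n <= grid q p * weight_const q K1 K3 * A (n + p).
  by apply: path_weight_wsum_le.
have Wc0 : 0 <= weight_const q K1 K3.
  have h1 : 0 <= q / (q - 1) by exact: divr_ge0 (ltW q0) (ltW q10).
  have h2 : 0 <= q ^+ 2 / (q - 1) by apply: divr_ge0 (ltW q10); exact/exprn_ge0/ltW.
  by apply: addr_ge0; apply: mulr_ge0 => //; exact: mulr_ge0.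
have gW0 : 0 <= grid q p * weight_const q K1 K3 by apply: mulr_ge0 => //; exact: ltW.
have E1 := block_window_slln KK gW0 pw0 hK pwA.
have E2 := wide_window_slln 1.
have E12 : {ae P, forall w, (forall e, 0 < e -> exists N, forall n, (N <= n)%N ->
    \sum_(i < n) pw i * G i w <= 4 * wsum pw n + e * A n) /\
    (forall e, 0 < e -> exists N, forall n, (N <= n)%N ->
    `|\sum_(j < n) om (j + p) * V (j + 1) w
      - \sum_(j < n) om (j + p) * \int[P]_w V (j + 1) w| <= e * A n)}.
  by move: E1 E2; apply: filterS2.
have E3 := block_window_series.
have E4 := wiener_continuous hW; have E5 := wiener_start hW.
have E45 : {ae P, forall w, {within `[0, +oo[, continuous (fun t : R => W t w)} /\ W 0 w = 0}.
  by move: E4 E5; apply: filterS2.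
move: E12 E3 E45; apply: filterS3 => w [slln1 slln2] series [cw w0] e e0.
have [C1 [v [rC1 gv line1 line2]]] := path_linear_bound cw w0 series.
have [B B0 hB] := path_start_bound cw.
have Z0 i : 0 <= Z i w by exact: window_seq_ge0.
have V0 j : 0 <= V j w by exact: window_seq_ge0.
have h01 t' : 0 <= t' -> t' <= 1 -> W t' w <= B.
  by move=> t'0 t'1; rewrite (le_trans (ler_norm _))// hB.
pose L := (q - q^-1) / 2; pose M := 4 * (grid q p * weight_const q K1 K3).
have L0 : 0 <= L.
  apply: divr_ge0 => //; rewrite subr_ge0 (le_trans _ (ltW q1))// invf_le1//.
  exact: ltW.
have M0 : 0 <= M by apply: mulr_ge0.
have LM : 0 < 6 * (L + M + 1) by rewrite mulr_gt0// ltr_wpDl// addr_ge0.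
(* A shift of the index by p + 1 multiplies A by at most 1 + dl; this choice keeps the loss in the
   leading terms below e / 6. *)
pose dl := Num.min 1 (e / (6 * (L + M + 1))).
have dl0 : 0 < dl by rewrite lt_min ltr01 divr_gt0.
have dl1 : dl <= 1 by rewrite ge_min lexx.
have dle : dl * (L + M) <= e / 6.
  have : dl * (6 * (L + M + 1)) <= e by rewrite -ler_pdivlMr// ge_min lexx orbT.
  by move: dl0; lra.
have e6 : 0 < e / 6 by rewrite divr_gt0.
have e18 : 0 < e / 18 by rewrite divr_gt0.
have [N1 H1] := slln1 _ e18; have [N2 H2] := slln2 _ e18.
have q20 : 0 <= q ^+ 2 by exact/exprn_ge0/ltW.
have [N3 H3] := scaled_negligible C0 cA0 beta0 bk th_le A_ge p q20 e6.
have [N4 H4] := wsum_shift th0 C0 cA0 beta0 bk th_le A_ge p.+1 dl0.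
(* Everything independent of n: the first piece of the envelope, the start of the path and boundary
   terms of the total weight. It is absorbed because A n is unbounded. *)
pose Cst := psi v / (v - grid q p) * C1 + s p * (r + B) + (s 0%N + th 0%N / q) / 2.
have [N5 H5] := wsum_unbounded cA0 beta0 bk A_ge (Cst / (e / 6)).
exists (maxn N1 (maxn N2 (maxn N3 (maxn N4 N5)))) => n.
rewrite !geq_max => /andP[n1 /andP[n2 /andP[n3 /andP[n4 n5]]]] T nT Tn.
have := @min_energy_upper R psi q psi_ge0 psi_line psi0 q1 (fun t => W t w) r B C1 v K1 K3 p
  (block_range q (Z ^~ w)) (V ^~ w) (fun i => G i w) (block_range_ge0 q1 Z0) V0
  (fun i => expR_ge0 _) K30 h01 (block_window_ge q1 cw) (wide_window_ge q1 cw)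
  (block_range_le q1 Z0) (fun j i _ => block_range_cubic q1 Z0 i j p) (ltW r0) B0
  rC1 gv line1 line2 n T nT Tn.
move=> H; apply: le_trans H _; rewrite lee_fin -/L -/M.
have An0 : 0 <= A n by exact: sumr_ge0.
have S1 := H1 _ (leqW n1); have S2 := H2 _ n2; have S3 := H3 _ n3.
have S4 := H4 _ n4; have S5 := H5 _ n5.
have An1 : A n.+1 <= A (n + p.+1).
  by apply: (wsum_le th0); rewrite addnS ltnS leq_addr.
have Anp : A (n + p) <= A (n + p.+1) by apply: (wsum_le th0); rewrite leq_add2l.
have T1 : psi (grid q (n + p)) * tau n.+1 <= e / 6 * A n.
  apply: le_trans S3; rewrite /scaled_psi mulnS exprD mulrCA.
  apply: ler_wpM2l => //; apply: ler_wpM2l => //.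
  by rewrite ler_weXn2l ?(ltW q1)// leq_pmul2l// leq_addr.
have T2 : Cst <= e / 6 * A n by rewrite mulrC -ler_pdivrMr.
have T3 : \sum_(j < n) om (j + p) * \int[P]_w V (j + 1) w <= 1 / 2 * \sum_(j < n) om (j + p).
  rewrite mulr_sumr; apply: ler_sum => j _; rewrite mulrC; apply: ler_wpM2r.
    exact: om_ge0.
  have cp k : 0 < grid q (k + p) by exact: c0.
  exact: (Rintegral_window_seq_le hW cp tau0 wide_lt).
have T4 := chord_weight_shift_sum_le n.
have T6 : 4 * wsum pw n.+1 <= M * A (n + p.+1).
  by rewrite addnS -addSn /M -mulrA; apply: ler_wpM2l => //; exact: pwA.
have T7 : L * A (n + p) <= L * A (n + p.+1) by apply: ler_wpM2l.
have T8 : (L + M) * A (n + p.+1) <= (L + M) * ((1 + dl) * A n).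
  by apply: ler_wpM2l => //; exact: addr_ge0.
have T9 : e / 18 * A n.+1 <= e / 18 * (2 * A n).
  apply: ler_wpM2l; first exact: ltW.
  rewrite (le_trans An1)// (le_trans S4)//; apply: ler_wpM2r => //.
  by move: dl1; lra.
have T10 : (dl * (L + M)) * A n <= e / 6 * A n by apply: ler_wpM2r.
have eA : 0 <= e * A n by apply: mulr_ge0 => //; exact: ltW.
have S2' : \sum_(j < n) om (j + p) * V j.+1 w <=
    \sum_(j < n) om (j + p) * \int[P]_w V (j + 1) w + e / 18 * A n.
  have -> : \sum_(j < n) om (j + p) * V j.+1 w = \sum_(j < n) om (j + p) * V (j + 1) w.
    by apply: eq_bigr => j _; rewrite addn1.
  by move: S2; rewrite ler_norml => /andP[_]; lra.
move: T1 T2 T3 T4 T6 T7 T8 T9 T10 S1 S2' eA; rewrite /Cst /L.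
set X1 := \sum_(j < n) om (j + p) * V j.+1 w.
set X2 := \sum_(j < n) om (j + p) * \int[P]_w0 V (j + 1) w0.
set X3 := \sum_(j < n) om (j + p).
set X4 := \sum_(i < n.+1) pw i * _.
move: (A n) (A n.+1) (A (n + p)) (A (n + p.+1)) X1 X2 X3 X4 (wsum pw n.+1) => *.
lra.
Qed.

End one_wiener.
Variables (W : R -> {RV P >-> R}) (hW : standard_wiener W).
Local Notation V := (wide_window W q p).
Local Notation W' := (fun t => (- W t)%R : {RV P >-> R}).
Local Notation Z' := (block_window W' q).

(** Collects the losses of relative order q^-p. In the first summand 4 / (q^2 - 1) is the deficit of
    the window means and 2 the precision with the initial drift, both times a bound for the total
    weight; the second summand is due to the downward oscillations. *)
Definition lower_loss : R :=
  q^-1 * ((4 / (q ^+ 2 - 1) + 2) * (2 * (q ^+ 2 / (q - 1)))) +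
  8 * (K1 * (q / (q - 1))).

Let q21 : 0 < q ^+ 2 - 1. Proof. by rewrite subr_gt0 exprn_egt1. Qed.

(** The scaled length of the window is q^(2p+2) - q^(-2p), which is at least (q^2 - 1) q^p. *)
Lemma wide_window_mean_ge j :
  1 / 2 - 4 / (q ^+ 2 - 1) * grid q p <= \int[P]_w V j w.
Proof.
have cp k : 0 < grid q (k + p) by exact: c0.
have wide_lt i : tau i < tau (i + 2 * p).+1 by apply: tau_lt; rewrite ltnS leq_addr.
apply: le_trans (Rintegral_window_seq_ge hW cp tau0 wide_lt j).
rewrite lerD2l lerN2 -mulrA ler_wpM2l ?ler0n//.
have x0 : 0 < q ^+ j by rewrite exprn_gt0.
have y0 : 0 < q ^+ p by rewrite exprn_gt0.
have -> : (q ^+ 2 - 1)^-1 * grid q p = ((q ^+ 2 - 1) * q ^+ p)^-1 by rewrite invfM.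
have h1 : 0 < (q ^+ 2 - 1) * q ^+ p by exact: mulr_gt0.
have h2 : 0 < grid q (j + p) ^+ 2 * (tau (j + 2 * p).+1 - tau j).
  by apply: mulr_gt0; [exact/exprn_gt0/c0|rewrite subr_gt0].
rewrite lef_pV2 ?posrE//.
have -> : grid q (j + p) ^+ 2 * (tau (j + 2 * p).+1 - tau j) =
    (q ^+ 2 * (q ^+ p * q ^+ p) - (q ^+ p * q ^+ p)^-1).
  rewrite /grid mulnS !mulnDr !mul2n -!addnn !exprD.
  move: (q ^+ j) x0 (q ^+ p) y0 => x x0 y y0; field.
  by rewrite !gt_eqF.
have y1 : 1 <= q ^+ p by rewrite exprn_ege1// ltW.
have yy : q ^+ p <= q ^+ p * q ^+ p by rewrite ler_peMr// ltW.
have yi : (q ^+ p * q ^+ p)^-1 <= q ^+ p * q ^+ p.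
  apply: (@le_trans _ _ 1); last by rewrite (le_trans y1).
  by rewrite invf_le1 ?mulr_gt0// (le_trans y1).
have : (q ^+ 2 - 1) * q ^+ p <= (q ^+ 2 - 1) * (q ^+ p * q ^+ p).
  by apply: ler_wpM2l => //; exact: ltW.
by move: yi; lra.
Qed.

Lemma lower_asymptotics : {ae P, forall w, forall e, 0 < e ->
  exists N, forall n, (N <= n)%N -> forall T, tau (n + 2 * p) <= T ->
  (((q^-1 * ((q - q^-1) / 2) - grid q p * lower_loss - e) * A n)%:E
    <= min_energy psi (fun t => W t w) T r)%E}.
Proof.
have hW' : standard_wiener W' by exact: standard_wiener_opp.
have [K KK hK] := slope_weight_bound psi_ge0 q1 p C0 beta0 th_le.
pose a i := K1 * (s (i + p) * q ^+ i).
have qq0 : 0 <= q / (q - 1) by exact: divr_ge0 (ltW q0) (ltW q10).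
have qq2 : 0 <= q ^+ 2 / (q - 1) by apply: divr_ge0 (ltW q10); exact/exprn_ge0/ltW.
have a0 i : 0 <= a i.
  by apply: mulr_ge0 => //; apply: mulr_ge0; [exact: s_ge0|exact/exprn_ge0/ltW].
have aK i : a i <= (K1 * K) * i.+1%:R `^ beta.
  by rewrite -mulrA; apply: ler_wpM2l.
have aA n : wsum a n <= (K1 * (grid q p * (q / (q - 1)))) * A (n + p).
  rewrite /a /wsum -mulr_sumr -mulrA; apply: ler_wpM2l => //.
  exact: (slope_weight_wsum_le psi_ge0 q1).
have K1K : 0 <= K1 * K by exact: mulr_ge0.
have K1g : 0 <= K1 * (grid q p * (q / (q - 1))).
  by apply: mulr_ge0 => //; apply: mulr_ge0 => //; exact: ltW.
have E1 := block_window_slln hW' K1K K1g a0 aK aA.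
have E2 := wide_window_slln hW 0.
have E12 : {ae P, forall w, (forall e, 0 < e -> exists N, forall n, (N <= n)%N ->
    \sum_(i < n) a i * expR (Z' i w / 2) <= 4 * wsum a n + e * A n) /\
    (forall e, 0 < e -> exists N, forall n, (N <= n)%N ->
    `|\sum_(j < n) om (j + p) * V (j + 0) w
      - \sum_(j < n) om (j + p) * \int[P]_w V (j + 0) w| <= e * A n)}.
  by move: E1 E2; apply: filterS2.
have E3 := wiener_continuous hW; have E4 := wiener_continuous hW'.
move: E12 E3 E4; apply: filterS3 => w [slln1 slln2] cw cw' e e0.
have [B B0 hB] := path_start_bound cw.
have Z0 i : 0 <= Z' i w by exact: window_seq_ge0.
have h01 t' : 0 <= t' -> t' <= 1 -> - W t' w <= B.
  by move=> t'0 t'1; rewrite (le_trans (ler_norm _))// normrN hB.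
pose dl : R := (4 / (q ^+ 2 - 1) + 2) * grid q p.
have dl0 : 0 <= dl.
  by apply: mulr_ge0; [apply: addr_ge0 => //; apply: divr_ge0 => //|]; exact: ltW.
have qV : 0 < q^-1 by rewrite invr_gt0.
have qV1 : q^-1 <= 1 by rewrite invf_le1// ltW.
have e8 : 0 < e / 8 by rewrite divr_gt0.
have [N1 H1] := slln1 _ e8; have [N2 H2] := slln2 _ e8.
pose Kn : R := q^-1 + q / (q - 1).
have Kn0 : 0 <= Kn by apply: addr_ge0 => //; exact: ltW.
have [N3 H3] := scaled_negligible C0 cA0 beta0 bk th_le A_ge p Kn0 e8.
have [N4 H4] := wsum_shift th0 C0 cA0 beta0 bk th_le A_ge p ltr01.
pose Bp := \sum_(k < p) om k.
have Bp0 : 0 <= Bp by apply: sumr_ge0.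
pose Cst := s p * (r + B) + Bp.
have [N5 H5] := wsum_unbounded cA0 beta0 bk A_ge (Cst / (e / 8)).
exists (maxn N1 (maxn N2 (maxn N3 (maxn N4 N5)))) => n.
rewrite !geq_max => /andP[n1 /andP[n2 /andP[n3 /andP[n4 n5]]]] T nT.
have := @min_energy_lower R psi q psi_ge0 psi_line psi0 q1 (fun t => W t w) r B K1 p
  (block_range q (Z' ^~ w)) (V ^~ w) (fun i => expR (Z' i w / 2)) (block_range_ge0 q1 Z0)
  h01 (block_window_ge (W := W') q1 cw') (wide_window_attained p q1 cw)
  (block_range_le q1 Z0) (ltW r0) B0 n T nT.
apply: le_trans; rewrite lee_fin.
have An0 : 0 <= A n by exact: sumr_ge0.
have S1 := H1 _ n1; have S2 := H2 _ n2; have S3 := H3 _ n3.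
have S4 := H4 _ n4; have S5 := H5 _ n5.
set Om := \sum_(j < n) om (j + p).
have Om0 : 0 <= Om by apply: sumr_ge0.
have T1 : Cst <= e / 8 * A n by rewrite mulrC -ler_pdivrMr.
(* The sum of all weights below n + p is known up to boundary terms, which [Kn] collects; [Bp]
   accounts for the first p weights, which have no window. *)
have Om_ge : (q - q^-1) * A n - Kn * th (n + p) - Bp <= Om.
  have OmE : \sum_(k < n + p) om k = Om + Bp.
    rewrite /Om /Bp -!(big_mkord xpredT om) -(big_mkord xpredT (fun j => om (j + p))).
    rewrite [LHS](@big_cat_nat _ _ _ p)//= ?leq_addl// addrC; congr (_ + _).
    by rewrite -{1}[p]add0n big_addn addnK.
  have := chord_weight_sum psi q1 (n + p); rewrite OmE => E.
  have h1 := chord_slope_le_scaled psi_ge0 q1 (n + p).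
  have h2 : (q - q^-1) * A n <= (q - q^-1) * A (n + p).
    apply: ler_wpM2l; first by rewrite subr_ge0 (le_trans qV1)// ltW.
    by apply: (wsum_le th0); exact: leq_addr.
  have h3 := s_ge0 0%N.
  have h4 : 0 <= th 0%N / q by apply: divr_ge0 (ltW q0); exact: th0.
  by move: E h1 h2 h3 h4; rewrite /Kn; lra.
have Om_le : Om <= q ^+ 2 / (q - 1) * (2 * A n).
  apply: (le_trans (chord_weight_wsum_le psi_ge0 psi_line psi0 q1 p n)).
  exact: ler_wpM2l.
have mean : (1 / 2 - 4 / (q ^+ 2 - 1) * grid q p) * Om <=
    \sum_(j < n) om (j + p) * \int[P]_w V (j + 0) w.
  rewrite /Om mulr_sumr; apply: ler_sum => j _; rewrite mulrC.
  by apply: ler_wpM2l; [exact: om_ge0|exact: wide_window_mean_ge].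
have T2 : \sum_(j < n) om (j + p) * (V j w - 2 * grid q (2 * p)) =
    \sum_(j < n) om (j + p) * V (j + 0) w - 2 * grid q (2 * p) * Om.
  by rewrite /Om mulr_sumr -sumrB; apply: eq_bigr => j _; rewrite addn0; ring.
have g2 : 2 * grid q (2 * p) * Om <= 2 * grid q p * Om.
  apply: ler_wpM2r => //; apply: ler_wpM2l => //; apply: grid_le => //.
  by rewrite leq_pmull.
have T3 : dl * Om <= dl * (q ^+ 2 / (q - 1) * (2 * A n)) by apply: ler_wpM2l.
have aA2 : 4 * wsum a n <= grid q p * (8 * (K1 * (q / (q - 1)))) * A n.
  have : (K1 * (grid q p * (q / (q - 1)))) * A (n + p) <=
    (K1 * (grid q p * (q / (q - 1)))) * ((1 + 1) * A n) by apply: ler_wpM2l.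
  by have := aA n; lra.
have eA : 0 <= e * A n by apply: mulr_ge0 => //; exact: ltW.
set S := \sum_(j < n) om (j + p) * (V j w - 2 * grid q (2 * p)).
have S_ge : ((q - q^-1) / 2 - dl * (2 * (q ^+ 2 / (q - 1))) - e / 4) * A n - Bp <= S.
  rewrite /S T2; move: S2; rewrite ler_norml => /andP[S2 _].
  have hB2 : 0 <= Bp / 2 by rewrite divr_ge0.
  move: eA hB2 S2 mean g2 T3 Om_ge S3; rewrite /dl -/Om.
  set x1 := \sum_(j < n) _; set x2 := \sum_(j < n) _.
  move: (q ^+ 2 / (q - 1)) (4 / (q ^+ 2 - 1)) (grid q p) (grid q (2 * p)) => y1 y2 y3 y4.
  move: (q - q^-1) => y5 *; lra.
have qS : q^-1 * (((q - q^-1) / 2 - dl * (2 * (q ^+ 2 / (q - 1))) - e / 4) * A n - Bp)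
    <= q^-1 * S by apply: ler_wpM2l S_ge; exact: ltW.
have qB : q^-1 * Bp <= Bp by rewrite ler_piMl.
have qe : q^-1 * (e / 4 * A n) <= e / 4 * A n.
  by rewrite ler_piMl// mulr_ge0// ltW// divr_gt0.
have S1' : \sum_(i < n) K1 * (s (i + p) * q ^+ i) * expR (Z' i w / 2)
    <= 4 * wsum a n + e / 8 * A n by exact: S1.
move: T1 aA2 S1' qS qB qe eA; rewrite /lower_loss /Cst /dl -/S.
set x1 := \sum_(i < n) _.
move: (q ^+ 2 / (q - 1)) (4 / (q ^+ 2 - 1)) (grid q p) (q / (q - 1)) => y1 y2 y3 y4.
move: (q - q^-1) (q^-1) => y5 y6 *; lra.
Qed.

End asymptotics.

(** * Comparison with the integral and passage to the limit *)

Lemma split_block (N1 N2 N3 p K : nat) : (N1 + (N2 + N3 + 2 * p) <= K)%N ->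
  exists n, [/\ K = (n + 2 * p)%N, (N2 <= n)%N, (N3 <= n)%N & (N1 <= K)%N].
Proof. by move=> h; exists (K - 2 * p)%N; split; lia. Qed.

Section sandwich.
Context {R : realType} d (Omega : measurableType d) (P : probability Omega R).
Variables (psi : R -> R) (q : R).
Hypotheses (psi_ge0 : forall u, 0 <= psi u)
  (psi_line : forall t x y : R, 0 <= t -> t <= 1 ->
     psi (t * x + (1 - t) * y) <= t * psi x + (1 - t) * psi y)
  (psi0 : psi 0 = 0) (q1 : 1 < q).
Local Notation th := (scaled_psi psi q).
Local Notation A := (wsum th).
Local Notation tau i := (q ^+ (2 * i)%N).
Local Notation m := (m_psi psi).

Let q0 : 0 < q. Proof. exact: lt_trans q1. Qed.
Let q10 : 0 < q - 1. Proof. by rewrite subr_gt0. Qed.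
Let th0 := scaled_psi_ge0 psi_ge0 q1.
Let psi_nd := convex_nondecreasing psi_ge0 psi_line psi0.

Lemma wsum_le_m_psi n x : q ^+ n <= x -> A n <= q ^+ 2 / (q - 1) * m x + th 0%N.
Proof.
move=> nx; have /andP[h _] := m_psi_geometric psi_ge0 psi_nd q1 n.
have qn1 : 1 <= q ^+ n by rewrite exprn_ege1// ltW.
have h2 := le_trans h (m_psi_le psi_ge0 psi_nd qn1 nx).
have E : A n.+1 = th 0%N + \sum_(k < n) th k.+1 by rewrite /wsum big_ord_recl.
have h3 : A n <= A n.+1 by exact: (wsum_le th0).
have q20 : 0 < q ^+ 2 by rewrite exprn_gt0.
have : \sum_(k < n) th k.+1 <= q ^+ 2 / (q - 1) * m x.
  rewrite mulrC -ler_pdivrMr ?divr_gt0// invf_div.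
  by rewrite mulrC.
by move: h3; rewrite E; lra.
Qed.

Lemma m_psi_le_wsum n x : 1 <= x -> x <= q ^+ n -> m x <= q * (q - 1) * A n.
Proof.
move=> x1 xn; have /andP[_ h] := m_psi_geometric psi_ge0 psi_nd q1 n.
by apply: le_trans h; exact: m_psi_le.
Qed.

Lemma time_block N : exists T0 : R, forall T, T0 <= T ->
  exists n, [/\ (N <= n)%N, tau n <= T & T <= tau n.+1].
Proof.
exists (tau N) => T NT.
have T0 : 0 < T by rewrite (lt_le_trans _ NT)// exprn_gt0.
have Ti : 0 < T^-1 by rewrite invr_gt0.
have [k hk] := grid_small q1 Ti.
have TM M : (maxn k N.+1 <= M)%N -> T <= tau M.
  rewrite geq_max => /andP[kM NM]; have k2 : (k <= 2 * M)%N by lia.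
  by have := hk _ k2; rewrite /grid ltf_pV2 ?posrE ?exprn_gt0// => /ltW.
have NM : (N < maxn k N.+1)%N by rewrite leq_max ltnSn orbT.
have [n [n1 _ n2 n3]] := tau_block NM NT (TM _ (leqnn _)).
by exists n.
Qed.

Lemma sqrt_tau n : Num.sqrt (tau n) = q ^+ n.
Proof. by rewrite mulnC exprM sqrtr_sqr ger0_norm// exprn_ge0// ltW. Qed.

Variables (C cA beta kappa : R) (n0 : nat).
Hypotheses (C0 : 0 < C) (cA0 : 0 < cA) (beta0 : 0 <= beta) (bk : beta < kappa)
  (th_le : forall k, th k <= C * k.+1%:R `^ beta)
  (A_ge : forall n, (n0 <= n)%N -> cA * n%:R `^ kappa <= A n)
  (m_oo : m b @[b --> +oo] --> +oo).

Lemma m_psi_sqrt_large (M : R) : exists T0 : R, forall T, T0 <= T -> M <= m (Num.sqrt T).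
Proof.
have /cvgryPge/(_ M)[b [_ hb]] := m_oo.
exists ((Num.max b 0 + 1) ^+ 2) => T bT; apply: hb => /=.
have h0 : 0 <= Num.max b 0 + 1 by rewrite addr_ge0// le_max lexx orbT.
rewrite (lt_le_trans (y := Num.max b 0 + 1))//.
  by rewrite (le_lt_trans (y := Num.max b 0)) ?le_max ?lexx// ltrDl.
by rewrite -(ger0_norm h0) -sqrtr_sqr ler_sqrt// (le_trans _ bT)// exprn_ge0.
Qed.

Variables (r : R).
Hypothesis r0 : 0 < r.
Variable W : R -> {RV P >-> R}.
Hypothesis hW : standard_wiener W.

(** The leading constant (q - 1/q) / 2 times q^2 / (q - 1), the price of passing from A to [m_psi].
    Likewise [lower_ratio] is (q - 1/q) / (2 q) divided by q (q - 1). Both tend to 1 as q tends to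
    1. *)
Definition upper_ratio : R := q * (q + 1) / 2.
Definition lower_ratio : R := (q + 1) / (2 * q ^+ 3).

Let small_grid (K x : R) : 0 < x -> exists p, grid q p * K <= x.
Proof.
move=> x0; have K1 : 0 < `|K| + 1 by rewrite ltr_wpDl.
have [p hp] := grid_small q1 (divr_gt0 x0 K1).
exists p; have := hp _ (leqnn _); rewrite ltr_pdivlMr// => /ltW h.
apply: le_trans h; apply: ler_wpM2l; first by rewrite ltW// grid_gt0.
by rewrite (le_trans (ler_norm _))// lerDl.
Qed.

Lemma min_energy_sandwich : {ae P, forall w, forall e, 0 < e ->
  exists T0 : R, forall T, T0 <= T ->
  (((lower_ratio - e) * m (Num.sqrt T))%:E <= min_energy psi (fun t => W t w) T r)%E /\
  (min_energy psi (fun t => W t w) T r <= ((upper_ratio + e) * m (Num.sqrt T))%:E)%E}.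
Proof.
have U := ae_foralln (fun p =>
  upper_asymptotics psi_ge0 psi_line psi0 q1 C0 cA0 beta0 bk th_le A_ge p r0 hW).
have L := ae_foralln (fun p =>
  lower_asymptotics psi_ge0 psi_line psi0 q1 C0 cA0 beta0 bk th_le A_ge p r0 hW).
move: U L; apply: filterS2 => w U L e e0.
pose c := q ^+ 2 / (q - 1).
have c0 : 0 < c by rewrite divr_gt0// exprn_gt0.
have c10 : 0 < c + 1 by rewrite addr_gt0.
(* Once [m_psi] exceeds [th 0], A K is at most (c + 1) times it, so an error x A K costs at most e /
   4. The parameters p1 and p2 are then chosen for this x. *)
pose x := e / (4 * (c + 1)).
have x0 : 0 < x by rewrite divr_gt0// mulr_gt0.
have xc : x * (c + 1) = e / 4 by rewrite /x; field; rewrite gt_eqF.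
have qi : q^-1 < 1 by rewrite invf_lt1.
pose Lu := (q - q^-1) / 2; pose Ll := q^-1 * Lu.
have Lu0 : 0 < Lu by rewrite divr_gt0// subr_gt0 (lt_trans qi).
have Ll0 : 0 < Ll by rewrite mulr_gt0// invr_gt0.
have [p1 hp1] := @small_grid (4 * weight_const q (block_const q) (cubic_const q)) x x0.
have [p2 hp2] := @small_grid (lower_loss q) x x0.
have [N1 H1] := U p1 _ x0; have [N2 H2] := L p2 _ x0.
have xL : 0 < x / Ll by rewrite divr_gt0.
have [N3 H3] := wsum_shift th0 C0 cA0 beta0 bk th_le A_ge (2 * p2).+1 xL.
have [T1 H4] := time_block (N1 + (N2 + N3 + 2 * p2)).
have [T2 H5] := m_psi_sqrt_large (Num.max 1 (Num.max (th 0%N) (Lu * th 0%N / (e / 4)))).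
exists (Num.max T1 T2) => T; rewrite ge_max => /andP[/H4[K [NK TK1 TK2]] /H5].
rewrite !ge_max => /andP[m1 /andP[m2]].
(* The lower bound is used at n = K - 2 p2, where all windows end by tau K <= T; a shift of 2 p2 + 1
   leads from A n to the A (K + 1) that dominates [m_psi]. *)
have [n [Kn N2n N3n N1K]] := split_block NK.
have e4 : 0 < e / 4 by rewrite divr_gt0.
rewrite ler_pdivrMr// => m3.
have sT1 : q ^+ K <= Num.sqrt T.
  by rewrite -sqrt_tau ler_sqrt// (le_trans _ TK1)// exprn_ge0// ltW.
have sT2 : Num.sqrt T <= q ^+ K.+1.
  by rewrite -sqrt_tau ler_sqrt// exprn_ge0// ltW.
have sT : 1 <= Num.sqrt T by rewrite (le_trans _ sT1)// exprn_ege1// ltW.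
have AK := wsum_le_m_psi sT1; have mK := m_psi_le_wsum sT sT2.
have AK0 : 0 <= A K by exact: sumr_ge0.
rewrite -/c in AK.
move: m1 m2 m3 AK mK; set mT := m (Num.sqrt T) => m1 m2 m3 AK mK.
have xA : x * A K <= e / 4 * mT.
  have : x * A K <= x * ((c + 1) * mT) by apply: ler_wpM2l; [exact: ltW|lra].
  by rewrite mulrA xc.
split.
- have nT : tau (n + 2 * p2) <= T by rewrite -Kn.
  apply: le_trans (H2 _ N2n _ nT); rewrite lee_fin -/Lu -/Ll.
  have An0 : 0 <= A n by exact: sumr_ge0.
  have AnK : A n <= A K by apply: (wsum_le th0); rewrite Kn leq_addr.
  have := H3 _ N3n; rewrite addnS -Kn => shift.
  have s1 : Ll * A K.+1 <= Ll * A n + x * A n.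
    have -> : Ll * A n + x * A n = Ll * ((1 + x / Ll) * A n).
      by field; rewrite gt_eqF.
    by apply: ler_wpM2l => //; exact: ltW.
  have s2 : lower_ratio * mT <= Ll * A K.+1.
    have -> : lower_ratio = Ll / (q * (q - 1)).
      rewrite /lower_ratio /Ll /Lu; field.
      by rewrite !gt_eqF.
    rewrite mulrAC ler_pdivrMr ?mulr_gt0// -[leRHS]mulrA.
    by apply: ler_wpM2l; [exact: ltW|rewrite mulrC].
  have s3 : grid q p2 * lower_loss q * A n <= x * A n by apply: ler_wpM2r.
  have s4 : x * A n <= x * A K by apply: ler_wpM2l => //; exact: ltW.
  have s5 : 0 <= e * mT by apply: mulr_ge0; [exact: ltW|lra].
  move: (grid q p2 * lower_loss q) s3 => y s3.
  by move: s1 s2 s3 s4 s5 xA; lra.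
- apply: le_trans (H1 _ N1K _ TK1 TK2) _; rewrite lee_fin -/Lu.
  have s1 : 4 * (grid q p1 * weight_const q (block_const q) (cubic_const q)) * A K <= x * A K.
    by apply: ler_wpM2r => //; rewrite mulrCA.
  have s2 : Lu * A K <= Lu * (c * mT + th 0%N) by apply: ler_wpM2l => //; exact: ltW.
  have s3 : upper_ratio * mT = Lu * (c * mT).
    rewrite /upper_ratio /Lu /c; field.
    by rewrite !gt_eqF.
  have s5 : 0 <= e * mT by apply: mulr_ge0; [exact: ltW|lra].
  move: (4 * (grid q p1 * weight_const q (block_const q) (cubic_const q))) s1 => y s1.
  by move: s1 s2 s3 s5 xA m3; lra.
Qed.

End sandwich.

(** The two finite bounds also rule out infinite values of I at large times, so the limit can be
    taken among real quotients. *)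
Lemma cvge_ratio1 (R : realType) (I : R -> \bar R) (g : R -> R) :
  (forall e : R, 0 < e -> exists T0 : R, forall T, T0 <= T ->
    [/\ 0 < g T, (((1 - e) * g T)%:E <= I T)%E & (I T <= ((1 + e) * g T)%:E)%E]) ->
  (I T / (g T)%:E)%E @[T --> +oo] --> 1%E.
Proof.
move=> H.
have key e : 0 < e -> \forall T \near +oo,
    exists2 x : R, (I T / (g T)%:E)%E = x%:E & `|1 - x| <= e.
  move=> /H[T0 hT]; exists T0; split; first exact: num_real.
  move=> T /ltW /hT[]; case: (I T) => [y| |]; last 2 first.
  - by move=> _ _; rewrite leye_eq.
  - by move=> _; rewrite leeNy_eq.
  move=> gT; rewrite !lee_fin => lo up; exists (y / g T).
    by rewrite inver (gt_eqF gT) -EFinM.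
  rewrite distrC ler_norml lerBlDr ler_pdivrMr// [e + 1]addrC up andbT.
  by rewrite lerBrDr ler_pdivlMr// [- e + 1]addrC.
apply/fine_cvgP; split.
  by have := key 1 ltr01; apply: filterS => T [x -> _].
apply/cvgrPdist_le => e /key; apply: filterS => T [x /= -> //].
Qed.

Theorem theorem11 (R : realType) (d : measure_display)
    (Omega : measurableType d) (P : probability Omega R)
    (W : R -> {RV P >-> R}) (hW : standard_wiener W)
    (psi theta : R -> R)
    (psi_ge0 : forall u, 0 <= psi u)
    (psi_convex : convex_function (setT : set R^o) psi)
    (psi_theta : forall u, 0 < u -> psi u = u ^+ 2 * theta u)
    (alpha_up alpha_lo : R)
    (halpha :
      [/\ - (1 / 2) < alpha_up, alpha_lo <= alpha_up &
          alpha_up < alpha_lo + 1 / 3] \/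
      [/\ -1 < alpha_up <= - (1 / 2), alpha_lo <= alpha_up &
          alpha_up < 3 * alpha_lo + 2])
    (theta_lo : (fun u : R => `|ln u| `^ alpha_lo) =O_ ((0 : R)^'+) theta)
    (theta_up : theta =O_ ((0 : R)^'+) (fun u : R => `|ln u| `^ alpha_up))
    (m_psi_infty : m_psi psi b @[b --> +oo] --> +oo)
    (r : R) (hr : 0 < r) :
  {ae P, forall omega,
    (min_energy psi (fun t => W t omega) T r / (m_psi psi (Num.sqrt T))%:E)%E
      @[T --> +oo] --> 1%E}.
Proof.
have psi_line := convex_function_line psi_convex.
have psi0 := psi_at0 psi_ge0 psi_line psi_theta theta_up.
(* In the first case alpha_lo > alpha_up - 1/3 > -5/6. In the second, alpha_up <= -1/2 is negative
   and 3 alpha_lo > alpha_up - 2 > -3. *)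
have bk : Num.max alpha_up 0 < alpha_lo + 1.
  by rewrite gt_max; case: halpha => [[? ? ?]|[/andP[? ?] ? ?]]; apply/andP; split; lra.
have b0 : 0 <= Num.max alpha_up 0 by rewrite le_max lexx orbT.
(* The grid ratios q = 1 + 1/(l+1) form a sequence tending to 1, so that the exceptional null sets
   can be united. *)
pose x l : R := l.+1%:R^-1.
have x0 l : 0 < x l by rewrite invr_gt0 ltr0n.
have q1 l : 1 < 1 + x l by rewrite ltrDl.
have S : {ae P, forall w, forall l e, 0 < e -> exists T0 : R, forall T, T0 <= T ->
    (((lower_ratio (1 + x l) - e) * m_psi psi (Num.sqrt T))%:E
      <= min_energy psi (fun t => W t w) T r)%E /\
    (min_energy psi (fun t => W t w) T r
      <= ((upper_ratio (1 + x l) + e) * m_psi psi (Num.sqrt T))%:E)%E}.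
  apply: ae_foralln => l.
  have [C C0 th_le] := scaled_psi_le_powR psi_ge0 psi_theta theta_up (q1 l).
  have [c c0 [n0 A_ge]] := wsum_scaled_psi_ge_powR psi_ge0 psi_theta theta_lo (q1 l).
  exact: (min_energy_sandwich psi_ge0 psi_line psi0 (q1 l) C0 c0 b0 bk th_le A_ge
    m_psi_infty hr hW).
move: S; apply: filterS => w S; apply: cvge_ratio1 => e e0.
have e8 : 0 < e / 8 by rewrite divr_gt0.
have [l xl] : exists l, x l <= e / 8.
  exists (Num.truncn (e / 8)^-1); rewrite -[leRHS]invrK lef_pV2 ?posrE ?invr_gt0//.
  exact/ltW/truncnS_gt.
have [T1 H1] := S l _ e8; have [T2 H2] := m_psi_sqrt_large m_psi_infty 1.
exists (Num.max T1 T2) => T; rewrite ge_max => /andP[/H1[lo up] /H2 m1].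
have x1 : x l <= 1 by rewrite invf_le1 ?ltr0n// ler1n.
have m0 : 0 < m_psi psi (Num.sqrt T) by apply: lt_le_trans m1.
split => //.
- apply: le_trans lo; rewrite lee_fin ler_pM2r// lerBrDr.
  (* At q = 1 + y the lower ratio is at least 1 - 3 y, as the identity below shows; the upper one,
     (1 + y) (2 + y) / 2, is at most 1 + 2 y for y <= 1. *)
  apply: (@le_trans _ _ (1 - 3 * x l)); first by lra.
  rewrite /lower_ratio ler_pdivlMr; last by rewrite mulr_gt0// exprn_gt0// addr_gt0.
  move: (x l) (x0 l) => y y0; rewrite -subr_ge0.
  have -> : 1 + y + 1 - (1 - 3 * y) * (2 * (1 + y) ^+ 3) =
    y + 12 * y ^+ 2 + 16 * y ^+ 3 + 6 * y ^+ 4 by ring.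
  by rewrite !addr_ge0 ?mulr_ge0 ?exprn_ge0// ltW.
- apply: (le_trans up); rewrite lee_fin ler_pM2r//.
  rewrite /upper_ratio; have h : x l * x l <= x l by rewrite ler_piMl// ltW.
  by move: h xl (x0 l) e0; move: (x l) => y; lra.
Qed.
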